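(* Let $\Psi$ be an affine flow on a vector bundle $B\times H$ with linear part $\Phi$, let $\mathcal{V}_1,\dots,\mathcal{V}_\ell$ be the Selgrade bundles of $\Phi$, and let $\mathcal{V}_i^\infty:=\mathcal{V}_i\times\{0\}\subset B\times H^1$. (i) The Selgrade decomposition of the lifted flow $\Psi^1$ on $B\times H^1$ is given by $$B\times H^1=\mathcal{V}_1^\infty\oplus\cdots\oplus\mathcal{V}_{\ell^+}^\infty\oplus\mathcal{V}_c^1\oplus\mathcal{V}_{\ell^++\ell^0+1}^\infty\oplus\cdots\oplus\mathcal{V}_\ell^\infty$$ for some numbers $\ell^+,\ell^0\ge0$ with $\ell^++\ell^0\le\ell$, and $\mathcal{V}_c^1$ (called the central Selgrade bundle) is the unique Selgrade bundle of $\Psi^1$ having nonvoid intersection with $B\times H^{1,1}$. (ii) The intersection of $\mathcal{V}_c^1$ with the subbundle $B\times H^{1,0}$ is $$\mathcal{V}_c^1\cap(B\times H^{1,0})=\bigoplus_{i=\ell^++1}^{\ell^++\ell^0}\mathcal{V}_i^\infty=:\mathcal{V}_c^\infty.$$ (iii) $\dim\mathcal{V}_c^1=1+\dim\mathcal{V}_c^\infty$, and $\dim\mathcal{V}_c^1=1$ holds if and only if $\mathcal{V}_c^1\cap(B\times H^{1,0})=B\times\{(0_H,0)\}$. (iv) If $h^1(\mathcal{V}_i)=\{(b,\mathbb{P}(x,1))\mid(b,x)\in\mathcal{V}_i\}$ is chain transitive (for $\mathbb{P}\Psi^1$) on the projective Poincaré bundle $B\times\mathbb{P}H^1$, then $\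mathcal{V}_i^\infty\subset\mathcal{V}_c^1$.
   Context: Flows and chains: A flow on a metric space $X$ is a continuous map $\Phi:\mathbb{R}\times X\to X$ with $\Phi_0=\mathrm{id}$, $\Phi_{t+s}=\Phi_t\circ\Phi_s$. For $\varepsilon,T>0$ an $(\varepsilon,T)$-chain from $x$ to $y$ consists of $n\ge1$, $T_0,\dots,T_{n-1}\ge T$ and $x_0=x,x_1,\dots,x_n=y\in X$ with $d(\Phi_{T_i}(x_i),x_{i+1})<\varepsilon$ for $i=0,\dots,n-1$. A set $Y\subset X$ is chain transitive if for all $x,y\in Y$ and all $\varepsilon,T>0$ there is an $(\varepsilon,T)$-chain from $x$ to $y$. A chain recurrent component is a maximal chain transitive set. Order: $\mathcal{M}\preceq\mathcal{M}'$ for chain recurrent components if there are components $\mathcal{M}=\mathcal{N}_0,\dots,\mathcal{N}_n=\mathcal{M}'$ and points $x_1,\dots,x_n$ with $\alpha(x_k)\subset\mathcal{N}_{k-1}$ and $\omega(x_k)\subset\mathcal{N}_k$ ($\alpha$- and $\omega$-limit sets). Linear flows and Selgrade's theorem: $B$ is a compact metric space with a chain transitive flow $\theta$ and $H$ is a real Hilbert space of finite dimension $d$. A linear flow on $B\times H$ is a flow $\Phi_t(b,x)=(\theta_tb,\varphi(t,b,x))$ with $\varphi(t,b,\cdot)$ linear. A subbundle is a closed subset of $B\times H$ intersecting each fiber $\{b\}\times H$ in a linear subspace of constant dimension (its dimension). $\mathbb{P}$ denotes the projections $H\setminus\{0\}\to\mathbb{P}H$ and $B\times(H\setminus\{0\})\to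 B\times\mathbb{P}H$. $\mathbb{P}H$ has the metric $d(\mathbb{P}x,\mathbb{P}y)=\min\{\|\frac{x}{\|x\|}-\frac{y}{\|y\|}\|,\|\frac{x}{\|x\|}+\frac{y}{\|y\|}\|\}$, and $B\times\mathbb{P}H$ the maximum metric. $\Phi$ induces a flow $\mathbb{P}\Phi$ on $B\times\mathbb{P}H$. Selgrade's theorem: $\mathbb{P}\Phi$ has finitely many chain recurrent components, linearly ordered and numbered $\mathcal{M}_1\preceq\dots\preceq\mathcal{M}_\ell$, $1\le\ell\le d$; the sets $\mathcal{V}_i=\{(b,x)\in B\times H\mid x\ne0\Rightarrow(b,\mathbb{P}x)\in\mathcal{M}_i\}$ are subbundles, called the Selgrade bundles, and $B\times H=\mathcal{V}_1\oplus\dots\oplus\mathcal{V}_\ell$ is the Selgrade decomposition. Affine flows: An affine flow on $B\times H$ is a continuous map $\Psi=(\theta,\psi)$ for which there are a linear flow $\Phi=(\theta,\varphi)$ (the linear part) and $f:B\to L^\infty(\mathbb{R},H)$ with $f(b)(t+s)=f(\theta_sb)(t)$ for all $b$ and almost all $t,s$, and $\psi(t,b,x)=\varphi(t,b,x)+\int_0^t\varphi(t-s,\theta_sb,f(b)(s))\,ds$. Its lift is the linear flow on $B\times H^1$, $H^1=H\times\mathbb{R}$ (product Hilbert norm), given by $\Psi^1_t(b,x,r)=(\theta_tb,\varphi(t,b,x)+r\int_0^t\varphi(t-s,\theta_sb,f(b)(s))\,ds,r)$; Selgrade's theorem applies to $\Psi^1$. Notation: $H^{1,0}=H\times\{0\}$,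 $H^{1,1}=H\times(\mathbb{R}\setminus\{0\})$. An empty direct sum of subbundles is the zero bundle. *)

(* Defs.v *)
From HB Require Import structures.
From mathcomp Require Import all_boot all_order all_algebra.
From mathcomp Require Import all_classical all_reals all_analysis.
From mathcomp Require Import ess_sup_inf.
From mathcomp Require Import ring lra.

Set Implicit Arguments.
Unset Strict Implicit.
Unset Printing Implicit Defensive.

Import Order.TTheory GRing.Theory Num.Theory.
Import numFieldNormedType.Exports.

Local Open Scope classical_set_scope.
Local Open Scope ring_scope.

(* Real Hilbert spaces of finite dimension; completeness is automatic. *)
HB.mixin Record NormedModule_isHilbert (R : realType) H
    & NormedModule R H & Vector R H := {
  inner : H -> H -> R ;
  inner_sym : forall x y, inner x y = inner y x ;
  inner_linear : forall a x y z,
    inner (a *: x + y) z = a * inner x z + inner y z ;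
  inner_norm : forall x, inner x x = `|x| ^+ 2
}.

#[short(type="finHilbertType")]
HB.structure Definition FinHilbert (R : realType) :=
  {H of NormedModule R H & Vector R H & NormedModule_isHilbert R H}.

(* H^1 = H x R with the product Hilbert norm.  This is an alias of the product
   type because the library equips products with the maximum norm. *)
Definition hilbert1 (R : realType) (H : finHilbertType R) : Type :=
  (H * R)%type.

Section Hilbert1.
Context {R : realType} (H : finHilbertType R).

HB.instance Definition _ := Vector.copy (hilbert1 H) (H * R)%type.

Definition norm1 (u : hilbert1 H) : R := Num.sqrt (`|u.1| ^+ 2 + u.2 ^+ 2).

Let norm1_ge0 (u : hilbert1 H) : 0 <= `|u.1| ^+ 2 + u.2 ^+ 2.
Proof. by rewrite addr_ge0// sqr_ge0. Qed.

Let minkowski2_sqr (a b c d p q : R) : 0 <= p -> 0 <= q ->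
  p ^+ 2 = a ^+ 2 + b ^+ 2 -> q ^+ 2 = c ^+ 2 + d ^+ 2 ->
  (a + c) ^+ 2 + (b + d) ^+ 2 <= (p + q) ^+ 2.
Proof.
move=> p0 q0 pE qE; have : a * c + b * d <= p * q; last by nra.
apply: le_trans (ler_norm _) _; rewrite -ler_sqr ?nnegrE ?mulr_ge0//.
rewrite real_normK ?num_real// (exprMn 2 p q) pE qE.
by have := sqr_ge0 (a * d - b * c); nra.
Qed.

Let minkowski2 (a b c d : R) :
  Num.sqrt ((a + c) ^+ 2 + (b + d) ^+ 2) <=
  Num.sqrt (a ^+ 2 + b ^+ 2) + Num.sqrt (c ^+ 2 + d ^+ 2).
Proof.
rewrite -ler_sqr ?nnegrE ?sqrtr_ge0 ?addr_ge0 ?sqrtr_ge0//.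
rewrite sqr_sqrtr ?addr_ge0 ?sqr_ge0//.
by apply: minkowski2_sqr; rewrite ?sqrtr_ge0// sqr_sqrtr ?addr_ge0 ?sqr_ge0.
Qed.

Let norm1D (u v : hilbert1 H) : norm1 (u + v) <= norm1 u + norm1 v.
Proof.
apply: le_trans (minkowski2 _ _ _ _); rewrite ler_sqrt ?addr_ge0 ?sqr_ge0//=.
by rewrite lerD2r ler_sqr ?nnegrE ?addr_ge0// ler_normD.
Qed.

Let norm1Z (a : R) (u : hilbert1 H) : norm1 (a *: u) = `|a| * norm1 u.
Proof.
transitivity (Num.sqrt (a ^+ 2 * (`|u.1| ^+ 2 + u.2 ^+ 2))); last first.
  by rewrite sqrtrM ?sqr_ge0// sqrtr_sqr.
rewrite /norm1 /= normrZ mulrDr; congr (Num.sqrt (_ + _)).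
  by rewrite exprMn real_normK ?num_real.
exact: exprMn.
Qed.

Let norm1_eq0 (u : hilbert1 H) : norm1 u = 0 -> u = 0.
Proof.
move=> /eqP; rewrite sqrtr_eq0 => u0.
have u1 : `|u.1| ^+ 2 <= 0 by apply: le_trans u0; rewrite lerDl sqr_ge0.
have u2 : u.2 ^+ 2 <= 0 by apply: le_trans u0; rewrite lerDr sqr_ge0.
have {u1}/eqP u1 : `|u.1| ^+ 2 == 0 by rewrite eq_le u1 sqr_ge0.
have {u2}/eqP u2 : u.2 ^+ 2 == 0 by rewrite eq_le u2 sqr_ge0.
move: u1 u2 => /eqP + /eqP; rewrite !sqrf_eq0 normr_eq0 => /eqP u1 /eqP u2.
by rewrite [u]surjective_pairing u1 u2.
Qed.

HB.instance Definition _ :=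
  @Lmodule_isNormed.Build R (hilbert1 H) norm1 norm1D norm1Z norm1_eq0.

Definition inner1 (u v : hilbert1 H) : R := inner u.1 v.1 + u.2 * v.2.

Let inner1_sym u v : inner1 u v = inner1 v u.
Proof. by rewrite /inner1 inner_sym mulrC. Qed.

Let inner1_linear (a : R) (u v w : hilbert1 H) :
  inner1 (a *: u + v) w = a * inner1 u w + inner1 v w.
Proof. by rewrite /inner1 /= inner_linear /GRing.scale/=; ring. Qed.

Let inner1_norm u : inner1 u u = `|u| ^+ 2.
Proof.
by rewrite /Num.norm/= /norm1 sqr_sqrtr// /inner1 inner_norm -expr2.
Qed.

HB.instance Definition _ := @NormedModule_isHilbert.Build R (hilbert1 H)
  inner1 inner1_sym inner1_linear inner1_norm.

End Hilbert1.

(* The projective space PH; its points are the lines through 0. *)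
Record projspace (R : realType) (H : finHilbertType R) : predArgType :=
  Projspace { pline : {vspace H} ; _ : \dim pline == 1%N }.

Section ProjectiveSpace.
Context {R : realType} {H : finHilbertType R}.
Implicit Types (L : projspace H) (x y : H).

HB.instance Definition _ := [isSub for @pline R H].
HB.instance Definition _ := [Choice of projspace H by <:].

Let projpt_subproof x : x != 0 -> \dim <[x]>%VS == 1%N.
Proof. by move=> x0; rewrite dim_vline x0. Qed.

Definition projpt x (x0 : x != 0) : projspace H :=
  Projspace (projpt_subproof x0).

Definition unit_vec x : H := `|x|^-1 *: x.

(* The formula below does not depend on the choice of representatives, see
   [pdist_projpt]. *)
Definition pdist L1 L2 : R :=
  let u := unit_vec (vpick (pline L1)) in
  let v := unit_vec (vpick (pline L2)) in
  Num.min `|u - v| `|u + v|.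

Let pick_neq0 L : vpick (pline L) != 0.
Proof. by case: L => L /= dL; rewrite vpick0 -dimv_eq0 (eqP dL). Qed.

Let pline_pick L : pline L = <[vpick (pline L)]>%VS.
Proof.
apply/eqP; rewrite eq_sym eqEdim -memvE memv_pick dim_vline pick_neq0.
by case: L => L /= /eqP ->.
Qed.

Let line_unit x : x != 0 -> <[x]>%VS = <[unit_vec x]>%VS.
Proof.
move=> x0; have nx0 : `|x| != 0 by rewrite normr_eq0.
apply/eqP; rewrite eqEsubv -!memvE; apply/andP; split.
  apply/vlineP; exists `|x|.
  by rewrite scalerA divff// scale1r.
by apply/vlineP; exists (`|x|^-1).
Qed.

Let pdistxx L : pdist L L = 0.
Proof. by rewrite /pdist subrr normr0 min_l. Qed.

Let pdist_eq0 L1 L2 : pdist L1 L2 = 0 -> L1 = L2.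
Proof.
rewrite /pdist => d0; apply: val_inj => /=.
rewrite (pline_pick L1) (pline_pick L2).
rewrite (line_unit (pick_neq0 L1)) (line_unit (pick_neq0 L2)).
move: d0; rewrite /Num.min; case: ifP => _ /eqP.
  by rewrite normr_eq0 subr_eq0 => /eqP ->.
rewrite normr_eq0 addr_eq0 => /eqP ->.
apply/eqP; rewrite eqEsubv -!memvE; apply/andP; split.
  by rewrite memvN memv_line.
by rewrite -memvN memv_line.
Qed.

Let pdist_sym L1 L2 : pdist L1 L2 = pdist L2 L1.
Proof. by rewrite /pdist distrC [X in Num.min _ `|X|]addrC. Qed.

Let pdist_triangle L2 L1 L3 : pdist L1 L3 <= pdist L1 L2 + pdist L2 L3.
Proof.
rewrite /pdist; set u := unit_vec _; set w := unit_vec (vpick (pline L3)).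
set v := unit_vec _.
have mm : `|u - w| <= `|u - v| + `|v - w| by exact: ler_distD.
have mp : `|u + w| <= `|u - v| + `|v + w|.
  by have := ler_normD (u - v) (v + w); rewrite addrA subrK.
have pm : `|u + w| <= `|u + v| + `|v - w|.
  by have := ler_normB (u + v) (v - w); rewrite opprB addrCA addrK addrC.
have pp : `|u - w| <= `|u + v| + `|v + w|.
  by have := ler_normB (u + v) (v + w); rewrite opprD addrA addrK.
by rewrite ge_min; case: (leP `|u - v| _) => _; case: (leP `|v - w| _) => _;
  rewrite ?mm ?mp ?pm ?pp ?orbT.
Qed.

HB.instance Definition _ := @isMetric.Build R (projspace H)
  pdist pdistxx pdist_eq0 pdist_sym pdist_triangle.

Let pick_line x : x != 0 ->
  unit_vec (vpick <[x]>%VS) = unit_vec x \/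
  unit_vec (vpick <[x]>%VS) = - unit_vec x.
Proof.
move=> x0; have /vlineP[c cE] := memv_pick <[x]>%VS.
have c0 : c != 0.
  apply: contraNneq x0 => c0; move: cE; rewrite c0 scale0r => /eqP.
  by rewrite vpick0 => /eqP xE; rewrite -memv0 -xE memv_line.
rewrite /unit_vec cE normrZ invfM scalerA mulrAC -scalerA.
case: (ltrgt0P c) => [cp|cn|/eqP]; last by rewrite (negPf c0).
  by left; rewrite mulVf// scale1r.
by right; rewrite invrN mulNr mulVf// scaleN1r.
Qed.

Lemma pdist_projpt x y (x0 : x != 0) (y0 : y != 0) :
  mdist (projpt x0) (projpt y0) =
  Num.min `|unit_vec x - unit_vec y| `|unit_vec x + unit_vec y|.
Proof.
rewrite [LHS]/(pdist _ _) /pdist /=.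
have [->|->] := pick_line x0; have [->|->] := pick_line y0 => //.
- by rewrite opprK minC.
- by rewrite minC -opprD normrN addrC distrC.
- by rewrite opprK -opprD normrN addrC distrC.
Qed.

End ProjectiveSpace.

Section Chains.
Context {R : realType}.

Definition is_flow (X : topologicalType) (Phi : R -> X -> X) : Prop :=
  [/\ continuous (fun p : R * X => Phi p.1 p.2),
      forall x, Phi 0 x = x &
      forall t s x, Phi (t + s) x = Phi t (Phi s x)].

Variables (X : pseudoMetricType R) (Phi : R -> X -> X).

(* [ball x eps y] is [d(x, y) < eps]; on a product it is the ball of the
   maximum metric. *)
Definition eps_chain (eps T : R) (x y : X) : Prop :=
  exists (n : nat) (t : nat -> R) (z : nat -> X),
    [/\ (0 < n)%N, z 0%N = x, z n = y &
        forall i, (i < n)%N ->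
          T <= t i /\ ball (Phi (t i) (z i)) eps (z i.+1)].

Definition chain_transitive (Y : set X) : Prop :=
  forall x y, Y x -> Y y ->
    forall eps T, 0 < eps -> 0 < T -> eps_chain eps T x y.

Definition chain_component (M : set X) : Prop :=
  chain_transitive M /\
  forall N, chain_transitive N -> M `<=` N -> N = M.

Definition omega_limit (x : X) : set X :=
  cluster (Phi t x @[t --> +oo]).

Definition alpha_limit (x : X) : set X :=
  cluster (Phi t x @[t --> -oo]).

Definition component_le (M M' : set X) : Prop :=
  exists (n : nat) (N : nat -> set X) (x : nat -> X),
    [/\ forall k, (k <= n)%N -> chain_component (N k), N 0%N = M, N n = M' &
        forall k, (k < n)%N ->
          alpha_limit (x k) `<=` N k /\ omega_limit (x k) `<=` N k.+1].

End Chains.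

Section Bundles.
Context {R : realType} {B : metricType R} {H : finHilbertType R}.
Implicit Types (V W : set (B * H)) (Ws : seq (set (B * H))).

Definition subbundle (k : nat) V : Prop :=
  closed V /\
  forall b, exists2 U : {vspace H}, \dim U = k &
    [set x | V (b, x)] = [set x | x \in U].

Definition bundle_sum Ws : set (B * H) :=
  [set p | exists2 w : 'I_(size Ws) -> H,
     forall i : 'I_(size Ws), nth set0 Ws i (p.1, w i) & p.2 = \sum_i w i].

(* V is the direct sum of the bundles in the list Ws; for the empty list this
   forces V to be the zero bundle. *)
Definition direct_sum Ws V : Prop :=
  V = bundle_sum Ws /\
  forall b (w : 'I_(size Ws) -> H),
    (forall i : 'I_(size Ws), nth set0 Ws i (b, w i)) -> \sum_i w i = 0 ->
    forall i, w i = 0.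

End Bundles.

Section LinearFlows.
Context {R : realType} {B : metricType R} {H : finHilbertType R}.
Variables (theta : R -> B -> B) (phi : R -> B -> H -> H).

Definition skew_product (t : R) (p : B * H) : B * H :=
  (theta t p.1, phi t p.1 p.2).

Definition linear_flow : Prop :=
  is_flow skew_product /\ forall t b, linear (phi t b).

(* The line spanned by the image of a line; the default value of [insubd] is
   irrelevant for linear flows, whose fiber maps are injective. *)
Definition pflow (t : R) (p : B * projspace H) : B * projspace H :=
  (theta t p.1, insubd p.2 <[phi t p.1 (vpick (pline p.2))]>%VS).

Definition bundle_of (M : set (B * projspace H)) : set (B * H) :=
  [set p | forall x0 : p.2 != 0, M (p.1, projpt x0)].

(* Vs is the list of the Selgrade bundles, numbered according to the order of
   the chain recurrent components. *)
Definition selgrade_bundles (Vs : seq (set (B * H))) : Prop :=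
  exists Ms : seq (set (B * projspace H)),
    [/\ uniq Ms,
        forall M, M \in Ms <-> chain_component pflow M,
        forall i j, (i < j < size Ms)%N ->
          component_le pflow (nth set0 Ms i) (nth set0 Ms j) &
        Vs = [seq bundle_of M | M <- Ms]].

Definition selgrade_decomposition (Vs : seq (set (B * H))) : Prop :=
  [/\ selgrade_bundles Vs,
      forall V, V \in Vs -> exists k, subbundle k V &
      direct_sum Vs setT].

End LinearFlows.

Section AffineFlows.
Context {R : realType} {B : metricType R} {H : finHilbertType R}.

Local Notation mu := (@lebesgue_measure R).

(* An element of L^oo(R, H) is given by a Borel measurable representative. *)
Definition in_Linfty (g : R -> H) : Prop :=
  (forall U : set H, open U -> measurable (g @^-1` U)) /\
  (ess_sup mu (fun t => `|g t|%:E) < +oo)%E.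

(* Componentwise integral of a vector-valued function, independent of the
   basis. *)
Definition vintegral (D : set R) (g : R -> H) : H :=
  \sum_i (\int[mu]_(s in D) coord (vbasis {:H}) i (g s)) *: (vbasis {:H})`_i.

(* Oriented integral from 0 to t. *)
Definition vintegral0 (t : R) (g : R -> H) : H :=
  if 0 <= t then vintegral `[0, t] g else - vintegral `[t, 0] g.

Variables (theta : R -> B -> B) (phi : R -> B -> H -> H) (f : B -> R -> H).

Definition affine_term (t : R) (b : B) : H :=
  vintegral0 t (fun s => phi (t - s) (theta s b) (f b s)).

(* (theta, psi) is an affine flow with linear part (theta, phi) and
   inhomogeneous term f.  The shift identity is required for almost every s and
   then for almost every t, which is weaker than both its validity for almost
   every (t, s) and its validity for every s and almost every t. *)
Definition affine_flow (psi : R -> B -> H -> H) : Prop :=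
  [/\ linear_flow theta phi,
      forall b, in_Linfty (f b),
      forall b, \forall s \ae mu, \forall t \ae mu,
        f b (t + s) = f (theta s b) t,
      continuous (fun p : R * (B * H) => skew_product theta psi p.1 p.2) &
      forall t b x, psi t b x = phi t b x + affine_term t b].

Definition lift_cocycle (t : R) (b : B) (u : hilbert1 H) : hilbert1 H :=
  (phi t b u.1 + u.2 *: affine_term t b, u.2).

Definition H10 : set (B * hilbert1 H) := [set p | p.2.2 = 0].

Definition H11 : set (B * hilbert1 H) := [set p | p.2.2 != 0].

Definition binfty (V : set (B * H)) : set (B * hilbert1 H) :=
  [set p | V (p.1, p.2.1) /\ p.2.2 = 0].

Lemma affine_point_neq0 (x : H) : ((x, 1) : hilbert1 H) != 0.
Proof. by apply/eqP => -[_ /eqP]; rewrite oner_eq0. Qed.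

Definition h1_image (V : set (B * H)) : set (B * projspace (hilbert1 H)) :=
  [set p | exists2 x, V (p.1, x) & p.2 = projpt (affine_point_neq0 x)].

End AffineFlows.

(* Main.v *)
From HB Require Import structures.
Require Import Defs.
From Stdlib Require Import Relation_Operators.
From mathcomp Require Import all_boot all_order all_algebra.
From mathcomp Require Import all_classical all_reals all_analysis.
From mathcomp Require Import ess_sup_inf measurable_realfun ring lra.

Set Implicit Arguments.
Unset Strict Implicit.
Unset Printing Implicit Defensive.

Import Order.TTheory GRing.Theory Num.Theory.
Import numFieldNormedType.Exports.

Local Open Scope classical_set_scope.
Local Open Scope ring_scope.

(** An attractor of the projective flow and its complementary repeller have
linear fibers, and chain transitivity of the base flow forces these fibers to
have constant dimension.  Attractors are therefore totally ordered by dimension,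
and intersecting each one with the repeller of the next smaller one yields the
chain recurrent components; this is Selgrade's theorem, used for both Phi and
Psi^1.

On the invariant hyperplane H x {0} the lift Psi^1 is a copy of Phi, so every
component of PPhi lies in a component of PPsi^1.  Conversely, a component of
PPsi^1 contained in this hyperplane at infinity is still chain transitive there,
since nearby chains are shadowed at infinity, so it is a component of PPhi.  A
component of PPsi^1 that leaves infinity has fibers strictly larger than the sum
of the components of PPhi it contains.  As the fiber dimensions add up to d and
d + 1, exactly one component leaves infinity, and its excess is exactly one.
For (iv), points (x, 1/k) of the bundle converge to (x, 0). *)

(** Attractors are not built as limit sets. A [trap] keeps a uniform margin [e] after time [T], and
    [attr] and [rep] are read off whole orbits; the set reached by chains from a point is itself a
    trap, which ties chains to attractors. Three obstacles shape the rest. Chains between points at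
    infinity may leave infinity; they can be shadowed because each component is an attractor
    intersected with a repeller, and the first condition propagates along a chain forwards from its
    start, the second backwards from its end. Statement (i) needs the components absorbed by the
    central one to form a single block of the list; this holds because an orbit joining two
    components at infinity is also an orbit of PPsi^1, so the position of the absorbing component is
    monotone. Finally, the shift law of [f] holds only almost everywhere, so the cocycle law of the
    lift is first obtained for almost all times and then extended through the continuity of [psi].
    If dim H = 0, the projective space is empty and the empty set is the only component of PPhi;
    this case is treated apart. *)

Lemma ultra_fmap (T U : Type) (f : T -> U) (F : set_system T) :
  UltraFilter F -> UltraFilter (f @ F).
Proof.
move=> FU; split; first exact: fmap_proper_filter.
move=> G GF FG; rewrite eqEsubset; split => // A GA.
have [//|FnA] := in_ultra_setVsetC (f @^-1` A) FU.
have GnA : G (~` A) by exact: FG.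
by have /filter_ex [? []] : G (A `&` ~` A) by exact: filterI.
Qed.

(** Replaces the passage to convergent subsequences: a single ultrafilter makes several functions
    converge at once, without successive extractions. *)
Lemma ultra_cvg (I : Type) (X : topologicalType) (A : set X)
    (F : set_system I) (f : I -> X) :
  UltraFilter F -> compact A -> (forall i, A (f i)) ->
  exists2 y, A y & f @ F --> y.
Proof.
move=> FU; rewrite compact_ultra => cA Af.
have fU := ultra_fmap f FU.
have [|y [Ay fy]] := cA (f @ F) fU; last by exists y.
have : F (f @^-1` A) by apply: filterE => i; exact: Af.
by [].
Qed.

(** The point is that [d] does not depend on [p]. Otherwise bad triples with ever closer [x] and [y]
    accumulate at one point of [K * X], where continuity fails. *)
Lemma uniform_continuity (R : realType) (P : topologicalType)
    (X Y : pseudoMetricType R) (K : set P) (f : P -> X -> Y) :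
  compact K -> compact [set: X] ->
  continuous (fun q : P * X => f q.1 q.2) ->
  forall e, 0 < e -> exists2 d, 0 < d &
    forall p x y, K p -> ball x d y -> ball (f p x) e (f p y).
Proof.
move=> cK cX cf e e0; apply: contrapT => H.
have {}H (n : nat) : exists q : P * (X * X),
    [/\ K q.1, ball q.2.1 n.+1%:R^-1 q.2.2 &
     ~ ball (f q.1 q.2.1) e (f q.1 q.2.2)].
  apply: contrapT => Hn; apply: H; exists n.+1%:R^-1; first by rewrite invr_gt0.
  move=> p x y Kp xy; apply: contrapT => nb; apply: Hn.
  by exists (p, (x, y)).
have [q Hq] := choice H.
have [F [FU FF]] := ultraFilterLemma (F := \oo) _.
have [p Kp pp] := ultra_cvg (f := fun n => (q n).1) FU cK
  (fun n => let: And3 h _ _ := Hq n in h).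
have [x _ xx] := ultra_cvg (f := fun n => (q n).2.1) FU cX (fun=> I).
have yx : (fun n => (q n).2.2) @ F --> x.
  apply/cvg_ballP => r r0.
  have h1 : \forall n \near F, ball x (r / 2) (q n).2.1.
    by move/cvg_ballP : xx; apply; rewrite divr_gt0.
  have h2 : \forall n \near F, n.+1%:R^-1 < r / 2.
    by apply: FF; apply: near_infty_natSinv_lt (PosNum _); rewrite divr_gt0.
  near=> n; apply: (@ball_split _ _ (q n).2.1).
    by near: n.
  have [_ b _] := Hq n.
  by apply: le_ball b; apply/ltW; near: n.
have c1 : (fun n => f (q n).1 (q n).2.1) @ F --> f p x.
  exact: (cvg_comp _ _ (cvg_pair pp xx) (cf (p, x))).
have c2 : (fun n => f (q n).1 (q n).2.2) @ F --> f p x.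
  exact: (cvg_comp _ _ (cvg_pair pp yx) (cf (p, x))).
have e20 : 0 < e / 2 by rewrite divr_gt0.
have [n [b1 b2]] := filter_ex (filterI (cvg_ball c1 e20) (cvg_ball c2 e20)).
by have [_ _] := Hq n; apply; apply: (ball_splitr b1 b2).
Unshelve. all: by end_near.
Qed.

(** * Chains as a transitive closure of single legs *)

Section Reach.
Context {R : realType} {X : pseudoMetricType R} (Phi : R -> X -> X).

Definition step (e T : R) (x y : X) : Prop :=
  exists2 t, T <= t & ball (Phi t x) e y.

(** Gives access to induction on the legs of a chain instead of manipulating indexed families. *)
Lemma eps_chainP (e T : R) (x y : X) :
  eps_chain Phi e T x y <-> clos_trans_1n X (step e T) x y.
Proof.
split.
  move=> [n [t [z [n0 <- <- H]]]].
  suff: forall k, (k < n)%N ->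
      clos_trans_1n X (step e T) (z (n - k.+1)%N) (z n).
    by move=> /(_ n.-1); rewrite prednK// subnn leqnn; apply.
  have S i : (i < n)%N -> step e T (z i) (z i.+1).
    by move=> /H [? ?]; exists (t i).
  elim=> [|k IH] kn.
    by rewrite subn1; apply: t1n_step; rewrite -{2}(prednK n0); apply: S;
      rewrite ltn_predL.
  apply: (@t1n_trans _ _ _ (z (n - k.+1)%N)); last by apply: IH; exact: ltnW.
  by rewrite -(subnSK kn); apply: S; rewrite ltn_subrL.
elim=> [a b [u Tu uB]|a b c [u Tu uB] _ [n [t [z [n0 z0 zn H]]]]].
  exists 1%N, (fun=> u), (fun i => if i == 0%N then a else b).
  by split=> // -[].
exists n.+1, (fun i => if i is j.+1 then t j else u),
  (fun i => if i is j.+1 then z j else a); split=> // -[_|i] /=.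
  by rewrite z0.
by rewrite ltnS; exact: H.
Qed.

Lemma eps_chain_mono (e e' T T' : R) (x y : X) :
  e <= e' -> T' <= T -> eps_chain Phi e T x y -> eps_chain Phi e' T' x y.
Proof.
move=> ee TT [n [t [z [n0 z0 zn H]]]]; exists n, t, z; split=> // i /H[Tt B].
by split; [exact: le_trans Tt|exact: le_ball B].
Qed.

Lemma eps_chain_trans (e T : R) (x y z : X) :
  eps_chain Phi e T x y -> eps_chain Phi e T y z -> eps_chain Phi e T x z.
Proof.
rewrite !eps_chainP; elim=> [a b s|a b c s _ IH] cz; first exact: t1n_trans cz.
by apply: t1n_trans s _; exact: IH.
Qed.

End Reach.

(** * Attractor-repeller pairs *)

Section Trap.
Context {R : realType} {X : pseudoMetricType R} (Phi : R -> X -> X).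
Hypotheses (cX : compact [set: X]) (flowP : is_flow Phi).

Let Phi0 x : Phi 0 x = x. Proof. by case: flowP. Qed.
Let PhiD t s x : Phi (t + s) x = Phi t (Phi s x). Proof. by case: flowP. Qed.

Lemma flow_cvg (I : Type) (F : set_system I) {FF : Filter F} (x : I -> X)
    (y : X) (t : R) :
  x @ F --> y -> (fun i => Phi t (x i)) @ F --> Phi t y.
Proof.
move=> xy; case: flowP => cP _ _.
exact: (cvg_comp _ _ (cvg_pair (cvg_cst t) xy) (cP (t, y))).
Qed.

Lemma flow_near (t : R) (y : X) (e : R) : 0 < e ->
  nbhs y [set z | ball (Phi t y) e (Phi t z)].
Proof. move=> e0; apply: (@cvg_ball _ _ _ (nbhs y) _ (Phi t)) => //.
exact: (flow_cvg (x := id)). Qed.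

(* An e-neighbourhood of the time-t image of U stays in U for all t >= T, so
   that attr U is an attractor and rep U its complementary repeller. *)
Record trap (U : set X) (e T : R) : Prop := Trap {
  trap_e : 0 < e; trap_T : 0 < T;
  trapP : forall x t, U x -> T <= t -> ball (Phi t x) e `<=` U }.

Definition attr (U : set X) : set X := [set x | forall t, U (Phi t x)].
Definition rep (U : set X) : set X := [set x | forall t, ~ U (Phi t x)].

Lemma attr_flow U s x : attr U x -> attr U (Phi s x).
Proof. by move=> Ax t; rewrite -PhiD. Qed.

Lemma rep_flow U s x : rep U x -> rep U (Phi s x).
Proof. by move=> Ax t; rewrite -PhiD. Qed.

Lemma attr_rep U x : attr U x -> rep U x -> False.
Proof. by move=> /(_ 0) + /(_ 0). Qed.

Section OneTrap.
Variables (U : set X) (e T : R).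
Hypothesis tU : trap U e T.
Let e0 := trap_e tU.
Let T0 := trap_T tU.

Lemma trap_later x t s : U (Phi t x) -> t + T <= s -> U (Phi s x).
Proof.
move=> Ux ts; have /trapP := tU => /(_ _ (s - t) Ux); rewrite -PhiD subrK.
by apply; [rewrite lerBrDl|exact: ballxx].
Qed.

Lemma attr_ball x : attr U x -> ball x e `<=` U.
Proof.
move=> Ax; have := trapP tU (Ax (- T)) (lexx T).
by rewrite -PhiD subrr Phi0.
Qed.

(** A trap need be neither open nor closed. Going back by [T] and flowing forward again gains the
    margin [e], which is enough to pass membership to a limit; [trap_near] uses the same margin in
    the other direction. *)
Lemma trap_cvg (I : Type) (F : set_system I) {FF : ProperFilter F}
    (x : I -> X) (y : X) :
  x @ F --> y -> (\forall i \near F, U (Phi (- T) (x i))) ->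
  U y.
Proof.
move=> xy Ux; have [i [Ui bi]] := filter_ex (filterI Ux (cvg_ball xy e0)).
apply: (trapP tU Ui (lexx T)); rewrite -PhiD subrr Phi0.
exact: ball_sym.
Qed.

Lemma trap_near (I : Type) (F : set_system I) {FF : Filter F}
    (x : I -> X) (y : X) :
  x @ F --> y -> U (Phi (- T) y) -> \forall i \near F, U (x i).
Proof.
move=> xy Uy; apply: filterS (cvg_ball xy e0) => i bi.
by apply: (trapP tU Uy (lexx T)); rewrite -PhiD subrr Phi0.
Qed.

Lemma closed_attr : closed (attr U).
Proof.
move=> y cy t; have [x [Ax yx]] := cy _ (flow_near t y e0).
exact: attr_ball (attr_flow t Ax) _ (ball_sym yx).
Qed.

Lemma closed_rep : closed (rep U).
Proof.
move=> y cy t Uy; have [x [Ax yx]] := cy _ (flow_near (T + t) y e0).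
apply: (Ax (T + t)); apply: (trapP tU Uy (lexx T)).
by rewrite -PhiD.
Qed.

Lemma attr_limit (I : Type) (F : set_system I) {FF : ProperFilter F}
    (x : I -> X) (t : I -> R) y :
  t @ F --> +oo -> (\forall i \near F, U (x i)) ->
  (fun i => Phi (t i) (x i)) @ F --> y -> attr U y.
Proof.
move=> too Ux xy s; apply: (trap_cvg (flow_cvg (t := s) xy)).
(* One [T] is the delay after which an orbit stays in [U], the other is the step back in
   [trap_cvg]. *)
have /too := nbhs_pinfty_ge (num_real (T + T - s)).
move=> tT; near=> i; rewrite -!PhiD.
apply: (@trap_later _ 0); first by rewrite Phi0; near: i.
rewrite add0r; have : T + T - s <= t i by near: i.
by move=> ?; lra.
Unshelve. all: by end_near.
Qed.

Lemma rep_limit (I : Type) (F : set_system I) {FF : ProperFilter F}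
    (x : I -> X) (t : I -> R) y :
  t @ F --> +oo ->
  (\forall i \near F, ~ U (Phi (t i) (x i))) -> x @ F --> y -> rep U y.
Proof.
move=> too Ux xy s Uy.
have Ui : \forall i \near F, U (Phi (T + s) (x i)).
  by apply: (trap_near (flow_cvg (t := T + s) xy)); rewrite -PhiD addKr.
have /too tT := nbhs_pinfty_ge (num_real (T + s + T)).
have [i [[Ui1 Ui2] Ui3]] := filter_ex (filterI (filterI Ux Ui) tT).
exact/Ui1/(trap_later Ui2).
Qed.

(** If an alpha-limit point ever entered [U], the orbit of [x] would be in [U] at arbitrarily early
    times, hence also at every later time, including the time [t0] where it is not. *)
Lemma alpha_limit_rep x : ~ attr U x -> alpha_limit Phi x `<=` rep U.
Proof.
move=> /existsNP[t0 nU] y cy s Uy.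
have [z [/= + yz]] : [set Phi t x | t in [set t | t < t0 - T - T - s]] `&`
    [set z | ball (Phi (T + s) y) e (Phi (T + s) z)] !=set0.
  apply: cy; last exact: flow_near.
  have := nbhs_ninfty_lt (num_real (t0 - T - T - s)).
  by rewrite /fmap/=; apply: filterS => t /= tt; exists t.
move=> [t tt zE]; apply: nU.
have Uz : U (Phi (T + s) z).
  by apply: (trapP tU Uy (lexx T)); rewrite -PhiD.
rewrite -zE -PhiD in Uz; apply: (trap_later Uz); lra.
Qed.

Lemma omega_limit_attr x : ~ rep U x -> omega_limit Phi x `<=` attr U.
Proof.
move=> /existsNP[t0 /contrapT Ux] y cy s.
have [z [/= + yz]] : [set Phi t x | t in [set t | t0 + T + T - s < t]] `&`
    [set z | ball (Phi s y) e (Phi s z)] !=set0.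
  apply: cy; last exact: flow_near.
  have := nbhs_pinfty_gt (num_real (t0 + T + T - s)).
  by rewrite /fmap/=; apply: filterS => t /= tt; exists t.
move=> [t tt zE].
have Uz : U (Phi (s - T) z).
  by rewrite -zE -PhiD; apply: (trap_later Ux); lra.
apply: (trapP tU Uz (lexx T)); rewrite -PhiD addrC subrK.
exact: ball_sym.
Qed.

(** The first leg must outlast the visit at time [t0] by [T]; the other legs start in [U] and only
    need duration [T]. *)
Lemma trap_chain x t0 e' T' y : U (Phi t0 x) -> e' <= e -> T <= T' ->
  T + t0 <= T' -> eps_chain Phi e' T' x y -> U y.
Proof.
move=> Ux ee TT tT; rewrite eps_chainP => ch.
have S a b : U a -> step Phi e' T' a b -> U b.
  move=> Ua [t Tt ab]; apply: (trapP tU Ua (le_trans TT Tt)).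
  exact: le_ball ab.
have S0 b : step Phi e' T' x b -> U b.
  move=> [t Tt ab]; apply: (trapP tU Ux (t := t - t0)).
    by rewrite lerBrDr (le_trans tT).
  by rewrite -PhiD subrK; apply: le_ball ab.
have C a b : U a -> clos_trans_1n X (step Phi e' T') a b -> U b.
  move=> + ch'; elim: ch' => [? ? s Ua|? ? ? s _ IH Ua]; first exact: S s.
  by apply: IH; exact: S s.
by case: ch => [b /S0 //|b c /S0 Ub /(C _ _ Ub)].
Qed.

(** Uniform continuity of the time-[s] map only costs a smaller margin. Shifted traps let a
    statement about endpoints of chains become one about their whole orbits. *)
Lemma trap_shift s : exists e', trap [set z | U (Phi s z)] e' T.
Proof.
have [cP _ _] := flowP.
have [d d0 H] := uniform_continuity (@compact_set1 _ s) cX cP e0.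
exists d; split => // x t Ux Tt y xy /=.
apply: (trapP tU Ux Tt); rewrite -PhiD addrC PhiD.
exact: H.
Qed.

End OneTrap.

(** If the orbit of one point of [N] visits [U], it also visits every shift of [U]. Fine chains with
    long legs from that point then end in every shift, so each point of [N] has its whole orbit in
    [U]. *)
Lemma chain_transitive_trap U e T (N : set X) : trap U e T ->
  chain_transitive Phi N -> N `<=` attr U \/ N `<=` rep U.
Proof.
move=> tU cN; have [?|] := pselect (N `<=` rep U); first by right.
move=> /existsNP[x /not_implyP[Nx /existsNP[t0 /contrapT Ux]]].
left=> y Ny s; have [e' tU'] := trap_shift tU s.
have T0 := trap_T tU.
have Ux' : [set z | U (Phi s z)] (Phi (t0 - s) x).
  by rewrite /= -PhiD addrC subrK.
apply: (trap_chain tU' Ux' (lexx _) (T' := Num.max T (T + (t0 - s)))).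
- by rewrite le_max lexx.
- by rewrite le_max lexx orbT.
- by apply: cN => //; [exact: trap_e tU'|rewrite lt_max T0].
Qed.

(** The source of attractors: one more leg extends a chain, so the points reachable from [x] trap
    themselves with the very constants of the chains. *)
Lemma trap_reach e T x : 0 < e -> 0 < T ->
  trap [set y | eps_chain Phi e T x y] e T.
Proof.
move=> e0 T0; split => // y t /= xy Tt z yz.
apply: eps_chain_trans xy _; rewrite eps_chainP.
by apply: t1n_step; exists t.
Qed.

Lemma trap0 : trap set0 1 1. Proof. by split. Qed.

Lemma trapT : trap setT 1 1. Proof. by split. Qed.

Lemma alpha_limit_neq0 x : alpha_limit Phi x !=set0.
Proof.
have [y [_ cy]] := cX (F := Phi t x @[t --> -oo]) _ filterT.
by exists y.
Qed.

Lemma omega_limit_neq0 x : omega_limit Phi x !=set0.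
Proof.
have [y [_ cy]] := cX (F := Phi t x @[t --> +oo]) _ filterT.
by exists y.
Qed.

Lemma cluster_closed (I : Type) (F : set_system I) (x : I -> X) (A : set X) :
  closed A -> (\forall i \near F, A (x i)) -> cluster (x @ F) `<=` A.
Proof.
move=> cA Ax y cy; apply: cA => B nB; exact: cy.
Qed.

End Trap.

(** * Shadowing chains near an isometrically embedded flow *)

Section Embedding.
Context {R : realType} {X X' : pseudoMetricType R}.
Variables (Phi : R -> X -> X) (Phi' : R -> X' -> X') (h : X -> X').
Hypotheses (cX' : compact [set: X']).
Hypotheses (flowP' : is_flow Phi').
Hypothesis h_ball : forall x e y, ball (h x) e (h y) <-> ball x e y.
Hypothesis h_flow : forall t x, h (Phi t x) = Phi' t (h x).

Let Phi'0 x : Phi' 0 x = x. Proof. by case: flowP'. Qed.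
Let Phi'D t s x : Phi' (t + s) x = Phi' t (Phi' s x). Proof. by case: flowP'. Qed.

Lemma chain_transitive_image (N : set X) :
  chain_transitive Phi N -> chain_transitive Phi' (h @` N).
Proof.
move=> cN _ _ [x Nx <-] [y Ny <-] e T e0 T0.
have [n [t [z [n0 z0 zn H]]]] := cN x y Nx Ny e T e0 T0.
exists n, t, (h \o z); split; rewrite /= ?z0 ?zn// => i /H[Tt B].
by rewrite -h_flow h_ball.
Qed.

(* Cutting the legs of a chain into pieces of duration in [T, 2T]. *)
Lemma step_bounded (e T : R) (x y : X') : 0 < e -> 0 < T -> step Phi' e T x y ->
  clos_trans_1n X'
    (fun a b => exists2 t, T <= t <= T + T & ball (Phi' t a) e b) x y.
Proof.
move=> e0 T0 [t Tt]; have [n tn] : exists n : nat, t <= n.+2%:R * T.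
  exists (Num.bound (t / T)); rewrite -ler_pdivrMr//.
  have t0 : 0 <= t by apply: le_trans Tt; exact: ltW.
  apply: le_trans (ltW (archi_boundP _)) _; first by rewrite divr_ge0// ltW.
  by rewrite ler_nat -addn2 leq_addr.
(* For [n = 0] the leg already has length at most [T + T]. Otherwise a piece of length [T] is cut
   off only when more than [T + T] is left, so the remainder is still long enough. *)
elim: n x t Tt tn => [|n IH] x t Tt tn xy.
  by apply: t1n_step; exists t => //; rewrite Tt /=; lra.
have [t2|t2] := leP t (T + T).
  by apply: t1n_step; exists t => //; rewrite Tt.
apply: (@t1n_trans _ _ _ (Phi' T x)).
  exists T; first by rewrite lexx lerDl ltW.
  exact: ballxx.
apply: (IH _ (t - T)); first by lra.
  by move: tn; rewrite -natr1 mulrDl mul1r; lra.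
by rewrite -Phi'D subrK.
Qed.

(** Compactness turns the intersection of attractor and repeller into two conditions at one finite
    time [s]. Unlike closeness to that intersection, each of these conditions is preserved along
    chains, one forwards and one backwards. *)
Lemma trap_squeeze U eU TU W eW TW (O : set X') :
  trap Phi' U eU TU -> trap Phi' W eW TW ->
  (forall I (F : set_system I), ProperFilter F -> forall (z : I -> X') y,
     attr Phi' U y -> rep Phi' W y -> z @ F --> y -> \forall i \near F, O (z i)) ->
  exists s, forall z, U (Phi' (- s) z) -> ~ W (Phi' s z) -> O z.
Proof.
move=> tU tW HO; apply: contrapT => H.
have {}H (n : nat) : exists z,
    [/\ U (Phi' (- n%:R) z), ~ W (Phi' n%:R z) & ~ O z].
  apply: contrapT => Hn; apply: H; exists n%:R => z Uz Wz.
  by apply: contrapT => Oz; apply: Hn; exists z.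
have [z Hz] := choice H.
have [F [FU FF]] := ultraFilterLemma (F := \oo) _.
have [y _ zy] := ultra_cvg (f := z) FU cX' (fun=> I).
have too : (fun n : nat => n%:R : R) @ F --> +oo.
  by move=> A /(@cvgr_idn R); exact: FF.
have Ay : attr Phi' U y.
  apply: (attr_limit flowP' tU (F := F) (x := fun n => Phi' (- n%:R) (z n))
    too).
    by apply: filterE => n; have [] := Hz n.
  have -> : (fun n : nat => Phi' n%:R (Phi' (- n%:R) (z n))) = z => //.
  by apply/funext => n; rewrite -Phi'D subrr Phi'0.
have Ry : rep Phi' W y.
  apply: (rep_limit flowP' tW (F := F) too _ zy).
  by apply: filterE => n; have [] := Hz n.
have [n On] := filter_ex (HO _ _ _ _ _ Ay Ry zy).
by have [] := Hz n.
Qed.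

(* Chains between points of h @^-1` M that leave the image of h stay so close
   to M, hence to the image, that they can be shadowed inside X. *)
Lemma preimage_chain_transitive U eU TU W eW TW :
  trap Phi' U eU TU -> trap Phi' W eW TW ->
  attr Phi' U `&` rep Phi' W `<=` range h ->
  chain_transitive Phi' (attr Phi' U `&` rep Phi' W) ->
  chain_transitive Phi (h @^-1` (attr Phi' U `&` rep Phi' W)).
Proof.
move=> tU tW hM cM x0 y0 Mx0 My0 e T e0 T0.
have cP : continuous (fun p : R * X' => Phi' p.1 p.2) by case: flowP'.
(* Legs of duration [T'] respect both traps. The tolerance [e] is later split in three: jumps of the
   given chain, drift of a shadowing leg, and distance of its endpoint. *)
pose T' := Num.max T (Num.max TU TW).
have TT' : T <= T' by rewrite le_max lexx.
have UT' : TU <= T' by rewrite !le_max lexx orbT.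
have WT' : TW <= T' by rewrite !le_max lexx !orbT.
have T'0 : 0 < T' by exact: lt_le_trans TT'.
apply: (eps_chain_mono (lexx e) TT').
have e30 : 0 < e / 3 by rewrite divr_gt0.
have [d d0 Hd] :=
  uniform_continuity (segment_compact (a := T') (b := T' + T')) cX' cP e30.
pose r := Num.min d (e / 3).
have r0 : 0 < r by rewrite lt_min d0.
pose O := [set z | exists p, ball z r (h p)].
have [s Hs] : exists s, forall z, U (Phi' (- s) z) -> ~ W (Phi' s z) -> O z.
  apply: (trap_squeeze tU tW) => I F FF z y Ay Ry zy.
  have [p _ hp] : range h y by apply: hM.
  apply: filterS (cvg_ball zy r0) => i bi.
  by exists p; rewrite hp; exact: ball_sym.
have [eU' tU'] := trap_shift cX' flowP' tU (- s).
have [eW' tW'] := trap_shift cX' flowP' tW s.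
pose q := Num.min (e / 3) (Num.min eU' eW').
have q0 : 0 < q by rewrite !lt_min e30 (trap_e tU') (trap_e tW').
have qe : q <= e / 3 by rewrite ge_min lexx.
have qU : q <= eU' by rewrite !ge_min lexx orbT.
have qW : q <= eW' by rewrite !ge_min lexx !orbT.
(* The upper bound on the duration is what allows the single modulus [d], valid on a compact time
   interval, to control the drift of every leg. *)
pose bs a b := exists2 t, T' <= t <= T' + T' & ball (Phi' t a) q b.
have bsU a b : bs a b -> U (Phi' (- s) a) -> U (Phi' (- s) b).
  move=> [t /andP[Tt _] ab] Ua; apply: (trapP tU' Ua (le_trans UT' Tt)).
  exact: le_ball ab.
have bsW a b : bs a b -> W (Phi' s a) -> W (Phi' s b).
  move=> [t /andP[Tt _] ab] Ua; apply: (trapP tW' Ua (le_trans WT' Tt)).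
  exact: le_ball ab.
have ch : clos_trans_1n X' bs (h x0) (h y0).
  have /eps_chainP := cM _ _ Mx0 My0 q T' q0 T'0.
  elim=> [a b|a b c /(step_bounded q0 T'0) ab _]; first exact: step_bounded.
  move=> bc; elim: ab bc => [? ? ?|? ? ? ? _ IH] bc; first exact: t1n_trans bc.
  by apply: t1n_trans (IH bc); eassumption.
have sh p t b p' : T' <= t <= T' + T' -> ball (Phi' t (h p)) (e / 3 + q) b ->
    ball b r (h p') -> step Phi e T' p p'.
  move=> /andP[Tt _] pb bp; exists t => //; rewrite -h_ball h_flow.
  apply: le_ball (ball_triangle pb bp).
  have : r <= e / 3 by rewrite ge_min lexx orbT.
  by lra.
(* The induction invariant: not one shadow of [a] but all points [p] with [h p] close to [a] are
   reached from [x0] inside [X], so the choice of shadow is free at the next leg. *)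
pose Q a := [/\ U (Phi' (- s) a), O a &
  forall p, ball a r (h p) -> eps_chain Phi e T' x0 p].
have bsQ a b : bs a b -> ~ W (Phi' s b) -> a = h x0 \/ Q a -> Q b.
  move=> ab Wb Pa.
  have Ub : U (Phi' (- s) b).
    by apply: bsU ab _; have [->|[]] := Pa => //; exact: (Mx0.1).
  split => //; first exact: Hs.
  move=> p' bp'; have [t tT tab] := ab.
  have [aE|[_ [p ap] Pa']] := Pa.
    rewrite eps_chainP; apply: t1n_step; apply: (sh _ t b) => //.
    by rewrite -aE; apply: le_ball tab; rewrite lerDr ltW.
  apply: eps_chain_trans (Pa' _ ap) _; rewrite eps_chainP; apply: t1n_step.
  apply: (sh _ t b) => //; apply: ball_triangle tab.
  apply: ball_sym; apply: Hd => //=.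
  by apply: le_ball ap; rewrite ge_min lexx.
(* Only the end of the chain is known to avoid [W] at time [s]. An intermediate point failing this
   would drag the end into [W], so all of them avoid it. *)
have fin a b : clos_trans_1n X' bs a b -> ~ W (Phi' s b) ->
    a = h x0 \/ Q a -> Q b.
  elim=> [? ? ab Wb|{}a b' c ab bc IH Wc Pa]; first exact: bsQ ab Wb.
  apply: (IH) => //; right; apply: bsQ ab _ Pa => Wb'; apply: Wc.
  elim: bc Wb' => [? ? ab' Wb'|? ? ? ab' _ IH' Wb']; first exact: bsW ab' Wb'.
  by apply: IH'; exact: bsW ab' Wb'.
have [||_ _] := fin _ _ ch; [exact: (My0.2)|by left|].
by apply; exact: ballxx.
Qed.

End Embedding.

(** * Finite-dimensional Hilbert spaces and projective space *)

Section FiniteDimension.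
Context {R : realType} {H : finHilbertType R}.
Local Notation n := (\dim {:H}).
Local Notation e := (vbasis {:H}).

Let lc (a : 'rV[R]_n) : H := \sum_i a ord0 i *: e`_i.

Let lc_cvg (I : Type) (F : set_system I) {FF : Filter F} (a : I -> 'rV[R]_n) b :
  a @ F --> b -> (fun i => lc (a i)) @ F --> lc b.
Proof.
move=> ab; apply: cvg_big => [|i _]; first exact: add_continuous.
apply: cvgZ; last exact: cvg_cst.
apply: (cvg_comp _ (fun M : 'rV[R]_n => M ord0 i) ab).
exact: coord_continuous.
Qed.

Let lc_coord x : lc (\row_i coord e i x) = x.
Proof.
rewrite [RHS](coord_vbasis (memvf x)); apply: eq_bigr => i _.
by rewrite mxE.
Qed.

Let lc_eq0 a : lc a = 0 -> a = 0.
Proof.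
move=> a0; apply/rowP => i; rewrite mxE.
have /freeP := basis_free (vbasisP {:H}).
by move/(_ (a ord0) a0 i).
Qed.

Let crow x : 'rV[R]_n := \row_i coord e i x.

Let crowZ a x : crow (a *: x) = a *: crow x.
Proof. by apply/rowP => i; rewrite !mxE linearZ. Qed.

Let sphere_rV : compact [set a : 'rV[R]_n | `|a| = 1].
Proof.
apply: bounded_closed_compact.
  exists 1; split; first exact: num_real.
  by move=> M M1 a /= ->; exact: ltW.
apply: (@preimage_closed _ _ (fun a : 'rV[R]_n => `|a|) [set x | x = 1]) => [a _|].
  exact: norm_continuous.
exact: closed_eq.
Qed.

(** Equivalence of norms. Otherwise coordinate rows of norm 1 would represent vectors tending to 0;
    a limit row would have norm 1 and represent 0, against the independence of the basis. *)
Let crow_bound : exists2 C, 0 < C & forall x, `|crow x| <= C * `|x|.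
Proof.
apply: contrapT => Hc.
have {}Hc (k : nat) : exists x, k.+1%:R * `|x| < `|crow x|.
  apply: contrapT => Hk; apply: Hc; exists k.+1%:R => // x.
  by rewrite leNgt; apply/negP => ?; apply: Hk; exists x.
have [x Hx] := choice Hc.
have cx0 k : `|crow (x k)| != 0.
  by rewrite gt_eqF//; apply: le_lt_trans (Hx k); rewrite mulr_ge0.
have nx k : `| `|crow (x k)|^-1 *: crow (x k)| = 1.
  by rewrite normrZ normfV normr_id mulVf.
have [F [FU FF]] := ultraFilterLemma (F := \oo) _.
have [a a1 xa] := ultra_cvg FU sphere_rV nx.
suff a0 : a = 0 by move: a1; rewrite a0 /= normr0 => /eqP; rewrite eq_sym oner_eq0.
apply: lc_eq0; have lca : lc (`|crow (x k)|^-1 *: crow (x k)) @[k --> F] --> lc a by exact: lc_cvg.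
apply: (norm_cvg_unique lca).
apply/cvgr0Pnorm_lt => r r0; near=> k.
rewrite -crowZ lc_coord normrZ normfV normr_id.
rewrite ltr_pdivrMl ?lt_def ?cx0 ?normr_ge0//.
suff : k.+1%:R^-1 < r.
  rewrite -[ltLHS]mul1r ltr_pdivrMr// => rk.
  have := Hx k; rewrite mulrC => xk; have x0 := normr_ge0 (x k).
  have kp : 0 < k.+1%:R :> R by [].
  nra.
near: k; apply: FF; exact: (near_infty_natSinv_lt (PosNum r0)).
Unshelve. all: by end_near.
Qed.

Lemma coord_bound : exists2 C, 0 < C & forall (i : 'I_n) (x : H),
  `|coord e i x| <= C * `|x|.
Proof.
have [C C0 HC] := crow_bound; exists C => // i x.
apply: le_trans (HC x); rewrite [leRHS]mx_normrE.
apply: le_trans (le_bigmax_cond _ _ (j := (ord0, i)) _); first by rewrite mxE.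
by [].
Qed.

Lemma coord_continuous_fin (i : 'I_n) : continuous (fun x : H => coord e i x).
Proof.
have [C C0 ci] := coord_bound.
move=> x; apply/cvgrPdist_lt => r r0; near=> y.
rewrite -linearB; apply: le_lt_trans (ci _ _) _.
rewrite -ltr_pdivlMl//; near: y; apply: cvgr_dist_lt => //.
by rewrite mulr_gt0// invr_gt0.
Unshelve. all: by end_near.
Qed.

Lemma unit_ball_compact : compact [set x : H | `|x| <= 1].
Proof.
have [C C0 HC] := crow_bound.
have cB : compact [set a : 'rV[R]_n | `|a| <= C].
  apply: bounded_closed_compact.
    exists C; split; first exact: num_real.
    by move=> M M1 a /= aC; rewrite (le_trans aC)// ltW.
  apply: (@preimage_closed _ _ (fun a : 'rV[R]_n => `|a|) [set x | x <= C]) => [a _|].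
    exact: norm_continuous.
  exact: closed_le.
rewrite compact_ultra => F FU F1.
(* Truncated because [ultra_cvg] wants every value in the compact set; along [F] the bound holds and
   the default 0 is never taken. *)
pose c x : 'rV[R]_n := if `|crow x| <= C then crow x else 0.
have [a _ ca] : exists2 a, `|a| <= C & c @ F --> a.
  apply: (ultra_cvg FU cB) => x /=; rewrite /c; case: ifP => // _.
  by rewrite normr0 ltW.
have xa : id @ F --> lc a.
  have : (fun x => lc (c x)) @ F --> lc a by exact: lc_cvg.
  apply: cvg_trans; apply: near_eq_cvg; near=> x.
  have x1 : `|x| <= 1 by near: x.
  rewrite /c; have /le_trans-> := HC x; first by rewrite lc_coord.
  by rewrite -[leRHS]mulr1 ler_pM2l.
exists (lc a); split => //.
apply: (@closed_cvg _ _ F _ (fun x => `|x|) [set x | x <= 1]) => //.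
exact: (cvg_norm xa).
Unshelve. all: by end_near.
Qed.

Lemma sphere_compact : compact [set x : H | `|x| = 1].
Proof.
apply: subclosed_compact unit_ball_compact _ => [|x /= ->//].
apply: (@preimage_closed _ _ (fun a : H => `|a|) [set x | x = 1]) => [a _|].
  exact: norm_continuous.
exact: closed_eq.
Qed.

Lemma linear_continuous_fin (V : normedModType R) (g : {linear H -> V}) :
  continuous g.
Proof.
move=> x; have gE : g = (fun x => \sum_i coord e i x *: g e`_i) :> (H -> V).
  apply/funext => y; rewrite {1}(coord_vbasis (memvf y)) linear_sum.
  by apply: eq_bigr => i _; rewrite linearZ.
rewrite gE; apply: cvg_big => [|i _]; first exact: add_continuous.
by apply: cvgZ; [exact: coord_continuous_fin|exact: cvg_cst].
Qed.

Lemma closed_vspace (U : {vspace H}) : closed [set x | x \in U].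
Proof.
pose g := (\1 - projv U)%VF.
have -> : [set x | x \in U] = g @^-1` [set 0].
  apply/seteqP; split => x /=; rewrite lfunE /= opp_lfunE id_lfunE.
    by move=> xU; rewrite projv_id ?subrr.
  by move/eqP; rewrite subr_eq0 => /eqP ->; exact: memv_proj.
apply: preimage_closed => [x _|]; first exact: linear_continuous_fin.
exact/accessible_closed_set1/hausdorff_accessible/norm_hausdorff.
Qed.

End FiniteDimension.

Section Projective.
Context {R : realType} {H : finHilbertType R}.
Implicit Types (L : projspace H) (x y : H).

Lemma projpt_eq x y (x0 : x != 0) (y0 : y != 0) c :
  y = c *: x -> projpt y0 = projpt x0.
Proof.
move=> yE; apply: val_inj => /=; apply/eqP.
by rewrite eqEdim !dim_vline x0 y0 -memvE leqnn andbT yE memvZ ?memv_line.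
Qed.

Lemma projpt_inj x y (x0 : x != 0) (y0 : y != 0) :
  projpt x0 = projpt y0 -> exists2 c, c != 0 & x = c *: y.
Proof.
move=> /(congr1 (fun L => x \in pline L)) /=; rewrite memv_line.
move=> /esym/vlineP[c xE]; exists c => //.
by apply: contraNneq x0 => c0; rewrite xE c0 scale0r.
Qed.

Lemma norm_neq0 x : `|x| = 1 -> x != 0.
Proof. by move=> x1; rewrite -normr_eq0 x1 oner_eq0. Qed.

Lemma unit_vec_norm x : x != 0 -> `|unit_vec x| = 1.
Proof. by move=> x0; rewrite normrZ normfV normr_id mulVf ?normr_eq0. Qed.

Lemma unit_vecE x : `|x| = 1 -> unit_vec x = x.
Proof. by move=> x1; rewrite /unit_vec x1 invr1 scale1r. Qed.

Lemma projptP L : exists2 x, `|x| = 1 & forall x0 : x != 0, projpt x0 = L.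
Proof.
have p0 : vpick (pline L) != 0.
  by case: L => L /= dL; rewrite vpick0 -dimv_eq0 (eqP dL).
exists (unit_vec (vpick (pline L))); first exact: unit_vec_norm.
move=> x0; rewrite (projpt_eq p0 x0 (c := `|vpick (pline L)|^-1))//.
apply: val_inj => /=; apply/eqP; rewrite eqEdim -memvE memv_pick dim_vline p0.
by case: L {p0 x0} => L /= /eqP ->.
Qed.

Lemma mdist_projpt_le x y (x0 : x != 0) (y0 : y != 0) :
  mdist (projpt x0) (projpt y0) <= `|unit_vec x - unit_vec y|.
Proof. by rewrite pdist_projpt ge_min lexx. Qed.

(** The sign of the unit representative is chosen so that the minimum in the metric is attained;
    closeness of lines thereby becomes closeness of vectors. *)
Lemma projpt_lift x (x0 : x != 0) L : `|x| = 1 ->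
  exists2 y, `|y| = 1 &
    `|x - y| = mdist (projpt x0) L /\ forall y0 : y != 0, projpt y0 = L.
Proof.
move=> x1; have [y y1 yL] := projptP L; have y0 := norm_neq0 y1.
rewrite -(yL y0) pdist_projpt !unit_vecE// minEle; case: ifP => _.
  by exists y => //; split => // z0; rewrite (bool_irrelevance z0 y0).
exists (- y); first by rewrite normrN.
split; first by rewrite opprK.
by move=> z0; apply: (projpt_eq _ _ (c := -1)); rewrite scaleN1r.
Qed.

Lemma cvg_projpt (I : Type) (F : set_system I) {FF : Filter F} (x : I -> H)
    (L : I -> projspace H) y (y0 : y != 0) :
  x @ F --> y ->
  (\forall i \near F, forall x0 : x i != 0, L i = projpt x0) ->
  L @ F --> projpt y0.
Proof.
move=> xy Lx.
have uxy : (fun i => unit_vec (x i)) @ F --> unit_vec y.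
  apply: (cvgZ _ xy); apply: cvgV; first by rewrite normr_eq0.
  exact: cvg_norm.
apply/cvg_ballP => e e0; rewrite ballEmdist.
near=> i; have xi0 : x i != 0.
  near: i; have /cvgr_norm_gt := xy => /(_ 0).
  by rewrite normr_gt0 => /(_ y0); apply: filterS => i; rewrite normr_gt0.
rewrite /= (near Lx i _ xi0)//; apply: le_lt_trans (mdist_projpt_le _ _) _.
by near: i; exact: cvgr_dist_lt.
Unshelve. all: by end_near.
Qed.

Lemma projspace_compact : compact [set: projspace H].
Proof.
rewrite compact_ultra => F FU _.
have [r Hr] := choice (fun L => let: ex_intro2 x h1 h2 := projptP L in
  ex_intro (fun x => `|x| = 1 /\ forall x0 : x != 0, projpt x0 = L) x (conj h1 h2)).
have [y y1 ry] := ultra_cvg FU sphere_compact (fun L => (Hr L).1).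
exists (projpt (norm_neq0 y1)); split => //.
apply: (@cvg_projpt _ F _ r id) => //; apply: nearW => L x0.
by have [_ ->] := Hr L.
Qed.

End Projective.

Section Vspaces.
Context {R : realType} {H : finHilbertType R}.

Lemma cap_neq0 (U V : {vspace H}) : (\dim {:H} < \dim U + \dim V)%N ->
  exists2 x, `|x| = 1 & x \in U /\ x \in V.
Proof.
move=> dUV; set x := vpick (U :&: V)%VS.
have x0 : x != 0.
  rewrite vpick0 -dimv_eq0 -lt0n -(ltn_add2l (\dim (U + V))) dimv_sum_cap addn0.
  by apply: leq_ltn_trans dUV; rewrite dimvS// subvf.
exists (unit_vec x); first exact: unit_vec_norm.
by have := memv_pick (U :&: V); rewrite memv_cap => /andP[xU xV];
  rewrite !memvZ.
Qed.

(** Take a subspace inside [P] of maximal dimension; adding the line of any further [x] in [P]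
    cannot enlarge it. *)
Lemma vspace_of_pred (P : H -> Prop) : P 0 ->
  (forall x y, P x -> P y -> P (x + y)) -> (forall a x, P x -> P (a *: x)) ->
  exists U : {vspace H}, forall x, P x <-> x \in U.
Proof.
move=> P0 PD PZ.
pose Q k := `[< exists2 U : {vspace H}, \dim U = k & forall x, x \in U -> P x >].
have Q0 : exists k, Q k.
  by exists 0%N; apply/asboolP; exists 0%VS; rewrite ?dimv0// => x; rewrite memv0 => /eqP ->.
have Qle k : Q k -> (k <= \dim {:H})%N.
  by move=> /asboolP[U <- _]; rewrite dimvS// subvf.
have [k /asboolP[U Uk UP] kmax] := ex_maxnP Q0 Qle.
exists U => x; split => [Px|]; last exact: UP.
have : Q (\dim (U + <[x]>)).
  apply/asboolP; exists (U + <[x]>)%VS => // y /memv_addP[u uU [v /vlineP[a ->] ->]].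
  by apply: PD; [exact: UP|exact: PZ].
move=> /kmax; rewrite -Uk => dU.
have /eqP -> : (U == U + <[x]>)%VS by rewrite eqEdim addvSl.
by apply: (subvP (addvSr U <[x]>)); exact: memv_line.
Qed.

(** Both families are divided by the larger of the two norms. The common factor keeps linear
    combinations meaningful in the limit, and the normalisation prevents both limits from
    vanishing. *)
Lemma ultra_pair (I : Type) (F : set_system I) (FU : UltraFilter F) (x y : I -> H) :
  (forall i, x i != 0 \/ y i != 0) ->
  exists (m : I -> R) (x' y' : H), [/\ forall i, m i != 0,
    (fun i => m i *: x i) @ F --> x', (fun i => m i *: y i) @ F --> y' &
    x' != 0 \/ y' != 0].
Proof.
move=> xy0; pose m i := (Num.max `|x i| `|y i|)^-1.
have M0 i : 0 < Num.max `|x i| `|y i|.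
  by rewrite lt_max !normr_gt0; case: (xy0 i) => ->; rewrite ?orbT.
have nm i : `|m i| = m i by rewrite ger0_norm// invr_ge0 ltW.
have mx i : `|m i *: x i| <= 1.
  by rewrite normrZ nm ler_pdivrMl// mulr1 le_max lexx.
have my i : `|m i *: y i| <= 1.
  by rewrite normrZ nm ler_pdivrMl// mulr1 le_max lexx orbT.
have [x' _ mx'] := ultra_cvg FU unit_ball_compact mx.
have [y' _ my'] := ultra_cvg FU unit_ball_compact my.
exists m, x', y'; split => // [i|]; first by rewrite invr_neq0// gt_eqF.
have lim1 (z : I -> H) z' : (fun i => m i *: z i) @ F --> z' ->
    (\forall i \near F, `|m i *: z i| = 1) -> z' != 0.
  move=> zz' z1; rewrite -normr_eq0.
  suff -> : `|z'| = 1 by rewrite oner_eq0.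
  apply: (norm_cvg_unique (F := (fun i => `|m i *: z i|) @ F)).
    exact: cvg_norm.
  have : (fun=> 1 : R) @ F --> (1 : R) by exact: cvg_cst.
  by apply: cvg_trans; apply: near_eq_cvg; apply: filterS z1 => i ->.
(* The ultrafilter decides which of the two vectors carries the maximum. *)
have [Fx|Fx] := in_ultra_setVsetC [set i | `|m i *: x i| = 1] FU.
  by left; apply: lim1 mx' Fx.
right; apply: lim1 my' _; apply: filterS Fx => i /= nx.
have := M0 i; move: nx; rewrite !normrZ nm /m.
case: (leP `|x i| `|y i|) => xy nx M; first by rewrite mulVf ?gt_eqF.
by exfalso; apply: nx; rewrite mulVf ?gt_eqF.
Qed.

End Vspaces.

(** * Linear flows and their attractor bundles *)

Section LinearFlow.
Context {R : realType} {B : metricType R} {H : finHilbertType R}.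
Variables (theta : R -> B -> B) (phi : R -> B -> H -> H).
Hypotheses (cB : compact [set: B]) (lf : linear_flow theta phi).
Local Notation X := (B * projspace H)%type.
Local Notation pf := (pflow theta phi).
Implicit Types (A : set X) (b : B) (x y : H) (t s : R).

Lemma theta0 b : theta 0 b = b.
Proof. by case: lf => -[_ /(_ (b, 0)) + _] _ => -[]. Qed.

Lemma thetaD t s b : theta (t + s) b = theta t (theta s b).
Proof. by case: lf => -[_ _ /(_ t s (b, 0))] + _ => -[]. Qed.

Lemma phi0 b x : phi 0 b x = x.
Proof. by case: lf => -[_ /(_ (b, x)) + _] _ => -[]. Qed.

Lemma phiD t s b x : phi (t + s) b x = phi t (theta s b) (phi s b x).
Proof. by case: lf => -[_ _ /(_ t s (b, x))] + _ => -[]. Qed.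

Lemma skew_cvg (I : Type) (F : set_system I) {FF : Filter F} (t : I -> R)
    (b : I -> B) (x : I -> H) t' b' x' :
  t @ F --> t' -> b @ F --> b' -> x @ F --> x' ->
  (fun i => theta (t i) (b i)) @ F --> theta t' b' /\
  (fun i => phi (t i) (b i) (x i)) @ F --> phi t' b' x'.
Proof.
move=> tt bb xx; case: lf => -[cP _ _] _.
have c : (fun i => skew_product theta phi (t i) (b i, x i)) @ F -->
    (theta t' b', phi t' b' x').
  exact: (cvg_comp _ _ (cvg_pair tt (cvg_pair bb xx)) (cP (t', (b', x')))).
split; first exact: (cvg_comp _ (@fst B H) c cvg_fst).
exact: (cvg_comp _ (@snd B H) c cvg_snd).
Qed.

Lemma phi_add t b x y : phi t b (x + y) = phi t b x + phi t b y.
Proof. by case: lf => _ /(_ t b 1 x y); rewrite !scale1r. Qed.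

Lemma phi_zero t b : phi t b 0 = 0.
Proof. by apply: (addrI (phi t b 0)); rewrite -phi_add !addr0. Qed.

Lemma phi_scale t b a x : phi t b (a *: x) = a *: phi t b x.
Proof. by case: lf => _ /(_ t b a x 0); rewrite phi_zero !addr0. Qed.

Lemma phi_eq0 t b x : (phi t b x == 0) = (x == 0).
Proof.
apply/eqP/eqP => [h|->]; last exact: phi_zero.
by rewrite -(phi0 b x) -(addNr t) phiD h phi_zero.
Qed.

Lemma phi_img t b (W : {vspace H}) : exists W' : {vspace H}, \dim W' = \dim W /\
  forall x', x' \in W' -> exists2 x, x \in W & x' = phi t b x.
Proof.
pose g : {linear H -> H} := HB.pack (phi t b) (GRing.isLinear.Build _ _ _ _ (phi t b) (lf.2 t b)).
exists (linfun g @: W)%VS; split.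
  apply: limg_dim_eq; apply/eqP; rewrite -subv0; apply/subvP => x.
  rewrite memv_cap memv_ker lfunE /= => /andP[_].
  by rewrite phi_eq0 memv0.
by move=> x' /memv_imgP[x xW ->]; exists x => //; rewrite lfunE.
Qed.

Lemma pflowE t b x (x0 : x != 0) (y0 : phi t b x != 0) :
  pf t (b, projpt x0) = (theta t b, projpt y0).
Proof.
rewrite /pflow /=; congr (_, _); apply: val_inj => /=.
have /vlineP[c cE] := memv_pick <[x]>%VS.
have c0 : c != 0.
  apply: contraNneq x0 => c0; move: cE; rewrite c0 scale0r => /eqP.
  by rewrite vpick0 -dimv_eq0 dim_vline; case: (x == 0).
have lE : <[phi t b (vpick <[x]>)]>%VS = <[phi t b x]>%VS.
  rewrite cE phi_scale; apply/eqP.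
  by rewrite eqEdim !dim_vline scaler_eq0 negb_or c0 y0 -memvE memvZ ?memv_line.
by rewrite lE val_insubd dim_vline y0.
Qed.

Lemma pflow_flow : is_flow pf.
Proof.
split.
- move=> [t0 [b0 L0]]; have [u0 u01 u0L] := projptP L0.
  have u00 := norm_neq0 u01.
  (* Representatives adapted to the single line [L0]: they depend continuously on the line at [L0],
     which is all that continuity at this point needs. *)
  have L (L : projspace H) : exists y, `|y| = 1 /\
      (`|u0 - y| = mdist L0 L /\ forall y0 : y != 0, projpt y0 = L).
    have [y y1 yL] := projpt_lift u00 L u01.
    by exists y; split => //; rewrite -(u0L u00).
  have [u Hu] := choice L.
  pose F := nbhs ((t0, (b0, L0)) : R * X).
  have ut : (fun p : R * X => p.1) @ F --> t0 by exact: cvg_fst.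
  have uL : (fun p : R * X => p.2.2) @ F --> L0.
    by apply: (cvg_comp _ _ cvg_snd); exact: cvg_snd.
  have ub : (fun p : R * X => p.2.1) @ F --> b0.
    by apply: (cvg_comp _ _ cvg_snd); exact: cvg_fst.
  have uu : (fun p : R * X => u p.2.2) @ F --> u0.
    apply/cvgrPdist_lt => e e0; have /cvg_ballP/(_ e e0) := uL.
    by apply: filterS => p; rewrite ballEmdist /= (Hu p.2.2).2.1.
  have [c1 c2] := skew_cvg ut ub uu.
  have phi00 : phi t0 b0 u0 != 0 by rewrite phi_eq0.
  have E : pf t0 (b0, L0) = (theta t0 b0, projpt phi00).
    by rewrite -(pflowE u00)/= -(u0L u00).
  rewrite /continuous_at [X in _ --> X]E.
  suff c3 : (fun p : R * X => (pf p.1 p.2).2) @ F --> projpt phi00.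
    exact: (cvg_pair c1 c3).
  apply: (cvg_projpt c2); apply: nearW => -[t [b L1]] /= x0.
  have [u1 [_ uL1]] := Hu L1; have un0 := norm_neq0 u1.
  rewrite -[X in insubd X](uL1 un0) -[in X in insubd _ X](uL1 un0).
  by rewrite -[LHS]/(pf t (b, projpt un0)).2 (pflowE un0 x0).
- move=> [b L]; have [x x1 xL] := projptP L; have x0 := norm_neq0 x1.
  rewrite -(xL x0) pflowE ?phi_eq0// => y0; rewrite theta0; congr (_, _).
  by apply: (projpt_eq _ _ (c := 1)); rewrite scale1r phi0.
move=> t s [b L]; have [x x1 xL] := projptP L; have x0 := norm_neq0 x1.
have y0 : phi s b x != 0 by rewrite phi_eq0.
have z0 : phi t (theta s b) (phi s b x) != 0 by rewrite phi_eq0.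
have w0 : phi (t + s) b x != 0 by rewrite phi_eq0.
rewrite -(xL x0) (pflowE x0 w0) (pflowE x0 y0) (pflowE y0 z0) thetaD.
by congr (_, _); apply: (projpt_eq _ _ (c := 1)); rewrite scale1r phiD.
Qed.

Lemma bundle_space_compact : compact [set: X].
Proof.
rewrite -setXTT; apply: compact_setX => //; exact: projspace_compact.
Qed.

End LinearFlow.

Section Fibers.
Context {R : realType} {B : metricType R} {H : finHilbertType R}.
Implicit Types V : set (B * H).

(* The fiber of V over b, with junk value 0 if it is not a linear subspace. *)
Definition fib V (b : B) : {vspace H} :=
  xget 0%VS [set U : {vspace H} | forall x, V (b, x) <-> x \in U].

Lemma fib_eq V b (U : {vspace H}) :
  (forall x, V (b, x) <-> x \in U) -> fib V b = U.
Proof.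
move=> HU; have h : forall x, V (b, x) <-> x \in fib V b.
  by rewrite /fib; case: xgetP => [W -> //|/(_ U)].
by apply/vspaceP => x; apply/idP/idP => ?; [apply/HU/h|apply/h/HU].
Qed.

Definition linear_fibers V := forall b x, V (b, x) <-> x \in fib V b.

End Fibers.

Section AttractorBundles.
Context {R : realType} {B : metricType R} {H : finHilbertType R}.
Variables (theta : R -> B -> B) (phi : R -> B -> H -> H).
Hypotheses (cB : compact [set: B]) (lf : linear_flow theta phi).
Local Notation X := (B * projspace H)%type.
Local Notation pf := (pflow theta phi).
Implicit Types (A : set X) (b : B) (x y : H) (t s : R).

Let fP : is_flow pf := pflow_flow lf.

Lemma bundle_ofE A b x (x0 : x != 0) :
  bundle_of A (b, x) <-> A (b, projpt x0).
Proof.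
by split => [|Ax x0']; [exact|rewrite (bool_irrelevance x0' x0)].
Qed.

Lemma bundle_of0 A b : bundle_of A (b, 0).
Proof. by move=> x0; exfalso; move: x0; rewrite eqxx. Qed.

Lemma bundle_of_scale A b a x :
  bundle_of A (b, x) -> bundle_of A (b, a *: x).
Proof.
move=> Ax ax0 /=; have x0 : x != 0.
  by apply: contraNneq ax0 => /= ->; rewrite scaler0.
by rewrite (projpt_eq x0 ax0 (c := a))//; exact: Ax.
Qed.

Lemma closed_bundle_of A : closed A -> closed (bundle_of A).
Proof.
move=> cA [b x] cx x0 /=.
pose pr y := if pselect (y != 0) is left y0 then projpt y0 else projpt x0.
have FF : ProperFilter (within (bundle_of A) (nbhs (b, x))).
  exact: within_nbhs_proper.
have c1 : (fun p : B * H => p.1) @ within (bundle_of A) (nbhs (b, x)) --> b.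
  by apply: cvg_within_filter; exact: cvg_fst.
have c2 : (fun p : B * H => p.2) @ within (bundle_of A) (nbhs (b, x)) --> x.
  by apply: cvg_within_filter; exact: cvg_snd.
have c3 : (fun p : B * H => pr p.2) @ within (bundle_of A) (nbhs (b, x)) -->
    projpt x0.
  apply: (cvg_projpt c2); apply: nearW => p p0; rewrite /pr.
  by case: pselect => // p0'; rewrite (bool_irrelevance p0' p0).
have c13 : (fun p : B * H => (p.1, pr p.2)) @
    within (bundle_of A) (nbhs (b, x)) --> (b, projpt x0).
  exact: (cvg_pair c1 c3).
apply: (@closed_cvg _ _ _ FF (fun p : B * H => (p.1, pr p.2)) A cA _ (b, projpt x0) c13).
near=> p; rewrite /pr; case: pselect => [p0|] /=.
  have Ap : bundle_of A p by near: p; exact: withinT.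
  exact: Ap.
move=> /negP; rewrite negbK => /eqP p0; exfalso.
suff : p.2 != 0 by rewrite p0 eqxx.
near: p; have /cvgr_norm_gt := c2 => /(_ 0).
by rewrite normr_gt0 => /(_ x0); apply: filterS => p; rewrite normr_gt0.
Unshelve. all: by end_near.
Qed.

(** Scaling by [m t] does not move the line, so a nonzero limit [w'] spans a cluster point of the
    projective orbit; a zero limit lies in every [bundle_of] set. *)
Lemma bundle_limit (F : set_system R) {FF : ProperFilter F} (P : set X) b w
    (m : R -> R) b' w' :
  (forall w0 : w != 0, cluster (pf t (b, projpt w0) @[t --> F]) `<=` P) ->
  (forall t, m t != 0) -> theta t b @[t --> F] --> b' ->
  m t *: phi t b w @[t --> F] --> w' -> bundle_of P (b', w').
Proof.
move=> cP m0 tb mw w'0 /=; have w0 : w != 0.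
  apply: contraNneq w'0 => /= w0; apply/eqP; apply: (norm_cvg_unique mw).
  suff -> : (fun t => m t *: phi t b w) = fun=> 0 by exact: cvg_cst.
  by apply/funext => t; rewrite w0 (phi_zero lf) scaler0.
have c2 : (fun t => (pf t (b, projpt w0)).2) @ F --> projpt w'0.
  apply: (cvg_projpt mw); apply: nearW => t mw0.
  have pw0 : phi t b w != 0 by rewrite (phi_eq0 lf).
  by rewrite (pflowE lf w0 pw0) /=; apply/esym/(projpt_eq _ _ (c := m t)).
have c : (fun t => pf t (b, projpt w0)) @ F --> (b', projpt w'0).
  exact: (cvg_pair tb c2).
apply: (cP w0) => A A' FA nA'.
by apply: (@filter_ex _ ((fun t => pf t (b, projpt w0)) @ F)); apply: filterI FA _; exact: c.
Qed.

Lemma cluster_sub (T : topologicalType) (I : Type) (F G : set_system I)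
    (f : I -> T) : F `<=` G -> cluster (f @ G) `<=` cluster (f @ F).
Proof. by move=> FG p cp A A' FA; apply: cp; exact: FG. Qed.

Lemma cvg_segment (I : Type) (F : set_system I) {FF : Filter F} (a : I -> R) (a' : R)
    b x y :
  a @ F --> a' -> (fun i => (b, x + a i *: y)) @ F --> (b, x + a' *: y).
Proof.
move=> aa; have c1 : (fun=> b) @ F --> b by exact: cvg_cst.
have c2 : (fun i => x + a i *: y) @ F --> x + a' *: y.
  apply: cvgD; first exact: cvg_cst.
  by apply: cvgZ => //; exact: cvg_cst.
exact: (cvg_pair c1 c2).
Qed.

Lemma cvg_phi_combine (F : set_system R) {FF : Filter F} (m : R -> R) b v v' y y'
    (c : R) :
  m t *: phi t b v @[t --> F] --> v' -> m t *: phi t b y @[t --> F] --> y' ->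
  m t *: phi t b (v + c *: y) @[t --> F] --> v' + c *: y'.
Proof.
move=> mv my; have -> : (fun t => m t *: phi t b (v + c *: y)) =
    fun t => m t *: phi t b v + c *: (m t *: phi t b y).
  apply/funext => t.
  by rewrite (phi_add lf) (phi_scale lf) scalerDr !scalerA (mulrC c).
by apply: (cvgD mv); apply: (cvgZ _ my); exact: cvg_cst.
Qed.

(** * Linearity of fibers, for either time direction: [F0] is -oo for attractors and +oo for
    repellers *)

Section AttractorRepeller.
Variables (F0 : set_system R) (A A' : set X).
Context {FF0 : ProperFilter F0}.
Hypotheses (cA : closed A) (cA' : closed A').
Hypothesis AA' : forall p, A p -> A' p -> False.
Hypothesis limA : forall p, A p -> cluster (pf t p @[t --> F0]) `<=` A.
Hypothesis limA' : forall p, ~ A p -> cluster (pf t p @[t --> F0]) `<=` A'.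

Lemma bundle_of_disjoint b x : bundle_of A (b, x) -> bundle_of A' (b, x) -> x = 0.
Proof.
move=> Ax A'x; apply/eqP; apply: contrapT => /negP x0.
exact: (AA' (Ax x0) (A'x x0)).
Qed.

Lemma bundle_limit_in (F : set_system R) b w (m : R -> R) b' w' :
  UltraFilter F -> F0 `<=` F -> (forall t, m t != 0) ->
  theta t b @[t --> F] --> b' -> m t *: phi t b w @[t --> F] --> w' ->
  bundle_of A (b, w) -> bundle_of A (b', w').
Proof.
move=> FU F0F m0 tb mw Aw; apply: bundle_limit mw => // w0.
apply: subset_trans (cluster_sub F0F) _.
exact: (limA (Aw w0)).
Qed.

Lemma bundle_limit_out (F : set_system R) b w (m : R -> R) b' w' :
  UltraFilter F -> F0 `<=` F -> (forall t, m t != 0) ->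
  theta t b @[t --> F] --> b' -> m t *: phi t b w @[t --> F] --> w' ->
  ~ bundle_of A (b, w) -> bundle_of A' (b', w').
Proof.
move=> FU F0F m0 tb mw Aw; apply: bundle_limit mw => // w0.
apply: subset_trans (cluster_sub F0F) _.
by apply: limA' => Aw0; apply: Aw; apply/(bundle_ofE _ _ w0).
Qed.

(* Let v be the last point of the segment from x to x + y whose line lies in A.
   Backwards in time the lines through v + c y, c > 0, all tend to A', and
   letting c tend to 0 the limit line of v lies in both A and A'. *)
Lemma bundle_of_add b x y :
  bundle_of A (b, x) -> bundle_of A (b, y) -> bundle_of A (b, x + y).
Proof.
move=> Ax Ay; apply: contrapT => Axy.
have y0 : y != 0 by apply: contra_notN Axy => /eqP ->; rewrite addr0.
pose E := [set c : R | 0 <= c <= 1 /\ bundle_of A (b, x + c *: y)].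
have cE : closed E.
  have -> : E = `[0, 1]%classic `&` [set c | bundle_of A (b, x + c *: y)].
    by apply/seteqP; split => c /=; rewrite in_itv.
  apply: closedI; first exact: itv_closed.
  apply: (@preimage_closed _ _ (fun c : R => (b, x + c *: y)) (bundle_of A)) => [c _|].
    by apply: (cvg_segment (a := id)).
  exact: closed_bundle_of.
have E0 : E 0 by split; rewrite ?lexx ?ler01// scale0r addr0.
have supE : has_sup E by split; [exists 0|exists 1 => c [/andP[]]].
pose c0 := sup E.
have [/andP[c00 c01] Ac0] : E c0.
  by apply: cE; apply: closure_sup; [exists 0|case: supE].
have c01' : c0 < 1.
  rewrite lt_neqAle c01 andbT; apply/eqP => c1; apply: Axy.
  by move: Ac0; rewrite c1 scale1r.
pose v := x + c0 *: y.
have Av c : 0 < c <= 1 - c0 -> ~ bundle_of A (b, v + c *: y).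
  move=> /andP[cp c1] Avc.
  have : c0 + c <= c0.
    apply: sup_upper_bound => //; split; last by rewrite scalerDl addrA.
    by rewrite addr_ge0 ?(ltW cp)//= -lerBrDl.
  by rewrite gerDl leNgt cp.
have [F [FU F0F]] := ultraFilterLemma FF0.
have [b' _ bb'] := ultra_cvg (f := fun t => theta t b) FU cB (fun=> I).
have [t|m [v' [y' [m0 mv my v'y'0]]]] :=
    @ultra_pair _ _ _ F FU (fun t => phi t b v) (fun t => phi t b y).
  by right; rewrite (phi_eq0 lf).
have Av' := bundle_limit_in FU F0F m0 bb' mv Ac0.
have Ay' := bundle_limit_in FU F0F m0 bb' my Ay.
have Avc' c : 0 < c <= 1 - c0 -> bundle_of A' (b', v' + c *: y').
  move=> /Av; apply: (bundle_limit_out FU F0F m0 bb').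
  exact: cvg_phi_combine.
have v'0 : v' = 0.
  apply: (bundle_of_disjoint Av').
  apply: (@closed_cvg _ _ 0^'+ _ (fun c : R => (b', v' + c *: y')) (bundle_of A')) => //.
  - exact: closed_bundle_of.
  - near=> c; apply: Avc'; apply/andP; split; first by near: c; exact: nbhs_right_gt.
    by near: c; apply: nbhs_right_le; rewrite subr_gt0.
  - rewrite -[X in _ --> (_, X)]addr0 -(scale0r y').
    apply: (cvg_segment (a := id)); apply: cvg_at_right_filter; exact: cvg_id.
(* As [v'] vanishes, the limit of [v + c *: y] for [c = 1 - c0] is a nonzero multiple of [y']; so
   the line of [y'] would lie in [A'] as well as in [A]. *)
have y'0 : y' = 0.
  apply: (bundle_of_disjoint Ay').
  have c10 : 1 - c0 != 0 by rewrite gt_eqF// subr_gt0.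
  rewrite -[y'](scalerK c10); apply: bundle_of_scale.
  rewrite -[_ *: _]add0r -v'0; apply: Avc'.
  by rewrite subr_gt0 c01' lexx.
by move: v'y'0; rewrite v'0 y'0 eqxx => -[].
Unshelve. all: by end_near.
Qed.

End AttractorRepeller.

Lemma bundle_of_fibers A :
  (forall b x y, bundle_of A (b, x) -> bundle_of A (b, y) ->
    bundle_of A (b, x + y)) -> linear_fibers (bundle_of A).
Proof.
move=> AD b x; have [U HU] : exists U : {vspace H},
    forall x, bundle_of A (b, x) <-> x \in U.
  apply: vspace_of_pred => [|? ?|? ?]; [exact: bundle_of0|exact: AD|].
  exact: bundle_of_scale.
by rewrite (fib_eq HU).
Qed.

Section Trap.
Variables (U : set X) (e T : R).
Hypothesis tU : trap pf U e T.
Local Notation A := (attr pf U).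
Local Notation A' := (rep pf U).

Let cA : closed A := closed_attr fP tU.
Let cA' : closed A' := closed_rep fP tU.

Lemma attr_cluster (F : set_system R) {FF : ProperFilter F} p :
  A p -> cluster (pf t p @[t --> F]) `<=` A.
Proof.
by move=> Ap; apply: cluster_closed => //; apply: nearW => t; exact: attr_flow.
Qed.

Lemma rep_cluster (F : set_system R) {FF : ProperFilter F} p :
  A' p -> cluster (pf t p @[t --> F]) `<=` A'.
Proof.
by move=> Ap; apply: cluster_closed => //; apply: nearW => t; exact: rep_flow.
Qed.

Lemma attr_fibP : linear_fibers (bundle_of A).
Proof.
apply: bundle_of_fibers => b x y; apply: (@bundle_of_add -oo A A') => //.
- by move=> p; exact: attr_rep.
- by move=> p; exact: attr_cluster.
- by move=> p; exact: (alpha_limit_rep fP tU).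
Qed.

Lemma rep_fibP : linear_fibers (bundle_of A').
Proof.
apply: bundle_of_fibers => b x y; apply: (@bundle_of_add +oo A' A) => //.
- by move=> p ? ?; apply: (@attr_rep _ _ pf U p).
- by move=> p; exact: rep_cluster.
- by move=> p; exact: (omega_limit_attr fP tU).
Qed.

Lemma fib_disjoint b x : x \in fib (bundle_of A) b -> x \in fib (bundle_of A') b -> x = 0.
Proof.
move=> /attr_fibP Ax /rep_fibP A'x.
by apply: (bundle_of_disjoint _ Ax A'x) => p; exact: attr_rep.
Qed.

End Trap.

End AttractorBundles.

Lemma cvg_vspace (R : realType) (H : finHilbertType R) (I : Type)
    (F : set_system I) {FF : ProperFilter F} (x : I -> H) y (U : {vspace H}) :
  x @ F --> y -> (forall i, x i \in U) -> y \in U.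
Proof.
move=> xy xU; apply: (@closed_cvg _ _ _ FF x (fun z => z \in U) _ _ y xy).
  exact: closed_vspace.
exact: nearW.
Qed.

(** Stops one step early: below, the last leg is the one whose duration tends to infinity and whose
    endpoint approaches the target. *)
Lemma clos_trans_last (T : Type) (S : T -> T -> Prop) (Q : T -> Prop) x y :
  clos_trans_1n T S x y -> Q x -> (forall z z', S z z' -> Q z -> Q z') ->
  exists2 z, Q z & S z y.
Proof.
move=> ch + QS; elim: ch => [a b s Qa|a b c s _ IH Qa]; first by exists a.
by apply: IH; exact: QS s Qa.
Qed.

(** * Constant dimension, total order of attractors, and Selgrade's theorem *)

Section Selgrade.
Context {R : realType} {B : metricType R} {H : finHilbertType R}.
Variables (theta : R -> B -> B) (phi : R -> B -> H -> H).
Hypotheses (cB : compact [set: B]) (lf : linear_flow theta phi).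
Hypotheses (B0 : [set: B] !=set0) (ctB : chain_transitive theta [set: B]).
Local Notation X := (B * projspace H)%type.
Local Notation pf := (pflow theta phi).
Local Notation attrF U := (fib (bundle_of (attr pf U))).
Local Notation repF U := (fib (bundle_of (rep pf U))).
Implicit Types (U : set X) (b : B) (x y : H) (t s : R).

Let cX : compact [set: X] := bundle_space_compact cB.
Let fP : is_flow pf := pflow_flow lf.

Lemma in_attrF U e T b x (x0 : x != 0) : trap pf U e T ->
  x \in attrF U b <-> attr pf U (b, projpt x0).
Proof. by move=> tU; rewrite -(attr_fibP cB lf tU) (bundle_ofE _ _ x0). Qed.

Lemma in_repF U e T b x (x0 : x != 0) : trap pf U e T ->
  x \in repF U b <-> rep pf U (b, projpt x0).
Proof. by move=> tU; rewrite -(rep_fibP cB lf tU) (bundle_ofE _ _ x0). Qed.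

(* A chain in B from b0 carries along k-dimensional subspaces whose lines stay
   in the trap; in the limit of ever finer chains they accumulate on attr U. *)
Lemma attrF_dim_le U e T b0 b1 : trap pf U e T ->
  (\dim (attrF U b0) <= \dim (attrF U b1))%N.
Proof.
move=> tU; rewrite leqNgt; apply/negP => dU.
set k := \dim (attrF U b0) in dU.
(* If the dimension dropped at [b1], every k-dimensional subspace would meet [C] nontrivially. This
   supplies unit vectors off the attractor fiber whose limit must nevertheless lie in it. *)
pose C := (attrF U b1)^C%VS.
have dC : \dim C = (\dim {:H} - \dim (attrF U b1))%N by rewrite dimv_compl.
have d1 : (\dim (attrF U b1) <= \dim {:H})%N by rewrite dimvS// subvf.
pose Q z := exists2 W : {vspace H}, \dim W = k &
  forall x (x0 : x != 0), x \in W -> U (z, projpt x0).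
have Qb0 : Q b0.
  exists (attrF U b0) => // x x0 /(in_attrF b0 x0 tU) /(_ 0).
  by case: fP => _ -> _.
have Qstep z z' : step theta e T z z' -> Q z -> Q z'.
  move=> [t Tt zz'] [W dW UW]; have [W' [dW' W'P]] := phi_img lf t z W.
  exists W'; first by rewrite dW'.
  move=> x' x'0 /W'P[x xW xE].
  have x0 : x != 0 by rewrite -(phi_eq0 lf t z) -xE.
  have y0 : phi t z x != 0 by rewrite (phi_eq0 lf).
  apply: (trapP tU (UW x x0 xW) Tt); rewrite (pflowE lf x0 y0).
  split => //=; rewrite (projpt_eq y0 x'0 (c := 1)) ?scale1r//.
  exact: ballxx (trap_e tU).
have last (n : nat) : exists q : R * (X * H),
    [/\ n%:R <= q.1, U q.2.1, ball (theta q.1 q.2.1.1) n.+1%:R^-1 b1,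
      (`|q.2.2| = 1 /\ q.2.2 \in C) &
      forall w0 : q.2.2 != 0, (pf q.1 q.2.1).2 = projpt w0].
  (* Tolerance [e] and duration [T] keep the subspaces in the trap; [n.+1%:R^-1] and [n%:R] make the
     last leg approach [b1] with duration tending to infinity. *)
  have e0 : 0 < Num.min e n.+1%:R^-1 by rewrite lt_min (trap_e tU) invr_gt0 ltr0n.
  have T0 : 0 < Num.max T n%:R by rewrite lt_max (trap_T tU).
  have /eps_chainP ch := ctB (x := b0) (y := b1) I I e0 T0.
  have [||z [W dW UW] [t Tt zb1]] := clos_trans_last (Q := Q) ch => //.
    move=> z z' [t Tt zz']; apply: Qstep; exists t.
      by apply: le_trans Tt; rewrite le_max lexx.
    by apply: le_ball zz'; rewrite ge_min lexx.
  have [W' [dW' W'P]] := phi_img lf t z W.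
  have [w w1 [/W'P[u uW wE] wC]] : exists2 w, `|w| = 1 & w \in W' /\ w \in C.
    by apply: cap_neq0; rewrite dW' dW dC addnBA// ltn_subRL ltn_add2r.
  have u0 : u != 0 by rewrite -(phi_eq0 lf t z) -wE norm_neq0.
  have y0 : phi t z u != 0 by rewrite (phi_eq0 lf).
  exists (t, ((z, projpt u0), w)); split => //=.
  - by apply: le_trans Tt; rewrite le_max lexx orbT.
  - exact: UW.
  - by apply: le_ball zb1; rewrite ge_min lexx orbT.
  - move=> w0; rewrite -[LHS]/(pf t (z, projpt u0)).2 (pflowE lf u0 y0)/=.
    by apply: (projpt_eq _ _ (c := 1)); rewrite scale1r.
have [q Hq] := choice last.
have [F [FU FF]] := ultraFilterLemma (F := \oo) _.
have [w w1 qw] := ultra_cvg (f := fun n => (q n).2.2) FU sphere_compact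
  (fun n => let: And5 _ _ _ h _ := Hq n in h.1).
have w0 := norm_neq0 w1.
have wC : w \in C.
  by apply: (cvg_vspace qw) => n; have [_ _ _ []] := Hq n.
have too : (fun n => (q n).1) @ F --> +oo.
  have nF : (fun n : nat => n%:R : R) @ F --> +oo.
    by move=> A /(@cvgr_idn R); exact: FF.
  apply: ger_cvgy nF; apply: nearW => n; by have [] := Hq n.
have c1 : (fun n => (pf (q n).1 (q n).2.1).1) @ F --> b1.
  apply/cvg_ballP => r r0; near=> n; apply: ball_sym.
  have [_ _ bb _ _] := Hq n; apply: le_ball bb; apply/ltW.
  by near: n; apply: FF; apply: near_infty_natSinv_lt (PosNum r0).
have c2 : (fun n => (pf (q n).1 (q n).2.1).2) @ F --> projpt w0.
  apply: (cvg_projpt qw); apply: nearW => n; by have [] := Hq n.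
have : attr pf U (b1, projpt w0).
  have c12 : (fun n => pf (q n).1 (q n).2.1) @ F --> (b1, projpt w0).
    exact: (cvg_pair c1 c2).
  apply: (attr_limit fP tU (F := F) too _ c12).
  by apply: nearW => n; have [] := Hq n.
move=> /(in_attrF b1 w0 tU) wA; apply: (negP w0).
by rewrite -memv0 -(capv_compl (attrF U b1)) memv_cap wA.
Unshelve. all: by end_near.
Qed.

Lemma attrF_dim U e T b0 b1 : trap pf U e T ->
  \dim (attrF U b0) = \dim (attrF U b1).
Proof. by move=> tU; apply/eqP; rewrite eqn_leq !(attrF_dim_le _ _ tU). Qed.

(* A complement of the repeller fiber over b is driven into the attractor, so
   it is no larger than the attractor fiber over an omega-limit point of b. *)
Lemma attrF_repF U e T b : trap pf U e T -> (attrF U b + repF U b)%VS = fullv.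
Proof.
move=> tU; apply/eqP; rewrite eqEdim subvf.
have dR : (\dim (repF U b) <= \dim {:H})%N by rewrite dimvS// subvf.
suff dA : (\dim {:H} - \dim (repF U b) <= \dim (attrF U b))%N.
  rewrite /= dimv_disjoint_sum; last first.
    apply/eqP; rewrite -subv0; apply/subvP => x; rewrite memv_cap => /andP[xA xR].
    by rewrite memv0; apply/eqP/(fib_disjoint cB lf tU xA xR).
  by move: dA; rewrite leq_subLR addnC.
have [F [FU FF]] := ultraFilterLemma (F := +oo : set_system R) _.
have [b' _ bb'] := ultra_cvg (f := fun t => theta t b) FU cB (fun=> I).
rewrite (attrF_dim b b' tU) leqNgt; apply/negP => dU.
pose W := (repF U b)^C%VS; pose C := (attrF U b')^C%VS.
have d1 : (\dim (attrF U b') <= \dim {:H})%N by rewrite dimvS// subvf.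
have Ht (t : R) : exists q : H * H, [/\ `|q.1| = 1, q.1 \in W,
    `|q.2| = 1, q.2 \in C & exists2 a, a != 0 & phi t b q.1 = a *: q.2].
  have [W' [dW' W'P]] := phi_img lf t b W.
  have [w w1 [/W'P[u uW wE] wC]] : exists2 w, `|w| = 1 & w \in W' /\ w \in C.
    apply: cap_neq0; rewrite dW' !dimv_compl addnBA// ltn_subRL ltn_add2r.
    exact: dU.
  have u0 : u != 0 by rewrite -(phi_eq0 lf t b) -wE norm_neq0.
  exists (unit_vec u, w); split => //=; first exact: unit_vec_norm.
    exact: memvZ.
  exists (`|u|^-1); first by rewrite invr_neq0// normr_eq0.
  by rewrite (phi_scale lf) wE.
have [q Hq] := choice Ht.
have [u u1 qu] := ultra_cvg (f := fun t => (q t).1) FU sphere_compact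
  (fun t => let: And5 h _ _ _ _ := Hq t in h).
have [w w1 qw] := ultra_cvg (f := fun t => (q t).2) FU sphere_compact
  (fun t => let: And5 _ _ h _ _ := Hq t in h).
have u0 := norm_neq0 u1; have w0 := norm_neq0 w1.
have q10 t : (q t).1 != 0 by apply: norm_neq0; have [] := Hq t.
have uW : u \in W.
  by apply: (cvg_vspace qu) => t; have [] := Hq t.
have wC : w \in C.
  by apply: (cvg_vspace qw) => t; have [] := Hq t.
have /existsNP[t0 /contrapT Ut0] : ~ rep pf U (b, projpt u0).
  move=> /(in_repF b u0 tU) uR; apply: (negP u0).
  by rewrite -memv0 -(capv_compl (repF U b)) memv_cap uR.
(* The limit line enters [U] at time [t0]; waiting a further [T] makes this stable, so nearby lines
   are in [U] at time [T + t0] too. The remaining time still tends to infinity. *)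
pose z t : X := pf (T + t0) (b, projpt (q10 t)).
have pfD t s p : pf (t + s) p = pf t (pf s p) by case: fP.
have zc : z @ F --> pf (T + t0) (b, projpt u0).
  apply: (flow_cvg fP).
  have cb : (fun=> b) @ F --> b by exact: cvg_cst.
  suff cp : (fun t => projpt (q10 t)) @ F --> projpt u0 by exact: (cvg_pair cb cp).
  apply: (cvg_projpt qu); apply: nearW => t x0.
  by rewrite (bool_irrelevance x0 (q10 t)).
have Uz : \forall t \near F, U (z t).
  by apply: (trap_near fP tU zc); rewrite -pfD addKr.
have c2 : (fun t => (pf (t - (T + t0)) (z t)).2) @ F --> projpt w0.
  apply: (cvg_projpt qw); apply: nearW => t x0; rewrite /z -pfD subrK.
  have y0 : phi t b (q t).1 != 0 by rewrite (phi_eq0 lf).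
  rewrite (pflowE lf (q10 t) y0)/=; have [_ _ _ _ [a a0 aE]] := Hq t.
  exact: (projpt_eq _ _ (c := a)).
have c1 : (fun t => (pf (t - (T + t0)) (z t)).1) @ F --> b'.
  have -> // : (fun t => (pf (t - (T + t0)) (z t)).1) = (fun t => theta t b).
  by apply/funext => t; rewrite /z -pfD subrK.
have too : (fun t => t - (T + t0)) @ F --> +oo.
  apply/cvgryPge => M; apply: FF.
  have := nbhs_pinfty_ge (num_real (M + (T + t0))).
  by apply: filterS => t; rewrite lerBrDr.
have : attr pf U (b', projpt w0).
  have c12 : (fun t => pf (t - (T + t0)) (z t)) @ F --> (b', projpt w0).
    exact: (cvg_pair c1 c2).
  exact: (attr_limit fP tU (F := F) too Uz c12).
move=> /(in_attrF b' w0 tU) wA; apply: (negP w0).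
by rewrite -memv0 -(capv_compl (attrF U b')) memv_cap wA.
Qed.

(** Suppose [v] is in the first fiber only; by dimension some [y] over the same base point is in the
    second only, and [v + y] is in neither. Backward limits under a common scaling put [v'] in the
    first attractor, [y'] in the second, [y'] and [v' + y'] in the first repeller, [v'] and
    [v' + y'] in the second. Subtraction puts [v'] in the first attractor and repeller and [y'] in
    the second pair, so both vanish, which the scaling excludes. *)
Lemma attr_total U1 e1 T1 U2 e2 T2 b0 : trap pf U1 e1 T1 -> trap pf U2 e2 T2 ->
  (\dim (attrF U1 b0) <= \dim (attrF U2 b0))%N -> attr pf U1 `<=` attr pf U2.
Proof.
move=> t1 t2 d12 [b L]; have [v v1 vL] := projptP L; have v0 := norm_neq0 v1.
rewrite -(vL v0) => /(in_attrF b v0 t1) v1A.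
apply/(in_attrF b v0 t2); apply: contrapT => v2A.
have [y y2A y1A] : exists2 y, y \in attrF U2 b & y \notin attrF U1 b.
  apply: contrapT => Hy; apply: v2A.
  have s21 : (attrF U2 b <= attrF U1 b)%VS.
    by apply/subvP => y y2; apply: contrapT => /negP y1; apply: Hy; exists y.
  have /eqP -> // : attrF U2 b == attrF U1 b.
  by rewrite eqEdim s21 (attrF_dim b b0 t1) (attrF_dim b b0 t2).
have [F [FU FF]] := ultraFilterLemma (F := -oo : set_system R) _.
have [b' _ bb'] := ultra_cvg (f := fun t => theta t b) FU cB (fun=> I).
have [t|m [v' [y' [m0 mv my v'y'0]]]] :=
    @ultra_pair _ _ _ F FU (fun t => phi t b v) (fun t => phi t b y).
  by left; rewrite (phi_eq0 lf).
have mvy : m t *: phi t b (v + y) @[t --> F] --> v' + y'.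
  by rewrite -[y]scale1r -[y']scale1r; exact: (cvg_phi_combine lf).
have lin U e T x x' : trap pf U e T -> m t *: phi t b x @[t --> F] --> x' ->
    (x \in attrF U b -> x' \in attrF U b') /\
    (x \notin attrF U b -> x' \in repF U b').
  move=> tU mx; split=> [/(attr_fibP cB lf tU) xA|/negP xA].
    apply/(attr_fibP cB lf tU).
    apply: (bundle_limit_in lf (F0 := -oo) _ FU FF m0 bb' mx xA) => p.
    exact: (attr_cluster lf tU).
  apply/(rep_fibP cB lf tU).
  apply: (bundle_limit_out lf (F0 := -oo) (A := attr pf U) _ FU FF m0 bb' mx).
    by move=> p; exact: (alpha_limit_rep fP tU).
  by move/(attr_fibP cB lf tU).
have vy1 : v + y \notin attrF U1 b.
  by apply: contra y1A => vyA; rewrite -[y](addKr v) rpredD ?rpredN.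
have vy2 : v + y \notin attrF U2 b.
  by apply/negP => vyA; apply: v2A; rewrite -[v](addrK y) rpredD ?rpredN.
have v1' := (lin _ _ _ _ _ t1 mv).1 v1A.
have v2' := (lin _ _ _ _ _ t2 mv).2 (introN idP v2A).
have y1' := (lin _ _ _ _ _ t1 my).2 y1A.
have y2' := (lin _ _ _ _ _ t2 my).1 y2A.
have vy1' := (lin _ _ _ _ _ t1 mvy).2 vy1.
have vy2' := (lin _ _ _ _ _ t2 mvy).2 vy2.
have v'0 : v' = 0.
  apply: (fib_disjoint cB lf t1 v1').
  by rewrite -[v'](addrK y') rpredD ?rpredN.
have y'0 : y' = 0.
  apply: (fib_disjoint cB lf t2 y2').
  by rewrite -[y'](addKr v') rpredD ?rpredN.
by move: v'y'0; rewrite v'0 y'0 eqxx => -[].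
Qed.

(** A point of the second repeller outside the first has its omega-limit set in the first attractor,
    hence in the second, but also in the second repeller. *)
Lemma rep_antimono U1 e1 T1 U2 e2 T2 : trap pf U1 e1 T1 -> trap pf U2 e2 T2 ->
  attr pf U1 `<=` attr pf U2 -> rep pf U2 `<=` rep pf U1.
Proof.
move=> t1 t2 s12 p p2; apply: contrapT => p1.
have [q q1] := omega_limit_neq0 pf cX p.
have qA := omega_limit_attr fP t1 p1 q1.
apply: attr_rep (s12 _ qA) _.
exact: (rep_cluster lf t2 p2 q1).
Qed.

(* The levels K 0 > ... > K L are the fiber dimensions of the attractors; each
   is realised by one attractor, A i, with complementary repeller A' i. *)
Let d := \dim {:H}.
Let level k := `[< exists U e T, trap pf U e T /\ forall b, \dim (attrF U b) = k >].
Let ks := [seq k <- rev (iota 0 d.+1) | level k].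
Let K i := nth 0%N ks i.
Let L := (size ks).-1.

Let level_trap U e T b : trap pf U e T -> \dim (attrF U b) \in ks.
Proof.
move=> tU; rewrite mem_filter mem_rev mem_iota /= add0n ltnS.
rewrite dimvS ?subvf// andbT; apply/asboolP; exists U, e, T; split => // b'.
exact: (attrF_dim _ _ tU).
Qed.

Let attrFT b : attrF setT b = fullv.
Proof.
by apply: fib_eq => x; rewrite memvf; split => // _ x0 /=.
Qed.

Let attrF0 b : attrF set0 b = 0%VS.
Proof.
apply: fib_eq => x; rewrite memv0; split => [xA|/eqP ->]; last exact: bundle_of0.
by apply: contrapT => /negP x0; case: (xA x0 0).
Qed.

Let ks_sorted : sorted gtn ks.
Proof.
apply: sorted_filter; first by move=> ? ? ? /= h1 h2; exact: ltn_trans h2 h1.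
by rewrite rev_sorted; exact: iota_ltn_sorted.
Qed.

Let size_ks : size ks = L.+1.
Proof.
have [b _] := B0; have := level_trap b (trap0 pf).
by rewrite /L; case: ks.
Qed.

Let K_lt i j : (i < j <= L)%N -> (K j < K i)%N.
Proof.
move=> /andP[ij jL]; have := sorted_ltn_nth _ 0%N ks_sorted.
move=> /(_ _ i j); rewrite !inE size_ks !ltnS; apply => //.
  by move=> ? ? ? /= h1 h2; exact: ltn_trans h2 h1.
exact: leq_trans (ltnW ij) jL.
Qed.

Let Uc i : set X := xget set0
  [set U | exists e T, trap pf U e T /\ forall b, \dim (attrF U b) = K i].

Let UcP i : (i <= L)%N ->
  exists e T, trap pf (Uc i) e T /\ forall b, \dim (attrF (Uc i) b) = K i.
Proof.
move=> iL; rewrite /Uc; case: xgetP => // noU; exfalso.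
have : K i \in ks by rewrite mem_nth// size_ks ltnS.
by rewrite mem_filter => /andP[/asboolP[U /noU]].
Qed.

Local Notation A i := (attr pf (Uc i)).
Local Notation A' i := (rep pf (Uc i)).

Let trap_level U e T : trap pf U e T -> exists2 j, (j <= L)%N & attr pf U = A j.
Proof.
move=> tU; have [b _] := B0; have dU := level_trap b tU.
pose j := index (\dim (attrF U b)) ks.
have jL : (j <= L)%N by rewrite -ltnS -size_ks index_mem.
exists j => //; have [e' [T' [tj dj]]] := UcP jL.
have dE : \dim (attrF (Uc j) b) = \dim (attrF U b) by rewrite dj /K nth_index.
by apply/seteqP; split; [apply: (attr_total tU tj (b0 := b))|
  apply: (attr_total tj tU (b0 := b))]; rewrite dE.
Qed.

Let A_mono i j : (i <= j <= L)%N -> A j `<=` A i.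
Proof.
move=> /andP[ij jL]; have iL := leq_trans ij jL.
have [e1 [T1 [t1 d1]]] := UcP iL; have [e2 [T2 [t2 d2]]] := UcP jL.
have [b _] := B0; apply: (attr_total t2 t1 (b0 := b)); rewrite d1 d2.
by move: ij; rewrite leq_eqVlt => /predU1P[->//|ij]; rewrite ltnW// K_lt ?ij.
Qed.

Let A'_mono i j : (i <= j <= L)%N -> A' i `<=` A' j.
Proof.
move=> ijL; have /andP[ij jL] := ijL; have iL := leq_trans ij jL.
have [e1 [T1 [t1 d1]]] := UcP iL; have [e2 [T2 [t2 d2]]] := UcP jL.
exact: rep_antimono t2 t1 (A_mono ijL).
Qed.

Let K0 : K 0 = d.
Proof.
have [b _] := B0; have [e [T [t0 d0]]] := UcP (leq0n L).
apply/eqP; rewrite eqn_leq -{1}(d0 b) dimvS ?subvf//=.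
have := level_trap b (trapT pf); rewrite attrFT -/d => dk.
have := nth_index 0%N dk; rewrite -/(K _) => Kd; rewrite -{1}Kd.
case: (posnP (index d ks)) => [->//|ip]; apply/ltnW/K_lt.
by rewrite ip -ltnS -size_ks index_mem.
Qed.

Let KL : K L = 0%N.
Proof.
have [b _] := B0; have := level_trap b (trap0 pf); rewrite attrF0 dimv0 => dk.
have := nth_index 0%N dk; rewrite -/(K _) => Kd; apply/eqP; rewrite -leqn0 -[leqRHS]Kd.
have : (index 0%N ks <= L)%N by rewrite -ltnS -size_ks index_mem.
by rewrite leq_eqVlt => /predU1P[->//|iL]; apply/ltnW/K_lt; rewrite iL leqnn.
Qed.

Let A0 : A 0 = setT.
Proof.
have [j jL jE] := trap_level (trapT pf).
apply/seteqP; split => // p _; apply: (A_mono (j := j)); first by rewrite leq0n.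
by rewrite -jE => t.
Qed.

Let AL p : ~ A L p.
Proof.
have [j jL jE] := trap_level (trap0 pf).
move=> /(A_mono (i := j)); rewrite -jE jL leqnn => /(_ isT 0).
by [].
Qed.

Let M i : set X := A i `&` A' i.+1.

(** The set reached from [x] has some [A j] as its attractor. For [j <= i] this contains [y]. For
    [j > i] the repeller would contain [A' i.+1], hence [x], although [x] flows into its own
    reachable set. *)
Let M_trans i : (i < L)%N -> chain_transitive pf (M i).
Proof.
move=> iL x y [xA xR] [yA _] e T e0 T0.
have tU := trap_reach pf x e0 T0.
set U := [set y | _] in tU.
have [j jL jE] := trap_level tU.
have [e2 [T2 [t2 _]]] := UcP iL.
have Ux : U (pf T x).
  apply/eps_chainP/t1n_step; exists T => //; exact: ballxx.
have [ji|ij] := leqP j i.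
  have : attr pf U y by rewrite jE; apply: A_mono yA; rewrite ji ltnW.
  by move=> /(_ 0); case: fP => _ -> _.
exfalso; have : rep pf U x; last by move=> /(_ T).
apply: (rep_antimono tU t2 _ xR); rewrite jE.
by apply: A_mono; rewrite ij.
Qed.

(** Take the last [i] with [N] inside [A i]; the next attractor does not contain [N], so its
    repeller does. *)
Let M_cover N : chain_transitive pf N -> N !=set0 ->
  exists2 i, (i < L)%N & N `<=` M i.
Proof.
move=> cN [x Nx].
have NA i : (i <= L)%N -> N `<=` A i \/ N `<=` A' i.
  by move=> /UcP[e [T [tU _]]]; exact: (chain_transitive_trap cX fP tU cN).
have P0 : exists i, `[< (i <= L)%N /\ N `<=` A i >].
  by exists 0%N; apply/asboolP; rewrite A0.
have PL i : `[< (i <= L)%N /\ N `<=` A i >] -> (i <= L)%N by move/asboolP => [].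
have [i /asboolP[iL NAi] imax] := ex_maxnP P0 PL.
have {}iL : (i < L)%N.
  rewrite ltn_neqAle iL andbT; apply/eqP => iE.
  by apply: (@AL x); rewrite -iE; exact: NAi.
exists i => // z Nz; split; first exact: NAi.
have [NAi'|] := NA _ iL; last exact.
suff : (i.+1 <= i)%N by rewrite ltnn.
by apply: imax; apply/asboolP.
Qed.

Let M_disj i j (x : X) : (i < L)%N -> (j < L)%N -> M i x -> M j x -> i = j.
Proof.
wlog ij : i j / (i < j)%N.
  move=> W iL jL Mi Mj; have [ij|ji|//] := ltngtP i j; first exact: W.
  exact/esym/W.
move=> iL jL [_ Ri] [Aj _]; exfalso.
by apply: attr_rep Ri; apply: (A_mono (j := j)) => //; rewrite ij ltnW.
Qed.

Let M_fib i b x : (i < L)%N -> bundle_of (M i) (b, x) <->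
  x \in (attrF (Uc i) b :&: repF (Uc i.+1) b)%VS.
Proof.
move=> iL; have [e1 [T1 [t1 _]]] := UcP (ltnW iL); have [e2 [T2 [t2 _]]] := UcP iL.
rewrite memv_cap; split=> [Mx|/andP[/(attr_fibP cB lf t1) xA /(rep_fibP cB lf t2) xR] x0].
  apply/andP; split; first by apply/(attr_fibP cB lf t1) => x0; have [] := Mx x0.
  by apply/(rep_fibP cB lf t2) => x0; have [] := Mx x0.
by split; [exact: xA|exact: xR].
Qed.

Let fib_M i b : (i < L)%N ->
  fib (bundle_of (M i)) b = (attrF (Uc i) b :&: repF (Uc i.+1) b)%VS.
Proof. by move=> iL; apply: fib_eq => x; exact: M_fib. Qed.

Let attrF_mono i j b : (i <= j <= L)%N -> (attrF (Uc j) b <= attrF (Uc i) b)%VS.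
Proof.
move=> ijL; have /andP[ij jL] := ijL; have iL := leq_trans ij jL.
have [e1 [T1 [t1 _]]] := UcP iL; have [e2 [T2 [t2 _]]] := UcP jL.
apply/subvP => x /(attr_fibP cB lf t2) xA; apply/(attr_fibP cB lf t1) => x0.
exact: A_mono ijL _ (xA x0).
Qed.

Let fib_M_sum i b : (i < L)%N ->
  (attrF (Uc i.+1) b + fib (bundle_of (M i)) b)%VS = attrF (Uc i) b /\
  (attrF (Uc i.+1) b :&: fib (bundle_of (M i)) b)%VS = 0%VS.
Proof.
move=> iL; have [e2 [T2 [t2 _]]] := UcP iL.
rewrite (fib_M b iL); split; apply/eqP; last first.
  rewrite -subv0; apply/subvP => x; rewrite !memv_cap => /and3P[xA _ xR].
  by rewrite memv0; apply/eqP/(fib_disjoint cB lf t2 xA xR).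
have s : (attrF (Uc i.+1) b <= attrF (Uc i) b)%VS by apply: attrF_mono; rewrite leqnSn.
rewrite eqEsubv subv_add s capvSl /=; apply/subvP => x xA.
have : x \in fullv by exact: memvf.
rewrite -(attrF_repF b t2) => /memv_addP[y yA [z zR xE]].
rewrite xE; apply: memv_add => //; rewrite memv_cap zR andbT.
have -> : z = x - y by rewrite xE addrC addKr.
by rewrite rpredB//; apply: (subvP s).
Qed.

Let dim_M i b : (i < L)%N -> \dim (fib (bundle_of (M i)) b) = (K i - K i.+1)%N.
Proof.
move=> iL; have [e1 [T1 [t1 d1]]] := UcP (ltnW iL).
have [e2 [T2 [t2 d2]]] := UcP iL; have [s c] := fib_M_sum b iL.
by rewrite -(d1 b) -s dimv_disjoint_sum// d2 addKn.
Qed.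

(** Telescopes [fib_M_sum] downwards from the zero attractor [A L], by induction on [L - m]. *)
Let direct_tail m b : (m <= L)%N ->
  (\sum_(m <= i < L) fib (bundle_of (M i)) b)%VS = attrF (Uc m) b /\
  (\sum_(m <= i < L) \dim (fib (bundle_of (M i)) b))%N = K m.
Proof.
move=> mL; rewrite -(subKn mL); have : (L - m <= L)%N by rewrite leq_subr.
elim: (L - m)%N => [_|k IH kL].
  rewrite subn0 !big_geq//; split; last by rewrite KL.
  apply/esym/eqP; rewrite -dimv_eq0; have [e1 [T1 [t1 ->]]] := UcP (leqnn L).
  by rewrite KL.
have iL : (L - k.+1 < L)%N by rewrite ltn_subrL (leq_trans _ kL).
have [IH1 IH2] := IH (ltnW kL).
rewrite !(big_ltn iL) -subSn// subSS IH1 IH2.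
have [s _] := fib_M_sum b iL; rewrite dim_M//.
rewrite -subSn// subSS in s *; split; first by rewrite addvC.
rewrite subnK// ltnW// K_lt// leq_subr andbT.
by rewrite ltn_sub2l.
Qed.

Let M_neq0 i : (i < L)%N -> M i !=set0.
Proof.
move=> iL; have [b _] := B0.
set V := fib (bundle_of (M i)) b.
have V0 : vpick V != 0.
  by rewrite vpick0 -dimv_eq0 dim_M// -lt0n subn_gt0 K_lt// ltnSn.
have := memv_pick V; rewrite [in X in _ \in X]/V fib_M// => /(M_fib _ _ iL) MV.
by exists (b, projpt V0); exact: MV.
Qed.

Let M_comp i : (i < L)%N -> chain_component pf (M i).
Proof.
move=> iL; split; first exact: M_trans.
move=> N cN MN; have [x Mx] := M_neq0 iL.
have [j jL NM] := M_cover cN (ex_intro _ x (MN _ Mx)).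
apply/seteqP; split => // z /NM Mz.
by rewrite (M_disj iL jL Mx (NM _ (MN _ Mx))).
Qed.

(** Positive dimension excludes the empty component: it guarantees some [M i], and no maximal chain
    transitive set is then empty. *)
Let M_all N : (0 < d)%N -> chain_component pf N -> exists2 i, (i < L)%N & N = M i.
Proof.
move=> d0 [cN maxN].
have L0 : (0 < L)%N.
  by rewrite lt0n; apply/eqP => L0; move: d0; rewrite -K0 -[X in K X]L0 KL.
have N0 : N !=set0.
  apply/set0P/eqP => N0; have [x Mx] := M_neq0 L0.
  have NE := maxN _ (M_trans L0); move: Mx; rewrite NE ?N0//.
have [i iL NM] := M_cover cN N0; exists i => //.
by rewrite (maxN _ (M_trans iL) NM).
Qed.

Let alpha_M i b x (x0 : x != 0) : (i < L)%N -> x \in attrF (Uc i) b ->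
  x \notin attrF (Uc i.+1) b -> alpha_limit pf (b, projpt x0) `<=` M i.
Proof.
move=> iL xi /negP xi1 p ap.
have [e1 [T1 [t1 _]]] := UcP (ltnW iL); have [e2 [T2 [t2 _]]] := UcP iL.
split; first by move/(in_attrF b x0 t1): xi => xi; exact: (attr_cluster lf t1 xi ap).
by apply: (alpha_limit_rep fP t2 _ ap) => /(in_attrF b x0 t2).
Qed.

Let omega_M i b x (x0 : x != 0) : (i < L)%N -> x \in repF (Uc i.+1) b ->
  x \notin repF (Uc i) b -> omega_limit pf (b, projpt x0) `<=` M i.
Proof.
move=> iL xi /negP xi1 p ap.
have [e1 [T1 [t1 _]]] := UcP (ltnW iL); have [e2 [T2 [t2 _]]] := UcP iL.
split; last by move/(in_repF b x0 t2): xi => xi; exact: (rep_cluster lf t2 xi ap).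
by apply: (omega_limit_attr fP t1 _ ap) => /(in_repF b x0 t1).
Qed.

Let pick_M i b : (i < L)%N -> exists2 x, x != 0 &
  x \in attrF (Uc i) b /\ x \in repF (Uc i.+1) b.
Proof.
move=> iL; set V := fib (bundle_of (M i)) b; exists (vpick V).
  by rewrite vpick0 -dimv_eq0 dim_M// -lt0n subn_gt0 K_lt// ltnSn.
have := memv_pick V; rewrite [in X in _ \in X]/V fib_M//.
by rewrite memv_cap => /andP[].
Qed.

Let repF_mono i j b : (i <= j <= L)%N -> (repF (Uc i) b <= repF (Uc j) b)%VS.
Proof.
move=> ijL; have /andP[ij jL] := ijL; have iL := leq_trans ij jL.
have [e1 [T1 [t1 _]]] := UcP iL; have [e2 [T2 [t2 _]]] := UcP jL.
apply/subvP => x /(rep_fibP cB lf t1) xA; apply/(rep_fibP cB lf t2) => x0.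
exact: A'_mono ijL _ (xA x0).
Qed.

(* If v lies in the bundle of M j and w in that of M i, then the line through
   v + w comes from M i and goes to M j. *)
Let M_le i j : (i < j < L)%N -> component_le pf (M i) (M j).
Proof.
move=> /andP[ij jL]; have iL := ltn_trans ij jL.
have [b _] := B0.
have [v v0 [vA vR]] := pick_M b jL; have [w w0 [wA wR]] := pick_M b iL.
have [e1 [T1 [t1 _]]] := UcP iL; have [e2 [T2 [t2 _]]] := UcP (ltnW jL).
have vA1 : v \in attrF (Uc i.+1) b by apply: (subvP (attrF_mono _ _)) vA; rewrite ij ltnW.
have wRj : w \in repF (Uc j) b by apply: (subvP (repF_mono _ _)) wR; rewrite ij ltnW.
have vA0 : v \in attrF (Uc i) b.
  by apply: (subvP (attrF_mono _ _)) vA1; rewrite leqnSn.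
have wR1 : w \in repF (Uc j.+1) b.
  by apply: (subvP (repF_mono _ _)) wRj; rewrite leqnSn.
have vwA : v + w \notin attrF (Uc i.+1) b.
  apply: contra_neqN w0 => h; apply: (fib_disjoint cB lf t1 _ wR).
  by rewrite -[w](addKr v) rpredD ?rpredN.
have vwR : v + w \notin repF (Uc j) b.
  apply: contra_neqN v0 => h; apply: (fib_disjoint cB lf t2 vA).
  by rewrite -[v](addrK w) rpredD ?rpredN.
have vw0 : v + w != 0 by apply: contraNneq vwA => ->; exact: mem0v.
exists 1%N, (fun k => if k is 0%N then M i else M j), (fun=> (b, projpt vw0)).
split => // [[|[|]]//|[|]// _]; [by move=> _; exact: M_comp..|].
split; first by apply: alpha_M => //; rewrite rpredD.
by apply: omega_M => //; rewrite rpredD.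
Qed.

(** Besides the decomposition this records what the comparison with the lift consumes: [spec_trap]
    for shadowing, [spec_cover] for locating images of components, [spec_order] for monotonicity of
    that location. *)
Record selgrade_spec (Ms : seq (set X)) : Prop := SelgradeSpec {
  spec_uniq : uniq Ms;
  spec_mem : forall N, N \in Ms <-> chain_component pf N;
  spec_le : forall i j, (i < j < size Ms)%N ->
    component_le pf (nth set0 Ms i) (nth set0 Ms j);
  spec_trap : forall N, N \in Ms -> exists U eU TU W eW TW,
    [/\ trap pf U eU TU, trap pf W eW TW & N = attr pf U `&` rep pf W];
  spec_neq0 : forall N, N \in Ms -> N !=set0;
  spec_fib : forall N, N \in Ms -> linear_fibers (bundle_of N);
  spec_dim : forall N, N \in Ms -> exists2 k, (0 < k)%N &
    forall b, \dim (fib (bundle_of N) b) = k;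
  spec_sum : forall b, (\sum_(N <- Ms) fib (bundle_of N) b)%VS = fullv;
  spec_sum_dim : forall b,
    (\sum_(N <- Ms) \dim (fib (bundle_of N) b))%N = \dim {:H};
  spec_cover : forall N, chain_transitive pf N -> N !=set0 ->
    exists2 N', N' \in Ms & N `<=` N';
  spec_order : forall i j p q r, (i < size Ms)%N -> (j < size Ms)%N ->
    alpha_limit pf p q -> nth set0 Ms i q ->
    omega_limit pf p r -> nth set0 Ms j r -> (i <= j)%N }.

Theorem selgrade : (0 < \dim {:H})%N -> exists Ms, selgrade_spec Ms.
Proof.
move=> d0; pose Ms := [seq M i | i <- iota 0 L].
have memM N : N \in Ms <-> exists2 i, (i < L)%N & N = M i.
  split; first by move=> /mapP[i]; rewrite mem_iota => iL ->; exists i.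
  by move=> [i iL ->]; apply: map_f; rewrite mem_iota.
have sM : size Ms = L by rewrite size_map size_iota.
have nM i : (i < L)%N -> nth set0 Ms i = M i.
  by move=> iL; rewrite (nth_map 0%N) ?size_iota// nth_iota.
exists Ms; split.
- rewrite map_inj_in_uniq ?iota_uniq// => i j; rewrite !mem_iota !add0n /=.
  move=> iL jL Mij; have [x Mx] := M_neq0 iL.
  by apply: (M_disj iL jL Mx); rewrite -Mij.
- move=> N; rewrite memM; split; first by move=> [i iL ->]; exact: M_comp.
  exact: M_all.
- move=> i j; rewrite sM => /andP[ij jL]; rewrite !nM ?(ltn_trans ij)//.
  by apply: M_le; rewrite ij.
- move=> N /memM[i iL ->].
  have [e1 [T1 [t1 _]]] := UcP (ltnW iL); have [e2 [T2 [t2 _]]] := UcP iL.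
  by exists (Uc i), e1, T1, (Uc i.+1), e2, T2.
- by move=> N /memM[i iL ->]; exact: M_neq0.
- by move=> N /memM[i iL ->] b x; rewrite fib_M//; exact: M_fib.
- move=> N /memM[i iL ->]; exists (K i - K i.+1)%N; last by move=> b; exact: dim_M.
  by rewrite subn_gt0 K_lt// ltnSn.
- move=> b; rewrite big_map; have [h _] := direct_tail b (leq0n L).
  have -> : iota 0 L = index_iota 0 L by rewrite /index_iota subn0.
  rewrite h; apply/eqP; rewrite eqEdim subvf.
  by have [e [T [_ ->]]] := UcP (leq0n L); rewrite K0 leqnn.
- move=> b; rewrite big_map; have [_ h] := direct_tail b (leq0n L).
  have -> : iota 0 L = index_iota 0 L by rewrite /index_iota subn0.
  by rewrite h K0.
- move=> N cN /(M_cover cN)[i iL NM]; exists (M i) => //.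
  by apply/memM; exists i.
- move=> i j p q r; rewrite sM => iL jL; rewrite !nM// => aq qM oq rM.
  have [e1 [T1 [t1 _]]] := UcP (ltnW iL).
  (* An orbit starting in the limit at [M i] lies in [A i] and never leaves it, whereas for [j < i]
     the set [M j] lies in a repeller disjoint from [A i]. *)
  have pA : A i p.
    apply: contrapT => pA; have := alpha_limit_rep fP t1 pA aq.
    by apply: attr_rep; case: qM.
  have rA : A i r by exact: (attr_cluster lf t1 pA oq).
  rewrite leqNgt; apply/negP => ji; have [_ rR] := rM.
  by apply: attr_rep rR; apply: A_mono rA; rewrite ji ltnW.
Qed.

End Selgrade.

(** * The lift of an affine flow *)

Section LocalIntegral.
Context {R : realType}.
Local Notation mu := (@lebesgue_measure R).
Implicit Types (g h : R -> R) (a b c s t : R).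

Let sh s : R -> measurableTypeR R := fun x => x + s.

Let measurable_shift s : measurable_fun setT (sh s).
Proof.
by apply: continuous_measurable_fun => x; apply: cvgD; [exact: cvg_id|exact: cvg_cst].
Qed.

Lemma lebesgue_measure_shift s (A : set R) : measurable A ->
  pushforward mu (sh s) A = mu A.
Proof.
move=> mA; have ms := measurable_shift s.
apply/esym/lebesgue_measure_unique => //= _ [[a b]] _ <-.
have -> : pushforward mu (sh s)
    `]a, b]%classic = mu `]a - s, b - s]%classic.
  rewrite /pushforward; congr (mu _); apply/seteqP; split => x /=;
    by rewrite !in_itv /= ltrBlDr lerBrDr.
by rewrite !lebesgue_measure_itv/= !lte_fin ltrD2r -!EFinB opprB addrA subrK.
Qed.

Definition loc_integrable g :=
  measurable_fun setT g /\ forall a b, mu.-integrable `[a, b] (EFin \o g).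

Let shift_preimage s a b :
  (sh s @^-1` `[a + s, b + s]) = `[a, b]%classic.
Proof. by apply/seteqP; split => x /=; rewrite !in_itv /= !lerD2r. Qed.

Lemma loc_integrable_shift g s :
  loc_integrable g -> loc_integrable (fun x => g (x + s)).
Proof.
move=> [mg ig]; have ms : measurable_fun setT (fun x : R => g (x + s)).
  exact: (measurableT_comp mg (measurable_shift s)).
split => // a b; apply/integrableP; split.
  by apply/measurable_EFinP; exact: measurable_funTS.
have /integrableP[_] := ig (a + s) (b + s); apply: le_lt_trans.
have -> : (\int[mu]_(x in `[(a + s)%R, (b + s)%R]) `|(EFin \o g) x|)%E =
    (\int[pushforward mu (sh s)]_(x in `[(a + s)%R, (b + s)%R]) `|(EFin \o g) x|)%E.
  by have msh := measurable_shift s; apply: eq_measure_integral => // A mA _; rewrite [RHS]lebesgue_measure_shift.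
rewrite ge0_integral_pushforward//=; last 2 first.
- exact: measurable_shift.
- by apply/measurable_EFinP; apply: measurableT_comp => //; exact: measurable_funTS.
by rewrite shift_preimage.
Qed.

Lemma Rintegral_shift g s a b : loc_integrable g ->
  \int[mu]_(x in `[a, b]) g (x + s) = \int[mu]_(x in `[a + s, b + s]) g x.
Proof.
move=> ig; have [mg _] := ig; have [_ igs] := loc_integrable_shift s ig.
rewrite /Rintegral; congr fine; apply/esym.
rewrite -[in RHS](shift_preimage s).
rewrite -(@integral_pushforward _ _ (measurableTypeR R) (measurableTypeR R) R (sh s) (measurable_shift s) mu `[a + s, b + s]%classic (EFin \o g))//=.
- by have msh := measurable_shift s; apply: eq_measure_integral => // A mA _; rewrite [RHS]lebesgue_measure_shift.
- exact/measurable_EFinP.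
- by rewrite shift_preimage; exact: igs.
Qed.

Lemma Rintegral_cat g a c b : loc_integrable g -> a <= c -> c <= b ->
  \int[mu]_(x in `[a, b]) g x =
  \int[mu]_(x in `[a, c]) g x + \int[mu]_(x in `[c, b]) g x.
Proof.
move=> [_ ig] ac cb; apply/eqP; rewrite addrC -subr_eq; apply/eqP.
rewrite (@Rintegral_itvB _ g (BLeft a) (BRight b) c) ?bnd_simp//.
rewrite Rintegral_itv_obnd_cbnd//.
by apply: integrableS (ig c b) => //; apply: subset_itvr; rewrite bnd_simp.
Qed.

Definition oint t g : R :=
  if 0 <= t then \int[mu]_(x in `[0, t]) g x else - \int[mu]_(x in `[t, 0]) g x.

(** A base point to the left of both 0 and [t] removes the case distinction on signs from the shift
    formula. *)
Lemma oint_from g c t : loc_integrable g -> c <= 0 -> c <= t ->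
  oint t g = \int[mu]_(x in `[c, t]) g x - \int[mu]_(x in `[c, 0]) g x.
Proof.
move=> ig c0 ct; rewrite /oint; case: (leP 0 t) => t0.
  by rewrite (Rintegral_cat ig c0 t0) addrC addKr.
by rewrite (Rintegral_cat ig ct (ltW t0)) opprD addNKr.
Qed.

Lemma oint_shift g s t : loc_integrable g ->
  oint (t + s) g = oint s g + oint t (fun x => g (x + s)).
Proof.
move=> ig; pose c := Num.min 0 (Num.min s (t + s)).
have c0 : c <= 0 by rewrite ge_min lexx.
have cs : c <= s by rewrite !ge_min lexx orbT.
have cts : c <= t + s by rewrite !ge_min lexx !orbT.
rewrite (oint_from ig c0 cts) (oint_from ig c0 cs).
rewrite (oint_from (c := c - s) (loc_integrable_shift s ig)) ?subr_le0 ?lerBlDr//.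
rewrite !Rintegral_shift// !subrK add0r.
by ring.
Qed.

Lemma eq_oint g h t : loc_integrable g -> loc_integrable h ->
  (\forall x \ae mu, g x = h x) -> oint t g = oint t h.
Proof.
move=> [mg ig] [mh ih] gh.
have E a b : \int[mu]_(x in `[a, b]) g x = \int[mu]_(x in `[a, b]) h x.
  rewrite /Rintegral; congr fine; apply: ae_eq_integral => //.
  - by apply/measurable_EFinP; exact: measurable_funTS.
  - by apply/measurable_EFinP; exact: measurable_funTS.
  - case: gh => N [mN N0 sN]; exists N; split => //.
    by apply: subset_trans sN => x /= nx ghx; apply: nx => _; rewrite ghx.
by rewrite /oint !E.
Qed.

Lemma loc_integrable_sum (I : finType) (c : I -> R) (g : I -> R -> R) :
  (forall i, loc_integrable (g i)) ->
  loc_integrable (fun x => \sum_i c i * g i x) /\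
  forall t, oint t (fun x => \sum_i c i * g i x) = \sum_i c i * oint t (g i).
Proof.
move=> ig.
have icg i a b : mu.-integrable `[a, b] (EFin \o (fun x => c i * g i x)).
  have -> : EFin \o (fun x => c i * g i x) = (fun x => (c i)%:E * (EFin \o g i) x)%E.
    by apply/funext => x /=; rewrite EFinM.
  by apply: integrableZl => //; exact: (ig i).2.
have isum a b : mu.-integrable `[a, b] (fun x => (\sum_i (c i * g i x)%:E)%E).
  by apply: integrable_sum => // i _; exact: icg.
have E : (fun x => (\sum_i (c i * g i x)%:E)%E) = EFin \o (fun x => \sum_i c i * g i x).
  by apply/funext => x /=; rewrite -sumEFin.
have Rsum a b : \int[mu]_(x in `[a, b]) (\sum_i c i * g i x) =
    \sum_i c i * \int[mu]_(x in `[a, b]) g i x.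
  rewrite /Rintegral -[X in (\int[mu]_(x in _) X x)%E]/(EFin \o _) -E integral_sum//; last by move=> i; exact: icg.
  rewrite -sum_fine; last by move=> i _; exact: integrable_fin_num (icg i a b).
  by apply: eq_bigr => i _; rewrite -RintegralZl//; exact: (ig i).2.
split; last first.
  by move=> t; rewrite /oint; case: ifP => _; rewrite Rsum// -sumrN;
    apply: eq_bigr => i _; rewrite mulrN.
split; last by move=> a b; rewrite -E; exact: isum.
by apply: measurable_sum => i; apply: measurable_funM => //; exact: (ig i).1.
Qed.

Lemma loc_integrableM g h : continuous g -> measurable_fun setT h ->
  (exists M, \forall x \ae mu, `|h x| <= M) -> loc_integrable (fun x => g x * h x).
Proof.
move=> cg mh [M hM]; have mg := continuous_measurable_fun cg.
have mgh : measurable_fun setT (fun x => g x * h x) by exact: measurable_funM.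
split => // a b.
have igM : mu.-integrable `[a, b] (EFin \o (fun x => g x * M)).
  apply: continuous_compact_integrable; first exact: segment_compact.
  apply: continuous_subspaceT => x.
  by apply: cvgM; [exact: cg|exact: cvg_cst].
have mEgh : measurable_fun `[a, b] (EFin \o (fun x => g x * h x)).
  by apply/measurable_EFinP; exact: measurable_funTS.
apply/integrableP; split => //.
have /integrableP[mE] := igM; apply: le_lt_trans.
apply: ae_ge0_le_integral => //.
- exact: measurableT_comp.
- exact: measurableT_comp.
case: hM => N [mN N0 sN]; exists N; split => //.
apply: subset_trans sN => x /= nx hx; apply: nx => _.
rewrite lee_fin !normrM ler_wpM2l// (le_trans hx)//; exact: ler_norm.
Qed.

End LocalIntegral.

(** * The cocycle law of the inhomogeneous term *)

Section AffineCocycle.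
Context {R : realType} {B : metricType R} {H : finHilbertType R}.
Variables (theta : R -> B -> B) (phi psi : R -> B -> H -> H) (f : B -> R -> H).
Hypothesis af : affine_flow theta phi f psi.
Local Notation mu := (@lebesgue_measure R).
Local Notation e := (vbasis {:H}).
Local Notation n := (\dim {:H}).

Let lf : linear_flow theta phi. Proof. by case: af. Qed.

Let theta_continuous b : continuous (fun s => theta s b).
Proof.
move=> s; have c1 : id @ s --> s by exact: cvg_id.
have c2 : (fun=> b) @ s --> b by exact: cvg_cst.
have c3 : (fun=> 0 : H) @ s --> (0 : H) by exact: cvg_cst.
exact: (skew_cvg lf c1 c2 c3).1.
Qed.

Let phi_coord t b i x : coord e i (phi t b x) =
  \sum_(j < n) coord e i (phi t b e`_j) * coord e j x.
Proof.
pose g : {linear H -> H} :=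
  HB.pack (phi t b) (GRing.isLinear.Build _ _ _ _ (phi t b) (lf.2 t b)).
rewrite -[phi t b x]/(g x) {1}(coord_vbasis (memvf x)) linear_sum linear_sum.
by apply: eq_bigr => j _; rewrite linearZ /= linearZ /= mulrC.
Qed.

Lemma vintegral0E t (g : R -> H) :
  vintegral0 t g = \sum_(i < n) oint t (fun s => coord e i (g s)) *: e`_i.
Proof.
rewrite /vintegral0 /oint /vintegral; case: ifP => // _.
by rewrite -sumrN; apply: eq_bigr => i _; rewrite scaleNr.
Qed.

Lemma vintegral0_phi t b s (g : R -> H) :
  (forall i : 'I_n, loc_integrable (fun r => coord e i (g r))) ->
  vintegral0 s (fun r => phi t b (g r)) = phi t b (vintegral0 s g).
Proof.
move=> ig; rewrite [RHS](coord_vbasis (memvf _)) vintegral0E.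
apply: eq_bigr => i _; congr (_ *: _); rewrite phi_coord.
have -> : (fun r => coord e i (phi t b (g r))) =
    fun r => \sum_(j < n) coord e i (phi t b e`_j) * coord e j (g r).
  by apply/funext => r; rewrite phi_coord.
rewrite (loc_integrable_sum _ ig).2; apply: eq_bigr => j _; congr (_ * _).
rewrite vintegral0E linear_sum (bigD1 j)//= linearZ /= coord_free; last first.
  exact: basis_free (vbasisP _).
rewrite eqxx mulr1 big1 ?addr0// => k kj; rewrite linearZ /= coord_free; last first.
  exact: basis_free (vbasisP _).
by rewrite (negPf kj) mulr0.
Qed.

(** Expanding in matrix entries gives a finite sum of products of a function continuous in [s] and a
    coordinate of [f b], which is measurable and essentially bounded. *)
Lemma integrand_loc_integrable t b (i : 'I_n) :
  loc_integrable (fun s => coord e i (phi (t - s) (theta s b) (f b s))).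
Proof.
have -> : (fun s => coord e i (phi (t - s) (theta s b) (f b s))) =
    fun s => \sum_(j < n) 1 * (coord e i (phi (t - s) (theta s b) e`_j) * coord e j (f b s)).
  by apply/funext => s; rewrite phi_coord; apply: eq_bigr => j _; rewrite mul1r.
apply: (loc_integrable_sum _ _).1 => j; apply: loc_integrableM.
- move=> s; apply: (cvg_comp _ (fun x => coord e i x)); last exact: coord_continuous_fin.
  have c1 : (fun s => t - s) @ s --> t - s by apply: cvgB; [exact: cvg_cst|exact: cvg_id].
  have c2 : (fun s => theta s b) @ s --> theta s b by exact: theta_continuous.
  have c3 : (fun=> e`_j) @ s --> e`_j by exact: cvg_cst.
  exact: (skew_cvg lf c1 c2 c3).2.
- case: af => _ /(_ b)[mfb _] _ _ _ mT.
  apply: (measurability _ (RGenOInfty.measurableE R)) => // _ [_ [x ->] <-].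
  rewrite setTI; apply: (mfb ((fun y => coord e j y) @^-1` `]x, +oo[)).
  apply: open_comp; last exact: interval_open.
  by move=> y _; exact: coord_continuous_fin.
- case: af => _ /(_ b)[_ /ess_supr_bounded[M bM]] _ _ _.
  have [C C0 HC] := @coord_bound R H; exists (C * M).
  case: bM => N [mN N0 sN]; exists N; split => //.
  apply: subset_trans sN => s /= ns fM; apply: ns.
  by apply: le_trans (HC _ _) _; rewrite ler_pM2l.
Qed.

(** Joint continuity of the integral is obtained here, from that of [psi], rather than from
    estimates on the integrand. *)
Lemma affine_termE t b : affine_term theta phi f t b = psi t b 0.
Proof. by case: af => _ _ _ _ ->; rewrite (phi_zero lf) add0r. Qed.

(** The integral up to [t + s] is split at [s]. After translation the second piece contains
    [f b (r + s)], which may be replaced by [f (theta s b) r] only for the almost every [s] granted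
    by the shift law. *)
Lemma affine_term_ae t b : \forall s \ae mu,
  affine_term theta phi f (t + s) b =
  phi t (theta s b) (affine_term theta phi f s b) +
  affine_term theta phi f t (theta s b).
Proof.
case: af => _ _ /(_ b) shift _ _.
case: shift => N [mN N0 sN]; exists N; split => //.
apply: subset_trans sN => s /= ns fs; apply: ns.
rewrite /affine_term -(vintegral0_phi _ _ _ (integrand_loc_integrable s b)).
rewrite !vintegral0E -big_split /=; apply: eq_bigr => i _; rewrite -scalerDl.
congr (_ *: _); rewrite (oint_shift _ _ (integrand_loc_integrable _ _ _)).
congr (_ + _).
  congr oint; apply/funext => r; congr (coord _ _ _).
  rewrite -addrA (phiD lf); congr (phi t _ _).
  by rewrite -(thetaD lf) subrK.
apply: eq_oint; [|exact: integrand_loc_integrable|].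
  exact: (loc_integrable_shift s (integrand_loc_integrable (t + s) b i)).
case: fs => N' [mN' N'0 sN']; exists N'; split => //.
apply: subset_trans sN' => r /= nr fr; apply: nr.
by rewrite fr (thetaD lf); congr (coord _ _ (phi _ _ _)); ring.
Qed.

Lemma ae_eq0_continuous (g : R -> H) : continuous g ->
  (\forall s \ae mu, g s = 0) -> forall s, g s = 0.
Proof.
move=> cg [N [mN N0 sN]] s; apply: contrapT => /eqP gs.
have : \forall r \near s, g r != 0.
  have cgs : g @ s --> g s by exact: cg.
  have /cvgr_norm_gt := cgs; move=> /(_ 0); rewrite normr_gt0 => /(_ gs).
  by apply: filterS => r; rewrite normr_gt0.
move=> /nbhs_ballP[r /= r0 rN].
have : (mu (ball s r) <= mu N)%E.
  apply: le_measure; rewrite ?inE//; first exact: measurable_ball.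
  apply: subset_trans sN => q /rN gq /= gq0.
  by rewrite gq0 eqxx in gq.
rewrite N0 lebesgue_measure_ball ?(ltW r0)//; apply/negP.
by rewrite -ltNge lte_fin mulrn_wgt0.
Qed.

Lemma affine_term_cvg (I : Type) (F : set_system I) {FF : Filter F}
    (t : I -> R) (b : I -> B) t' b' :
  t @ F --> t' -> b @ F --> b' ->
  (fun i => affine_term theta phi f (t i) (b i)) @ F -->
  affine_term theta phi f t' b'.
Proof.
move=> tt bb; rewrite affine_termE.
have -> : (fun i => affine_term theta phi f (t i) (b i)) =
    (fun i => psi (t i) (b i) 0) by apply/funext => i; rewrite affine_termE.
case: af => _ _ _ cP _.
have c : (fun i => skew_product theta psi (t i) (b i, 0)) @ F -->
    (theta t' b', psi t' b' 0).
  exact: (cvg_comp _ _ (cvg_pair tt (cvg_pair bb (cvg_cst (0 : H)))) (cP (t', (b', 0)))).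
exact: (cvg_comp _ (@snd B H) c cvg_snd).
Qed.

(** The defect is continuous in [s] and vanishes almost everywhere; its nonzero set is open and
    contains no ball, since balls have positive measure. *)
Lemma affine_termD t s b : affine_term theta phi f (t + s) b =
  phi t (theta s b) (affine_term theta phi f s b) +
  affine_term theta phi f t (theta s b).
Proof.
apply/eqP; rewrite -subr_eq0; apply/eqP.
pose g s := affine_term theta phi f (t + s) b -
  (phi t (theta s b) (affine_term theta phi f s b) +
   affine_term theta phi f t (theta s b)).
apply: (@ae_eq0_continuous g).
  move=> {}s; apply: cvgB.
    apply: affine_term_cvg; last exact: cvg_cst.
    by apply: cvgD; [exact: cvg_cst|exact: cvg_id].
  have c2 : (fun s => theta s b) @ s --> theta s b by exact: theta_continuous.
  have c3 : (fun s => affine_term theta phi f s b) @ s --> affine_term theta phi f s b.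
    by apply: affine_term_cvg; [exact: cvg_id|exact: cvg_cst].
  apply: cvgD; last exact: affine_term_cvg (cvg_cst t) c2.
  have c1 : (fun=> t) @ s --> t by exact: cvg_cst.
  exact: (skew_cvg lf c1 c2 c3).2.
have [N [mN N0 sN]] := affine_term_ae t b; exists N; split => //.
apply: subset_trans sN => r /= nr gr; apply: nr.
by rewrite /g gr subrr.
Qed.

Lemma affine_term0 b : affine_term theta phi f 0 b = 0.
Proof.
have := affine_termD 0 0 b; rewrite addr0 (phi0 lf) (theta0 lf) => /eqP.
by rewrite -subr_eq subrr eq_sym => /eqP.
Qed.

(** [hilbert1 H] has the topology of its own norm; convergence is transferred from the factors by
    bounding the Euclidean norm by the sum of the two norms. *)
Lemma hilbert1_cvg (I : Type) (F : set_system I) {FF : Filter F}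
    (x : I -> H) (r : I -> R) x' r' : x @ F --> x' -> r @ F --> r' ->
  (fun i => (x i, r i) : hilbert1 H) @ F --> ((x', r') : hilbert1 H).
Proof.
move=> xx rr; apply/cvgrPdist_lt => d d0; near=> i.
have : `|x' - x i| + `|r' - r i| < d.
  rewrite [ltRHS]splitr; apply: ltrD; near: i.
    by apply: cvgr_dist_lt xx _ _; rewrite divr_gt0.
  by apply: cvgr_dist_lt rr _ _; rewrite divr_gt0.
apply: le_lt_trans; rewrite -[leLHS]/(norm1 _) /norm1 /=.
rewrite -ler_sqr ?nnegrE ?sqrtr_ge0 ?addr_ge0// sqr_sqrtr ?addr_ge0 ?sqr_ge0//.
rewrite -[(r' - r i) ^+ 2]real_normK ?num_real//.
have := normr_ge0 (x' - x i); have := normr_ge0 (r' - r i).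
by move: `|x' - x i| `|r' - r i| => p q q0 p0; nra.
Unshelve. all: by end_near.
Qed.

Lemma hilbert1_norm1 (u : hilbert1 H) : `|u.1| <= `|u| /\ `|u.2| <= `|u|.
Proof.
rewrite -[`|u|]/(norm1 u) /norm1; split.
  by rewrite -[leLHS]normr_id -sqrtr_sqr ler_sqrt ?lerDl ?addr_ge0 ?sqr_ge0.
by rewrite -sqrtr_sqr ler_sqrt ?lerDr ?addr_ge0 ?sqr_ge0.
Qed.

Lemma hilbert1_fst_cvg (I : Type) (F : set_system I) {FF : Filter F}
    (u : I -> hilbert1 H) (u' : hilbert1 H) : u @ F --> u' ->
  (fun i => (u i).1) @ F --> u'.1 /\ (fun i => (u i).2) @ F --> u'.2.
Proof.
move=> /cvgrPdist_lt uu; split; apply/cvgrPdist_lt => d /uu;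
  apply: filterS => i; apply: le_lt_trans.
  exact: (hilbert1_norm1 (u' - u i)).1.
exact: (hilbert1_norm1 (u' - u i)).2.
Qed.

Lemma lift_linear_flow : linear_flow theta (lift_cocycle theta phi f).
Proof.
split; last first.
  move=> t b a u v; rewrite /lift_cocycle /=.
  apply/pair_equal_spec; split => //=.
  rewrite (phi_add lf) (phi_scale lf) scalerDl scalerDr scalerA.
  by rewrite addrACA.
split.
- move=> [t [b u]].
  have ct : (fun p : R * (B * hilbert1 H) => p.1) @ (t, (b, u)) --> t by exact: cvg_fst.
  have cb : (fun p : R * (B * hilbert1 H) => p.2.1) @ (t, (b, u)) --> b.
    by apply: (cvg_comp _ _ cvg_snd); exact: cvg_fst.
  have cu : (fun p : R * (B * hilbert1 H) => p.2.2) @ (t, (b, u)) --> u.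
    by apply: (cvg_comp _ _ cvg_snd); exact: cvg_snd.
  have [c1 c2] := hilbert1_fst_cvg cu.
  have [d1 d2] := skew_cvg lf ct cb c1.
  have d3 : (fun p : R * (B * hilbert1 H) =>
      phi p.1 p.2.1 p.2.2.1 + p.2.2.2 *: affine_term theta phi f p.1 p.2.1) @
      nbhs (t, (b, u)) --> phi t b u.1 + u.2 *: affine_term theta phi f t b.
    by apply: (cvgD d2); apply: (cvgZ c2); exact: affine_term_cvg.
  exact: (cvg_pair d1 (hilbert1_cvg d3 c2)).
- move=> [b [x r]]; rewrite /skew_product /lift_cocycle /=.
  by rewrite (theta0 lf) (phi0 lf) affine_term0 scaler0 addr0.
- move=> t s [b [x r]]; rewrite /skew_product /lift_cocycle /=.
  rewrite (thetaD lf) (phiD lf) affine_termD (phi_add lf) (phi_scale lf).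
  by rewrite scalerDr addrA.
Qed.

End AffineCocycle.

(** * The hyperplane at infinity and the central bundle *)

Section BundleSums.
Context {R : realType} {B : metricType R} {H : finHilbertType R}.
Implicit Types (V W : set (B * H)) (Ws : seq (set (B * H))).

Lemma subbundle_fib k V : closed V -> linear_fibers V ->
  (forall b, \dim (fib V b) = k) -> subbundle k V.
Proof.
move=> cV lV dV; split => // b; exists (fib V b) => //.
by apply/seteqP; split => x /= /lV.
Qed.

Lemma subbundle_dim k V b : subbundle k V -> \dim (fib V b) = k.
Proof.
move=> [_ /(_ b)[U <- UE]]; congr (\dim _); apply: fib_eq => x.
by have /predeqP/(_ x) := UE.
Qed.

Lemma dim_sum_le (I : Type) (r : seq I) (P : pred I) (U : I -> {vspace H}) :
  (\dim (\sum_(i <- r | P i) U i)%VS <= \sum_(i <- r | P i) \dim (U i))%N.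
Proof.
elim/big_rec2: _ => [|i m V _ IH]; first by rewrite dimv0.
apply: leq_trans (dimv_add_leqif _ _).1 _.
by rewrite leq_add2l.
Qed.

(** The selected and the remaining part can each only lose dimension; as the whole sum loses none,
    neither part does. *)
Lemma dim_subsum (I : Type) (r : seq I) (P : pred I) (U : I -> {vspace H}) :
  (\dim (\sum_(i <- r) U i)%VS = \sum_(i <- r) \dim (U i))%N ->
  (\dim (\sum_(i <- r | P i) U i)%VS = \sum_(i <- r | P i) \dim (U i))%N.
Proof.
rewrite (bigID P) [in RHS](bigID P) /= => dU; apply/eqP; rewrite eqn_leq dim_sum_le /=.
rewrite -(leq_add2r (\sum_(i <- r | ~~ P i) \dim (U i))%N) -dU.
by apply: leq_trans (dimv_add_leqif _ _).1 _; rewrite leq_add2l dim_sum_le.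
Qed.

(** Independence is a dimension count: the fibers span, and their dimensions add up exactly. *)
Lemma direct_sum_fib Ws V : linear_fibers V ->
  (forall W, W \in Ws -> linear_fibers W) ->
  (forall b, (\sum_(W <- Ws) fib W b)%VS = fib V b) ->
  (forall b, (\sum_(W <- Ws) \dim (fib W b))%N = \dim (fib V b)) ->
  direct_sum Ws V.
Proof.
move=> lV lW sumW dimW.
have lWi (i : 'I_(size Ws)) b x : nth set0 Ws i (b, x) <-> x \in fib (nth set0 Ws i) b.
  by apply: lW; rewrite mem_nth.
have sumE b : (\sum_(i < size Ws) fib (nth set0 Ws i) b)%VS = fib V b.
  by rewrite -sumW (big_nth set0) big_mkord.
split.
  apply/seteqP; split => [[b x]|[b x] [w wW /= ->]].
    move=> /lV; rewrite -sumE => /memv_sumP[w wW ->].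
    by exists w => // i; apply/lWi; exact: wW.
  by apply/lV; rewrite -sumE; apply: memv_sumr => i _; apply/lWi; exact: wW.
move=> b w wW w0 i.
have dV : directv (\sum_(i < size Ws) fib (nth set0 Ws i) b).
  by rewrite directvE /= sumE -dimW (big_nth set0) big_mkord.
have /directv_sum_independent H0 := dV.
by apply: H0 => // j _; apply/lWi; exact: wW.
Qed.

End BundleSums.

(** Used with the position of the absorbing component as key and the central position as [c]: the
    absorbed components are consecutive. *)
Lemma sorted_split (T : eqType) (k : T -> nat) (c : nat) (s : seq T) :
  sorted (relpre k leq) s ->
  s = [seq x <- s | (k x < c)%N] ++ [seq x <- s | k x == c] ++
      [seq x <- s | (c < k x)%N].
Proof.
elim: s => //= x s IH xs; have {IH}IH := IH (path_sorted xs).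
have /allP xmin : all (relpre k leq x) s.
  by apply: order_path_min xs => ? ? ?; exact: leq_trans.
have noth (P : pred T) : (forall y, (k x <= k y)%N -> ~~ P y) -> [seq y <- s | P y] = [::].
  by move=> HP; apply/eqP; rewrite -(negbK (_ == _)) -has_filter; apply/hasPn => y /xmin/HP.
case: ltngtP => [kc|ck|kc] /=; first by rewrite {1}IH.
  rewrite (noth (fun y => (k y < c)%N)); last first.
    by move=> y ky; rewrite -leqNgt; exact: leq_trans (ltnW ck) ky.
  rewrite (noth (fun y => k y == c)); last first.
    by move=> y ky; rewrite gtn_eqF//; exact: leq_trans ck ky.
  rewrite {1}IH (noth (fun y => (k y < c)%N)); last first.
    by move=> y ky; rewrite -leqNgt; exact: leq_trans (ltnW ck) ky.
  rewrite (noth (fun y => k y == c))//.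
  by move=> y ky; rewrite gtn_eqF//; exact: leq_trans ck ky.
have N0 : [seq y <- s | (k y < c)%N] = [::].
  by apply: noth => y ky; rewrite -leqNgt -kc.
by rewrite N0 /=; rewrite {1}IH N0.
Qed.

Section HyperplaneAtInfinity.
Context {R : realType} {B : metricType R} {H : finHilbertType R}.
Variables (theta : R -> B -> B) (phi : R -> B -> H -> H) (f : B -> R -> H).
Hypothesis lf : linear_flow theta phi.
Local Notation H1 := (hilbert1 H).
Local Notation phi1 := (lift_cocycle theta phi f).
Hypothesis lf1 : linear_flow theta phi1.
Local Notation pf := (pflow theta phi).
Local Notation pf1 := (pflow theta phi1).

Definition at_infinity (x : H) : H1 := (x, 0).

Lemma at_infinityE (u : H1) : u.2 = 0 -> u = at_infinity u.1.
Proof. by case: u => x r /= ->. Qed.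

Lemma at_infinity_linear : linear at_infinity.
Proof.
by move=> a x y; apply/pair_equal_spec; split => //=; rewrite [RHS]addr0 scaler0.
Qed.

Lemma at_infinity_neq0 x : x != 0 -> at_infinity x != 0.
Proof. by apply: contraNneq => -[->]. Qed.

Lemma norm_at_infinity x : `|at_infinity x| = `|x|.
Proof.
rewrite -[LHS]/(norm1 _) /norm1 /= expr0n addr0 sqrtr_sqr.
by rewrite normr_id.
Qed.

Let pick_neq0 (L : projspace H) : vpick (pline L) != 0.
Proof. by case: L => L /= dL; rewrite vpick0 -dimv_eq0 (eqP dL). Qed.

Definition proj_at_infinity (L : projspace H) : projspace H1 :=
  projpt (at_infinity_neq0 (pick_neq0 L)).

Lemma proj_at_infinityE x (x0 : x != 0) (x10 : at_infinity x != 0) :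
  proj_at_infinity (projpt x0) = projpt x10.
Proof.
have /vlineP[c cE] : vpick (pline (projpt x0)) \in <[x]>%VS by exact: memv_pick.
apply: (projpt_eq _ _ (c := c)); rewrite cE.
by apply/pair_equal_spec; split => //=; rewrite scaler0.
Qed.

Definition embed (p : B * projspace H) : B * projspace H1 :=
  (p.1, proj_at_infinity p.2).

Lemma mdist_at_infinity L L' :
  mdist (proj_at_infinity L) (proj_at_infinity L') = mdist L L'.
Proof.
have [x x1 xL] := projptP L; have [y y1 yL] := projptP L'.
have x0 := norm_neq0 x1; have y0 := norm_neq0 y1.
rewrite -(xL x0) -(yL y0) (proj_at_infinityE x0 (at_infinity_neq0 x0)).
rewrite (proj_at_infinityE y0 (at_infinity_neq0 y0)) !pdist_projpt.
rewrite !unit_vecE ?norm_at_infinity//.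
have -> : at_infinity x - at_infinity y = at_infinity (x - y).
  by apply/pair_equal_spec; split => //=; exact: subr0.
have -> : at_infinity x + at_infinity y = at_infinity (x + y).
  by apply/pair_equal_spec; split => //=; exact: addr0.
by rewrite !norm_at_infinity.
Qed.

Lemma embed_ball p e q : ball (embed p) e (embed q) <-> ball p e q.
Proof.
have E : ball (proj_at_infinity p.2) e (proj_at_infinity q.2) <-> ball p.2 e q.2.
  by rewrite !ballEmdist /= mdist_at_infinity.
by split=> -[? ?]; split => //; apply/E.
Qed.

Lemma proj_at_infinity_inj : injective proj_at_infinity.
Proof.
by move=> L L' LL'; apply: mdist_positivity; rewrite -mdist_at_infinity LL' mdistxx.
Qed.

Lemma embed_inj : injective embed.
Proof. move=> [b L] [b' L'] E; have /= -> := congr1 fst E.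
by have /proj_at_infinity_inj /= -> := congr1 snd E. Qed.

Lemma embed_flow t p : embed (pf t p) = pf1 t (embed p).
Proof.
case: p => b L; have [x x1 xL] := projptP L; have x0 := norm_neq0 x1.
rewrite -(xL x0); have y0 : phi t b x != 0 by rewrite (phi_eq0 lf).
have z0 : phi1 t b (at_infinity x) != 0 by rewrite (phi_eq0 lf1) at_infinity_neq0.
rewrite (pflowE lf x0 y0) /embed /= (proj_at_infinityE x0 (at_infinity_neq0 x0)).
rewrite (pflowE lf1 _ z0) (proj_at_infinityE y0 (at_infinity_neq0 y0)).
congr (_, _); apply: (projpt_eq _ _ (c := 1)); rewrite scale1r.
by apply/pair_equal_spec; split => //=; rewrite scale0r addr0.
Qed.

Lemma embed_range b (u : H1) (u0 : u != 0) :
  range embed (b, projpt u0) <-> u.2 = 0.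
Proof.
split.
  move=> [[b' L] _ E]; have /projpt_inj[c c0 uE] := congr1 snd E.
  have := congr1 snd uE; rewrite /= -[RHS]/(c * u.2) => /esym/eqP.
  by rewrite mulf_eq0 (negPf c0) => /eqP.
case: u u0 => x r u0 /= r0; have x0 : x != 0 by apply: contraNneq u0 => ->; rewrite r0.
exists (b, projpt x0) => //; rewrite /embed /= (proj_at_infinityE x0 (at_infinity_neq0 x0)).
by congr (_, _); apply: (projpt_eq _ _ (c := 1)); rewrite scale1r /at_infinity r0.
Qed.

Lemma embed_bundle M : bundle_of (embed @` M) = binfty (bundle_of M).
Proof.
apply/seteqP; split => -[b u].
  move=> Mu; have [->|u0] := eqVneq u 0.
    by split => //; exact: bundle_of0.
  have [[b' L] ML E] := Mu u0.
  have /= bE := congr1 fst E; have /= LE := congr1 snd E.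
  have u20 : u.2 = 0 by apply/(embed_range b u0); exists (b', L); rewrite //= /embed bE LE.
  split => // x0 /=.
  suff <- : L = projpt x0 by rewrite -bE.
  apply: proj_at_infinity_inj; rewrite LE (proj_at_infinityE x0 (at_infinity_neq0 x0)).
  apply: (projpt_eq _ _ (c := 1)); rewrite scale1r.
  exact: at_infinityE.
move=> [/= Mu u20] u0 /=; have x0 : u.1 != 0.
  by apply: contraNneq u0 => x0; rewrite (at_infinityE u20) x0.
exists (b, projpt x0); first exact: Mu.
rewrite /embed /= (proj_at_infinityE x0 (at_infinity_neq0 x0)); congr (_, _).
apply: (projpt_eq _ _ (c := 1)); rewrite scale1r.
exact/esym/at_infinityE.
Qed.

Lemma embed_alpha p q : alpha_limit pf p q -> alpha_limit pf1 (embed p) (embed q).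
Proof.
move=> pq A W FA nW.
have [e /= e0 eW] : nbhs_ball (embed q) W by rewrite nbhs_ballE.
have FA' : (pf t p @[t --> -oo]) (embed @^-1` A).
  have E : (fun t => pf1 t (embed p)) = embed \o (fun t => pf t p).
    by apply/funext => t /=; rewrite embed_flow.
  by move: FA; rewrite E.
have [z [/= Az qz]] := pq _ _ FA' (nbhsx_ballx q e e0).
by exists (embed z); split => //; apply: eW; apply/embed_ball.
Qed.

Lemma embed_omega p q : omega_limit pf p q -> omega_limit pf1 (embed p) (embed q).
Proof.
move=> pq A W FA nW.
have [e /= e0 eW] : nbhs_ball (embed q) W by rewrite nbhs_ballE.
have FA' : (pf t p @[t --> +oo]) (embed @^-1` A).
  have E : (fun t => pf1 t (embed p)) = embed \o (fun t => pf t p).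
    by apply/funext => t /=; rewrite embed_flow.
  by move: FA; rewrite E.
have [z [/= Az qz]] := pq _ _ FA' (nbhsx_ballx q e e0).
by exists (embed z); split => //; apply: eW; apply/embed_ball.
Qed.

Lemma dim_hilbert1 : \dim {:H1} = (\dim {:H}).+1.
Proof. by rewrite !dimvf -addn1. Qed.

HB.instance Definition _ := GRing.isLinear.Build R H H1 _ at_infinity
  at_infinity_linear.

Definition vinf (U : {vspace H}) : {vspace H1} := (linfun at_infinity @: U)%VS.

Lemma dim_vinf U : \dim (vinf U) = \dim U.
Proof.
apply: limg_dim_eq; apply/eqP; rewrite -subv0; apply/subvP => x.
rewrite memv_cap memv_ker lfunE /= => /andP[_ /eqP[->]].
by rewrite mem0v.
Qed.

Lemma mem_vinf U (u : H1) : u \in vinf U <-> u.1 \in U /\ u.2 = 0.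
Proof.
split=> [/memv_imgP[y yU ->]|[uU /at_infinityE ->]]; first by rewrite lfunE.
have -> : at_infinity u.1 = linfun at_infinity u.1 by rewrite lfunE.
exact: memv_img.
Qed.

Lemma binfty_fib (V : set (B * H)) b : linear_fibers V -> fib (binfty V) b = vinf (fib V b).
Proof.
move=> lV; apply: fib_eq => u; rewrite mem_vinf.
by split=> -[/= /lV ? ?].
Qed.

Lemma binfty_linear (V : set (B * H)) : linear_fibers V -> linear_fibers (binfty V).
Proof.
move=> lV b u; rewrite binfty_fib// mem_vinf.
by split=> -[/= /lV ? ?].
Qed.

End HyperplaneAtInfinity.

(** * Matching the components of the flow with those of its lift *)

Section CentralBundle.
Context {R : realType} {B : metricType R} {H : finHilbertType R}.
Variables (theta : R -> B -> B) (phi : R -> B -> H -> H) (f : B -> R -> H).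
Local Notation H1 := (hilbert1 H).
Local Notation phi1 := (lift_cocycle theta phi f).
Local Notation pf := (pflow theta phi).
Local Notation pf1 := (pflow theta phi1).
Variables (Ms : seq (set (B * projspace H))) (Ms1 : seq (set (B * projspace H1))).
Hypotheses (cB : compact [set: B]) (B0 : [set: B] !=set0).
Hypothesis ctB : chain_transitive theta [set: B].
Hypotheses (lf : linear_flow theta phi) (lf1 : linear_flow theta phi1).
Hypotheses (uM : uniq Ms) (memM : forall M, M \in Ms <-> chain_component pf M).
Hypothesis leM : forall i j, (i < j < size Ms)%N ->
  component_le pf (nth set0 Ms i) (nth set0 Ms j).
Hypothesis spec1 : selgrade_spec theta phi1 Ms1.
Local Notation d := (\dim {:H}).
Local Notation emb M := (embed @` M).
Implicit Types (M : set (B * projspace H)) (N : set (B * projspace H1)).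

(** The given list has the same members as the constructed one, which suffices for sums of fibers
    and dimensions; its ordering enters through [leM] instead. *)
Let perm_spec Ms0 : selgrade_spec theta phi Ms0 -> perm_eq Ms Ms0.
Proof.
move=> s0; apply: uniq_perm => //; first exact: spec_uniq s0.
by move=> M; apply/idP/idP => [/memM /(spec_mem s0)|/(spec_mem s0) /memM].
Qed.

Let component_fib M : M \in Ms ->
  linear_fibers (bundle_of M) /\ exists k, forall b, \dim (fib (bundle_of M) b) = k.
Proof.
move=> MM; have [d0|d0] := posnP d.
  have H0 (x : H) : x = 0.
    apply/eqP; rewrite -memv0.
    by have /eqP <- : ({:H} == 0)%VS; rewrite ?memvf// -dimv_eq0 d0.
  split; first by move=> b x; rewrite (H0 x) mem0v; split=> // _; exact: bundle_of0.
  by exists 0%N => b; apply/eqP; rewrite -leqn0 -d0 dimvS// subvf.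
have [Ms0 s0] := selgrade cB lf B0 ctB d0.
have MM0 : M \in Ms0 by rewrite -(perm_mem (perm_spec s0)).
split; first exact: (spec_fib s0 MM0).
by have [k _ kM] := spec_dim s0 MM0; exists k.
Qed.

Let component_sum b :
  (\sum_(M <- Ms) fib (bundle_of M) b)%VS = fullv /\
  (\sum_(M <- Ms) \dim (fib (bundle_of M) b))%N = d.
Proof.
have [d0|d0] := posnP d.
  have dim0 (U : {vspace H}) : \dim U = 0%N.
    by apply/eqP; rewrite -leqn0 -d0 dimvS// subvf.
  split; first by apply/eqP; rewrite eqEdim subvf dim0.
  by rewrite d0 big1// => M _.
have [Ms0 s0] := selgrade cB lf B0 ctB d0.
rewrite !(perm_big _ (perm_spec s0)).
by split; [exact: (spec_sum s0)|exact: (spec_sum_dim s0)].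
Qed.

Let component_cover M' : chain_transitive pf M' -> M' !=set0 ->
  exists2 M, M \in Ms & M' `<=` M.
Proof.
move=> cM' M'0; have d0 : (0 < d)%N.
  by have [[b [U /= /eqP <-]] _] := M'0; rewrite dimvS// subvf.
have [Ms0 s0] := selgrade cB lf B0 ctB d0.
have [M MM0 M'M] := spec_cover s0 cM' M'0.
by exists M => //; rewrite (perm_mem (perm_spec s0)).
Qed.

Let maximal1 N N' : N \in Ms1 -> N' \in Ms1 -> N `<=` N' -> N = N'.
Proof.
move=> /(spec_mem spec1)[_ maxN] /(spec_mem spec1)[cN' _] NN'.
by rewrite (maxN _ cN' NN').
Qed.

Let maximal M M' : M \in Ms -> M' \in Ms -> emb M `<=` emb M' -> M = M'.
Proof.
move=> /memM[_ maxM] /memM[cM' _] MM'.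
rewrite (maxM _ cM')// => x Mx.
by have [x' M'x' /embed_inj <-] := MM' _ (imageP embed Mx).
Qed.

Let n1 := size Ms1.

Let hosted M : M \in Ms -> has (fun N => `[< emb M `<=` N >]) Ms1.
Proof.
(* The empty component, which arises for dim H = 0, is hosted by any component of the lift; one
   exists because the dimensions add up to at least 1. *)
move=> /memM[cM _]; have [->|M0] := eqVneq M set0.
  suff [N NM] : exists N, N \in Ms1.
    by apply/hasP; exists N => //; apply/asboolP; rewrite image_set0.
  have [b _] := B0; have := spec_sum_dim spec1 b; rewrite dim_hilbert1.
  case: Ms1 => [|N s _]; first by rewrite big_nil.
  by exists N; rewrite mem_head.
have cM1 := chain_transitive_image (@embed_ball _ _ _) (embed_flow lf lf1) cM.
have [|N NM MN] := spec_cover spec1 cM1.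
  by have /set0P[x Mx] := M0; exists (embed x); exact: imageP.
by apply/hasP; exists N => //; apply/asboolP.
Qed.

Let idx M := find (fun N => `[< emb M `<=` N >]) Ms1.

Let idx_lt M : M \in Ms -> (idx M < n1)%N.
Proof. by move=> /hosted; rewrite has_find. Qed.

Let idx_sub M : M \in Ms -> emb M `<=` nth set0 Ms1 (idx M).
Proof. by move=> /hosted /(nth_find set0) /asboolP. Qed.

Let good N := `[< N `<=` range (@embed R B H) >].

(** By shadowing, the preimage of [N] is chain transitive, so it lies in some [M]. Then [N] lies in
    [emb M], which lies in the component hosting [M], and maximality of [N] makes the three
    coincide. *)
Let good_comp N : N \in Ms1 -> good N -> exists2 M, M \in Ms & N = emb M.
Proof.
move=> NM /asboolP Nr.
have [U [eU [TU [W [eW [TW [tU tW NE]]]]]]] := spec_trap spec1 NM.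
have cN : chain_transitive pf (embed @^-1` N).
  rewrite NE; apply: (preimage_chain_transitive (bundle_space_compact cB)
    (pflow_flow lf1) (@embed_ball _ _ _) (embed_flow lf lf1) tU tW).
    by rewrite -NE.
  by rewrite -NE; have /(spec_mem spec1)[] := NM.
have [q Nq] := spec_neq0 spec1 NM; have [p _ pq] := Nr _ Nq.
have [|M MM NMs] := component_cover cN; first by exists p; rewrite /preimage/= pq.
have Nemb : N `<=` emb M.
  move=> y Ny; have [x _ xy] := Nr _ Ny; exists x => //.
  by apply: NMs; rewrite /preimage /= xy.
exists M => //; apply/seteqP; split => //.
have iM := idx_sub MM.
have NE' := maximal1 NM (mem_nth set0 (idx_lt MM)) (subset_trans Nemb iM).
by rewrite [X in _ `<=` X]NE'.
Qed.

Let idx_good M : M \in Ms -> good (nth set0 Ms1 (idx M)) ->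
  nth set0 Ms1 (idx M) = emb M.
Proof.
move=> MM gM; have [M' MM' E] := good_comp (mem_nth _ (idx_lt MM)) gM.
have iM := idx_sub MM; rewrite E in iM.
by rewrite E (maximal MM MM' iM).
Qed.

(** Limit points of a connecting orbit embed as limit points of an orbit of the lift, so
    [spec_order] applies link by link. *)
Let idx_le M M' : component_le pf M M' -> (idx M <= idx M')%N.
Proof.
move=> [n [N [x [Ncomp <- <- Nx]]]].
suff: forall k, (k <= n)%N -> (idx (N 0) <= idx (N k))%N by exact.
elim=> [//|k IH kn]; apply: leq_trans (IH (ltnW kn)) _.
have [aN oN] := Nx _ kn.
have cX : compact [set: B * projspace H] := bundle_space_compact cB.
have [q aq] := alpha_limit_neq0 pf cX (x k).
have [r or] := omega_limit_neq0 pf cX (x k).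
have Nk : N k \in Ms by apply/memM/Ncomp/ltnW.
have Nk1 : N k.+1 \in Ms by apply/memM/Ncomp.
apply: (spec_order spec1 (idx_lt Nk) (idx_lt Nk1)
  (embed_alpha lf lf1 aq) _ (embed_omega lf lf1 or)).
  exact/idx_sub/imageP/aN.
exact/idx_sub/imageP/oN.
Qed.

Let idx_sorted : sorted (relpre idx leq) Ms.
Proof.
apply/(sortedP set0) => i iM; apply: idx_le; apply: leM.
by rewrite leqnn.
Qed.

Local Notation S j b :=
  (\sum_(M <- Ms | idx M == j) vinf (fib (bundle_of M) b))%VS.
Local Notation F j b := (fib (bundle_of (nth set0 Ms1 j)) b).

Let b0 := sval (cid B0).
Let s j := (\sum_(M <- Ms | idx M == j) \dim (fib (bundle_of M) b0))%N.
Let delta j := \dim (F j b0).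

Let vinf_sum b : (\sum_(M <- Ms) vinf (fib (bundle_of M) b))%VS = vinf fullv.
Proof. by rewrite -(component_sum b).1 /vinf limg_sum. Qed.

Let dimS j b : \dim (S j b) = s j.
Proof.
rewrite dim_subsum; last first.
  rewrite vinf_sum dim_vinf -(component_sum b).2.
  by apply: eq_bigr => M _; rewrite dim_vinf.
rewrite /s big_seq_cond [RHS]big_seq_cond; apply: eq_bigr => M /andP[MM _].
by rewrite dim_vinf; have [_ [k kM]] := component_fib MM; rewrite !kM.
Qed.

Let dimF j b : (j < n1)%N -> \dim (F j b) = delta j.
Proof.
by move=> jn; have [k _ kM] := spec_dim spec1 (mem_nth set0 jn); rewrite /delta !kM.
Qed.

Let memF j b u : (j < n1)%N -> bundle_of (nth set0 Ms1 j) (b, u) <-> u \in F j b.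
Proof. by move=> jn; apply: (spec_fib spec1); exact: mem_nth. Qed.

Let subS j b : (j < n1)%N -> (S j b <= F j b :&: vinf fullv)%VS.
Proof.
move=> jn; rewrite big_seq_cond; elim/big_ind: _ => [|U V US VS|M /andP[MM /eqP ij]].
- exact: sub0v.
- by rewrite subv_add US VS.
apply/subvP => u uM'; rewrite memv_cap; apply/andP; split; last first.
  by have /mem_vinf[_ u2] := uM'; apply/mem_vinf; rewrite memvf.
apply/(memF _ _ jn); have [lM _] := component_fib MM.
have : binfty (bundle_of M) (b, u) by apply/(binfty_linear lM); rewrite binfty_fib.
rewrite -embed_bundle => Mu u0; rewrite -ij; exact/idx_sub/Mu.
Qed.

Let bad_witness N : ~~ good N -> exists b (u : H1), bundle_of N (b, u) /\ u.2 != 0.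
Proof.
move=> /asboolPn /existsNP[[b L] /not_implyP[NL Lr]].
have [u u1 uL] := projptP L; have u0 := norm_neq0 u1.
exists b, u; split; first by move=> u0'; rewrite uL.
by apply/eqP => u2; apply: Lr; rewrite -(uL u0); apply/embed_range.
Qed.

Let good_sub j b : (j < n1)%N -> good (nth set0 Ms1 j) -> (F j b <= vinf fullv)%VS.
Proof.
move=> jn /asboolP g; apply/subvP => u /(memF _ _ jn) Nu.
apply/mem_vinf; rewrite memvf; split => //.
have [->//|u0] := eqVneq u 0.
by apply/(embed_range b u0)/g; exact: Nu.
Qed.

(** The boolean counts 1 for a component leaving infinity. Its witness off infinity lives over some
    [b], where the inclusion of fibers is strict; constancy of dimensions carries this to [b0]. *)
Let s_delta j : (j < n1)%N -> (s j + ~~ good (nth set0 Ms1 j) <= delta j)%N.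
Proof.
move=> jn; case: (boolP (good _)) => [_|/bad_witness[b [u [Nu u2]]]] /=.
  rewrite addn0 -(dimS j b0); apply: dimvS.
  exact: subv_trans (subS b0 jn) (capvSl _ _).
rewrite addn1 -(dimS j b) -(dimF b jn) ltn_neqAle dimvS ?andbT; last first.
  exact: subv_trans (subS b jn) (capvSl _ _).
apply/eqP => dE; move/negP: u2; apply.
have SF : (S j b == F j b)%VS.
  by rewrite eqEdim dE leqnn andbT (subv_trans (subS b jn) (capvSl _ _)).
have : u \in S j b by rewrite (eqP SF); exact/(memF _ _ jn).
by move=> /(subvP (subS b jn)); rewrite memv_cap => /andP[_ /mem_vinf[_ ->]].
Qed.

Let sum_s : (\sum_(j < n1) s j)%N = d.
Proof.
rewrite -(component_sum b0).2 (exchange_big_dep predT) //=.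
rewrite big_seq [RHS]big_seq; apply: eq_bigr => M MM.
by rewrite (eq_bigl (pred1 (Ordinal (idx_lt MM)))) ?big_pred1_eq.
Qed.

Let sum_delta : (\sum_(j < n1) delta j)%N = d.+1.
Proof.
by rewrite -dim_hilbert1 -(spec_sum_dim spec1 b0) (big_nth set0) big_mkord.
Qed.

Let exists_bad : exists2 c, (c < n1)%N & ~~ good (nth set0 Ms1 c).
Proof.
apply: contrapT => nobad.
have g j : (j < n1)%N -> good (nth set0 Ms1 j).
  by move=> jn; apply: contrapT => /negP nj; apply: nobad; exists j.
have : ((0, 1) : H1) \in fullv by exact: memvf.
rewrite -(spec_sum spec1 b0) (big_nth set0) big_mkord.
have sub : (\sum_(j < n1) F j b0 <= vinf fullv)%VS.
  by apply/subv_sumP => j _; apply: good_sub => //; exact: g.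
by move=> /(subvP sub) /mem_vinf[_ /eqP]; rewrite oner_eq0.
Qed.

Let c := sval (cid2 exists_bad).

Let c_lt : (c < n1)%N. Proof. exact: (s2valP (cid2 exists_bad)). Qed.

Let c_bad : ~~ good (nth set0 Ms1 c). Proof. exact: (s2valP' (cid2 exists_bad)). Qed.

(* d + 1 = sum of delta >= sum of s + number of bad components
   = d + number of bad components. *)
Let others_good j : (j < n1)%N -> j != c -> good (nth set0 Ms1 j).
Proof.
move=> jn jc; apply: contrapT => /negP jbad.
have : (\sum_(i < n1) (s i + ~~ good (nth set0 Ms1 i)) <= d.+1)%N.
  by rewrite -sum_delta; apply: leq_sum => i _; exact: s_delta.
rewrite big_split /= sum_s -addn1 leq_add2l.
rewrite (bigD1 (Ordinal c_lt))//= c_bad (bigD1 (Ordinal jn))/=; last first.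
  by rewrite -val_eqE.
by rewrite jbad.
Qed.

Let delta_c : delta c = (s c).+1.
Proof.
apply/eqP; rewrite eqn_leq; apply/andP; split; last first.
  by have := s_delta c_lt; rewrite c_bad addn1.
rewrite -(leq_add2r (\sum_(i < n1 | i != Ordinal c_lt) delta i)%N).
have <- : (\sum_(i < n1) delta i = delta c + \sum_(i < n1 | i != Ordinal c_lt) delta i)%N.
  by rewrite (bigD1 (Ordinal c_lt)).
rewrite sum_delta -sum_s (bigD1 (Ordinal c_lt))//= -addSn leq_add2l.
apply: leq_sum => i _; apply: leq_trans (s_delta (ltn_ord i)).
exact: leq_addr.
Qed.

Let Vc := bundle_of (nth set0 Ms1 c).

(** [S c b] has codimension 1 in [F c b], so it suffices that [F c b] leaves the hyperplane. This
    holds over every [b], since all other fibers lie in the hyperplane while together they span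
    everything. *)
Let fib_Vc b : (F c b :&: vinf fullv)%VS = S c b.
Proof.
apply/esym/eqP; rewrite eqEdim subS// dimS -ltnS -delta_c -(dimF b c_lt).
rewrite ltn_neqAle dimvS ?capvSl// andbT; apply/eqP => dE.
have FcE : (F c b <= vinf fullv)%VS.
  have /eqP <- : (F c b :&: vinf fullv == F c b)%VS by rewrite eqEdim capvSl dE leqnn.
  exact: capvSr.
have sub : (\sum_(j < n1) F j b <= vinf fullv)%VS.
  apply/subv_sumP => j _; have [->//|jc] := eqVneq (val j) c.
  by apply: good_sub => //; exact: others_good.
have : ((0, 1) : H1) \in fullv by exact: memvf.
rewrite -(spec_sum spec1 b) (big_nth set0) big_mkord => /(subvP sub).
by move=> /mem_vinf[_ /eqP]; rewrite oner_eq0.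
Qed.

Let A := [seq M <- Ms | (idx M < c)%N].
Let C := [seq M <- Ms | idx M == c].
Let D := [seq M <- Ms | (c < idx M)%N].

Let Ms_split : Ms = A ++ C ++ D.
Proof. exact: sorted_split idx_sorted. Qed.

(** Away from [c], taking [emb M] and taking the host are inverse to each other. So [idx] is
    injective there and its sorted values enumerate exactly the positions satisfying [P]. *)
Let idx_filter (P : pred nat) (t : seq nat) : (forall j, P j -> j != c) ->
  sorted ltn t -> (forall j, (j \in t) = (j < n1)%N && P j) ->
  [seq emb M | M <- Ms & P (idx M)] = [seq nth set0 Ms1 j | j <- t].
Proof.
move=> Pc st memt.
have gP M : M \in Ms -> P (idx M) -> nth set0 Ms1 (idx M) = emb M.
  by move=> MM /Pc ic; apply: idx_good => //; apply: others_good => //; exact: idx_lt.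
suff <- : [seq idx M | M <- Ms & P (idx M)] = t.
  rewrite -map_comp; apply/eq_in_map => M; rewrite mem_filter => /andP[PM MM].
  by rewrite /= gP.
apply: (irr_sorted_eq ltn_trans ltnn) => //.
  rewrite ltn_sorted_uniq_leq; apply/andP; split.
    rewrite map_inj_in_uniq ?filter_uniq// => M M'.
    rewrite !mem_filter => /andP[PM MM] /andP[PM' MM'] iE.
    by apply: maximal => //; rewrite -!gP// iE.
  rewrite sorted_map; apply: sorted_filter idx_sorted.
  by move=> ? ? ?; exact: leq_trans.
move=> j; rewrite memt; apply/mapP/andP.
  by move=> [M]; rewrite mem_filter => /andP[PM MM] ->; rewrite idx_lt.
move=> [jn Pj]; have [M MM NE] := good_comp (mem_nth set0 jn) (others_good jn (Pc _ Pj)).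
have iE : idx M = j.
  have iM := idx_sub MM; rewrite -NE in iM.
  have /eqP := maximal1 (mem_nth set0 jn) (mem_nth set0 (idx_lt MM)) iM.
  by rewrite (nth_uniq _ jn (idx_lt MM) (spec_uniq spec1)) => /eqP.
by exists M; rewrite ?mem_filter iE ?Pj.
Qed.

Let embA : [seq emb M | M <- A] = take c Ms1.
Proof.
rewrite (@idx_filter (fun j => (j < c)%N) (iota 0 c)).
- by rewrite map_nth_iota0// ltnW.
- by move=> j jc; rewrite ltn_eqF.
- exact: iota_ltn_sorted.
- move=> j; rewrite mem_iota /= add0n; apply/idP/andP => [jc|[]//].
  by split => //; exact: ltn_trans c_lt.
Qed.

Let embD : [seq emb M | M <- D] = drop c.+1 Ms1.
Proof.
rewrite (@idx_filter (fun j => (c < j)%N) (iota c.+1 (n1 - c.+1))).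
- by rewrite map_nth_iota// take_oversize// size_drop.
- by move=> j jc; rewrite gtn_eqF.
- exact: iota_ltn_sorted.
- by move=> j; rewrite mem_iota subnKC// andbC.
Qed.

Let bundle_emb (r : seq (set (B * projspace H))) :
  [seq binfty V | V <- [seq bundle_of M | M <- r]] =
  [seq bundle_of N | N <- [seq emb M | M <- r]].
Proof.
by rewrite -!map_comp; apply: eq_map => M /=; rewrite embed_bundle.
Qed.

Lemma central_bundle :
  let Vsinf := [seq binfty V | V <- [seq bundle_of M | M <- Ms]] in
  exists (lp l0 : nat) (W : set (B * H1)),
    let Ws := take lp Vsinf ++ W :: drop (lp + l0) Vsinf in
    let Vcinf := bundle_sum (take l0 (drop lp Vsinf)) in
    [/\ (lp + l0 <= size Ms)%N,
        selgrade_decomposition theta phi1 Ws /\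
        (forall V, V \in Ws -> (V `&` H11 (H := H) !=set0 <-> V = W)),
        direct_sum (take l0 (drop lp Vsinf)) (W `&` H10 (H := H)),
        (exists k, subbundle k Vcinf /\ subbundle k.+1 W) /\
        (subbundle 1 W <-> W `&` H10 (H := H) = [set p | p.2 = 0]) &
        forall M, M \in Ms -> chain_transitive pf1 (h1_image (bundle_of M)) ->
          binfty (bundle_of M) `<=` W].
Proof.
(* The two numbers count the components hosted before the central position and at it. *)
move=> Vsinf; exists (size A), (size C), Vc => Ws Vcinf.
have VsinfE : Vsinf = [seq bundle_of N | N <- [seq emb M | M <- A]] ++
    [seq binfty V | V <- [seq bundle_of M | M <- C]] ++
    [seq bundle_of N | N <- [seq emb M | M <- D]].
  by rewrite /Vsinf {1}Ms_split !map_cat !bundle_emb.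
have takeE : take (size A) Vsinf = [seq bundle_of N | N <- take c Ms1].
  by rewrite VsinfE take_size_cat; [rewrite embA|rewrite !size_map].
have dropE : drop (size A + size C) Vsinf = [seq bundle_of N | N <- drop c.+1 Ms1].
  by rewrite VsinfE catA drop_size_cat; [rewrite embD|rewrite size_cat !size_map].
have midE : take (size C) (drop (size A) Vsinf) =
    [seq binfty V | V <- [seq bundle_of M | M <- C]].
  by rewrite VsinfE drop_size_cat ?take_size_cat ?size_map// !size_map.
have Ms1E : Ms1 = take c Ms1 ++ nth set0 Ms1 c :: drop c.+1 Ms1.
  by rewrite -drop_nth// cat_take_drop.
have WsE : Ws = [seq bundle_of N | N <- Ms1].
  by rewrite /Ws takeE dropE [in RHS]Ms1E map_cat.
have cMs1 N : N \in Ms1 -> closed N.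
  move=> /(spec_trap spec1)[U [eU [TU [W [eW [TW [tU tW ->]]]]]]].
  apply: closedI; first exact: (closed_attr (pflow_flow lf1) tU).
  exact: (closed_rep (pflow_flow lf1) tW).
have cVc : closed Vc by apply: closed_bundle_of; apply: cMs1; exact: mem_nth.
have lH10 b u : (Vc `&` H10 (H := H)) (b, u) <-> u \in S c b.
  rewrite -fib_Vc memv_cap; split.
    by move=> [/(memF _ _ c_lt) -> u2]; apply/mem_vinf; rewrite memvf.
  by move=> /andP[/(memF _ _ c_lt) Vu /mem_vinf[_ u2]].
have fH10 b : fib (Vc `&` H10 (H := H)) b = S c b by apply: fib_eq => u; exact: lH10.
have lH10' : linear_fibers (Vc `&` H10 (H := H)) by move=> b u; rewrite fH10.
have dir : direct_sum (take (size C) (drop (size A) Vsinf)) (Vc `&` H10 (H := H)).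
  rewrite midE; apply: direct_sum_fib => //.
  - move=> W /mapP[V /mapP[M + ->] ->]; rewrite mem_filter => /andP[_ MM].
    exact/binfty_linear/(component_fib MM).1.
  - move=> b; rewrite fH10 !big_map big_filter big_seq_cond [RHS]big_seq_cond.
    by apply: eq_bigr => M /andP[MM _]; rewrite binfty_fib//; have [] := component_fib MM.
  - move=> b; rewrite fH10 dimS !big_map big_filter /s big_seq_cond [RHS]big_seq_cond.
    apply: eq_bigr => M /andP[MM _]; have [lM [k kM]] := component_fib MM.
    by rewrite binfty_fib// dim_vinf !kM.
have cH10 : closed (Vc `&` H10 (H := H)).
  apply: closedI => //.
  apply: (@preimage_closed _ _ (fun p : B * H1 => p.2.2) [set 0]); last first.
    exact/accessible_closed_set1/hausdorff_accessible/norm_hausdorff.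
  by move=> p _; apply: (hilbert1_fst_cvg (u := snd) _).2; exact: cvg_snd.
have sH10 : subbundle (s c) (Vc `&` H10 (H := H)).
  by apply: subbundle_fib => // b; rewrite fH10 dimS.
have sVc : subbundle (s c).+1 Vc.
  apply: subbundle_fib => // [b u|b]; first exact: memF.
  by rewrite dimF// delta_c.
split => //.
- by rewrite Ms_split !size_cat leq_add2l leq_addr.
- split.
    rewrite WsE; split.
    + exists Ms1; split => //; [exact: spec_uniq spec1|exact: spec_mem spec1|].
      exact: spec_le spec1.
    + move=> V /mapP[N NM ->]; have [k _ kN] := spec_dim spec1 NM.
      exists k; apply: subbundle_fib => //; first by apply: closed_bundle_of; apply: cMs1.
      exact: (spec_fib spec1 NM).
    + have lT : linear_fibers [set: B * H1].
        by move=> b u; rewrite (fib_eq (U := fullv)) => [|x]; rewrite memvf.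
      have fT b : fib [set: B * H1] b = fullv.
        by apply: fib_eq => x; rewrite memvf.
      apply: direct_sum_fib => //.
      * by move=> W /mapP[N NM ->]; exact: (spec_fib spec1 NM).
      * by move=> b; rewrite big_map (spec_sum spec1) fT.
      * by move=> b; rewrite big_map (spec_sum_dim spec1) fT.
  move=> V; rewrite WsE => /mapP[N /(nthP set0)[j jn <-] ->]; split.
    move=> [[b u] [Nu /= u2]]; rewrite /Vc; congr bundle_of.
    have [->//|jc] := eqVneq j c; exfalso; move/negP: u2; apply.
    have /subvP := good_sub b jn (others_good jn jc).
    by move=> /(_ u); case/(memF _ _ jn): Nu => -> /(_ isT) /mem_vinf[_ ->].
  move=> ->; have [b [u [Nu u2]]] := bad_witness c_bad.
  by exists (b, u).
- split.
    exists (s c); split => //.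
    by rewrite /Vcinf -dir.1.
  split=> [/(subbundle_dim b0)|VE].
    rewrite dimF// delta_c => -[sc0].
    apply/seteqP; split => -[b u] /=.
      move=> /lH10; have /eqP -> : (S c b == 0)%VS by rewrite -dimv_eq0 dimS sc0.
      by rewrite memv0 => /eqP.
    by move=> ->; apply/lH10; exact: mem0v.
  suff <- : s c = 0%N by [].
  rewrite -(dimS c b0) -fH10; apply/eqP; rewrite dimv_eq0; apply/eqP.
  by apply: fib_eq => u; rewrite VE memv0; split => /eqP.
move=> M MM cM [b u] [/= Mu u2].
(* The zero vector over [b] gives the line of (0, 1), which is off infinity; hence the component
   containing the image of [h1] can only be the central one. *)
have hb : h1_image (bundle_of M) (b, projpt (affine_point_neq0 0)).
  by exists 0 => //; exact: bundle_of0.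
have [N NM hN] := spec_cover spec1 cM (ex_intro _ _ hb).
have NE : N = nth set0 Ms1 c.
  have /(nthP set0)[j jn jE] := NM; rewrite -jE; congr nth.
  apply/eqP; apply: contrapT => /negP jc.
  have /asboolP := others_good jn jc; rewrite jE => /(_ _ (hN _ hb)) /embed_range.
  by move/eqP; rewrite /= oner_eq0.
(* This vector is a multiple of [(k.+1%:R *: u.1, 1)], and fibers of [bundle_of M] are stable under
   scaling. *)
have Vcn (k : nat) : Vc (b, ((u.1, k.+1%:R^-1) : H1)).
  move=> w0; rewrite -NE; apply: hN; exists (k.+1%:R *: u.1).
    exact: bundle_of_scale.
  apply: (projpt_eq _ _ (c := k.+1%:R^-1)).
  apply/pair_equal_spec; split => /=; last by rewrite /GRing.scale /= mulr1.
  by rewrite scalerA mulVf ?scale1r.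
have c1 : (fun k : nat => (u.1, k.+1%:R^-1) : H1) @ \oo --> u.
  rewrite (at_infinityE u2); apply: hilbert1_cvg; first exact: cvg_cst.
  exact: cvg_harmonic.
have c2 : (fun k : nat => (b, ((u.1, k.+1%:R^-1) : H1))) @ \oo --> (b, u).
  have cb : (fun=> b) @ \oo --> b by exact: cvg_cst.
  exact: (cvg_pair cb c1).
apply: (@closed_cvg _ _ \oo _ (fun k : nat => (b, ((u.1, k.+1%:R^-1) : H1))) Vc cVc _ _ c2).
exact: nearW.
Qed.

End CentralBundle.

Theorem theorem12 (R : realType) (B : metricType R) (H : finHilbertType R)
    (theta : R -> B -> B) (phi psi : R -> B -> H -> H) (f : B -> R -> H)
    (Vs : seq (set (B * H))) :
  [set: B] !=set0 -> compact [set: B] ->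
  is_flow theta -> chain_transitive theta [set: B] ->
  affine_flow theta phi f psi ->
  selgrade_bundles theta phi Vs ->
  let Vsinf := [seq binfty V | V <- Vs] in
  let phi1 := lift_cocycle theta phi f in
  exists (lp l0 : nat) (Vc : set (B * hilbert1 H)),
    let Ws := take lp Vsinf ++ Vc :: drop (lp + l0) Vsinf in
    let Vcinf := bundle_sum (take l0 (drop lp Vsinf)) in
    [/\ (lp + l0 <= size Vs)%N,
        (* (i) *)
        selgrade_decomposition theta phi1 Ws /\
        (forall W, W \in Ws -> (W `&` H11 !=set0 <-> W = Vc)),
        (* (ii) *)
        direct_sum (take l0 (drop lp Vsinf)) (Vc `&` H10),
        (* (iii) *)
        (exists k, subbundle k Vcinf /\ subbundle k.+1 Vc) /\
        (subbundle 1 Vc <-> Vc `&` H10 = [set p | p.2 = 0]) &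
        (* (iv) *)
        forall V, V \in Vs ->
          chain_transitive (pflow theta phi1) (h1_image V) -> binfty V `<=` Vc].
Proof.
move=> B0 cB _ ctB af [Ms [uM memM leM ->]] Vsinf phi1.
have lf : linear_flow theta phi by case: af.
have lf1 : linear_flow theta phi1 := lift_linear_flow af.
have [|Ms1 spec1] := selgrade cB lf1 B0 ctB; first by rewrite dim_hilbert1.
have [lp [l0 [W [h1 h2 h3 h4 h5]]]] :=
  central_bundle cB B0 ctB lf lf1 uM memM leM spec1.
exists lp, l0, W; split => //; first by rewrite size_map.
by move=> V /mapP[M MM ->]; exact: h5.
Qed.
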